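(* Let $W$ be a finite Coxeter group (complexified finite real reflection group) with simple reflections $s_1,\dots,s_n$ and corresponding walls $H_i = \mathrm{Ker}(s_i-1)$, and let $\sigma_1,\dots,\sigma_n$ be the associated Artin generators of its braid group $B$. Then for every $h \in \mathbb{C}$ the assignment $\sigma_i \mapsto R_0(s_i)\exp(\mathrm{i}\pi h\, p_{H_i})$ defines a representation of $B$ on $\mathbb{C}\mathcal{A}$ which is equivalent to $R_h$. In particular, $R_1$ is equivalent to a representation of $W$ on $\mathbb{C}\mathcal{A}$ for which $s_i.v_H = v_{s_i(H)}$ if $H \neq H_i$ and $s_i.v_{H_i} = -v_{H_i}$; and $R_{h+2}$ is equivalent to $R_h$ for any $h \in \mathbb{C}$, while $R_1 \not\simeq R_0$.
   Context: Setting: $V_0$ is a nonzero real vector space of dimension $n$ with complexification $V$; $W \subset \mathrm{GL}(V_0) \subset \mathrm{GL}(V)$ is a finite real reflection group; $\mathcal{A}$ is the set of hyperplanes $\mathrm{Ker}(s-1) \subset V$, $s$ a reflection of $W$, assumed essential ($\bigcap\mathcal{A} = \{0\}$), the complexification of a real arrangement $\mathcal{A}_0$ in $V_0$. A $W$-invariant scalar product on $V_0$ is fixed and extended to a hermitian one on $V$. Choose a Weyl chamber $\mathcal{C}$, i.e. a connected component of $V_0 \setminus \bigcup\mathcal{A}_0$; it has $n$ walls $H_1,\dots,H_n$ and the reflections $s_i$ in the $H_i$ are the simple reflections. Braid group: $X = V \setminus \bigcup\mathcal{A}$, with base point $\underline{z} \in \mathcal{C}$; $B = \pi_1(X/W)$.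 Each $\sigma \in B$ lifts to a homotopy class of paths $\gamma_\sigma$ in $X$ from $\underline{z}$ to $\pi(\sigma).\underline{z}$, where $\pi : B \to W$ is the natural surjective morphism with kernel $\pi_1(X)$; the product $\sigma\tau$ lifts to $\gamma_\sigma$ followed by $\pi(\sigma).\gamma_\tau$. The Artin generator $\sigma_i$ is the class with $\pi(\sigma_i) = s_i$ whose lift is: the real straight segment $\gamma_0$ orthogonal to $H_i$ from $\underline{z} = \underline{z}^+ + \underline{z}^-$ ($\underline{z}^+ \in H_i$, $\underline{z}^- \perp H_i$) to $\underline{z}^+ + \varepsilon\underline{z}^-$ with $\varepsilon>0$ small, followed by $\gamma_1(t) = \underline{z}^+ + \varepsilon e^{\mathrm{i}\pi t}\underline{z}^-$, $t\in[0,1]$, followed by the reverse of $s_i.\gamma_0$. Representations: $\mathbb{C}\mathcal{A}$ has basis $(v_H)_{H\in\mathcal{A}}$, $R_0(w)v_H = v_{w(H)}$, and $p_H$ is the projector with $p_Hv_H = v_H$, $p_Hv_{H'} = 0$ for $H'\neq H$. With $\omega_H = d\alpha_H/\alpha_H$, where $\alpha_H \in V^*$ is any linear form with kernel $H$, define for $h \in \mathbb{C}$ $$R_h(\sigma) = \Big(\prod_{H \in \mathcal{A}} \exp\big(h\, p_H \int_{\gamma_\sigma} \omega_H\big)\Big) R_0(\pi(\sigma)),\qquad \sigma \in B,$$ the monodromy representation $B \to \mathrm{GL}(\mathbb{C}\mathcal{A})$ attached to the flat $W$-equivariant connection form $h\sum_H p_H\omega_H$. For $n \in \mathbb{Z}$,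 $R_n$ is trivial on $\pi_1(X)$ and hence is a representation of $W$. *)

(* Defs.v *)
From HB Require Import structures.
From mathcomp Require Import all_boot all_order all_algebra all_fingroup.
From mathcomp Require Import all_character generic_quotient.
From mathcomp Require Import all_classical all_reals all_analysis.
From mathcomp Require Import homotopy complex lra.

Set Implicit Arguments.
Unset Strict Implicit.
Unset Printing Implicit Defensive.

Import Order.TTheory GRing.Theory Num.Theory.
Import numFieldNormedType.Exports.

Local Open Scope classical_set_scope.
Local Open Scope ring_scope.
Local Open Scope quotient_scope.

Section UnitInterval.
Variable R : realType.

(* A two-pointed space, to be used as the domain of the library's paths. *)
Definition unit_itv : Type := set_type (`[0, 1]%classic : set R).
HB.instance Definition _ := Topological.on unit_itv.

Fact clamp01_subproof (t : R) :
  Num.max 0 (Num.min t 1) \in (`[0, 1]%classic : set R).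
Proof.
by apply/mem_set; rewrite /= in_itv /= le_max lexx ge_max ler01 ge_min lexx orbT.
Qed.

Definition clamp01 (t : R) : unit_itv :=
  exist _ (Num.max 0 (Num.min t 1)) (clamp01_subproof t).

Definition itv_val (t : unit_itv) : R := set_val t.

Lemma itv_val01 (t : unit_itv) : 0 <= itv_val t <= 1.
Proof. by have := set_mem (valP t); rewrite /= in_itv. Qed.

Lemma clamp01K (t : R) : 0 <= t <= 1 -> itv_val (clamp01 t) = t.
Proof. move=> /andP[t0 t1]; rewrite /itv_val /set_val /= min_l // max_r //. Qed.

Lemma itv_valK (t : unit_itv) : clamp01 (itv_val t) = t.
Proof. by apply: val_inj; exact: (clamp01K (itv_val01 t)). Qed.

Lemma clamp01_le0 (t : R) : t <= 0 -> clamp01 t = clamp01 0.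
Proof.
by move=> t0; apply: val_inj; rewrite /= !min_l ?ler01 ?(le_trans t0) // !max_l.
Qed.

Lemma clamp01_ge1 (t : R) : 1 <= t -> clamp01 t = clamp01 1.
Proof. by move=> t1; apply: val_inj; rewrite /= !min_r. Qed.

Fact clamp01_neq : clamp01 0 != clamp01 1.
Proof.
apply/eqP => /(congr1 itv_val); rewrite !clamp01K ?lexx ?ler01 // => /eqP.
by rewrite eq_sym oner_eq0.
Qed.

HB.instance Definition _ := isBiPointed.Build unit_itv clamp01_neq.

Lemma continuous_itv_val : continuous itv_val.
Proof. exact: initial_continuous. Qed.

Lemma continuous_clamp01 : continuous clamp01.
Proof.
apply: continuous_comp_initial => t.
have := @continuous_max R R (cst 0) (idfun \min cst 1) t.
apply; first exact: cvg_cst.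
by apply: continuous_min; [exact: cvg_id|exact: cvg_cst].
Qed.

Lemma continuous_glue (Y T : topologicalType) (a : Y -> R) (c : R)
    (f g : Y -> T) : continuous a -> continuous f -> continuous g ->
    (forall y, a y = c -> f y = g y) ->
  continuous (fun y => if a y <= c then f y else g y).
Proof.
move=> ca cf cg fg y.
suff gl U : nbhs (if a y <= c then f y else g y) U ->
    \forall z \near y, U (if a z <= c then f z else g z) by exact: gl.
have [ay|ay|ay] := ltgtP (a y) c.
- move=> /cf Uf; near=> z.
  have -> : a z <= c.
    by apply: ltW; near: z; exact: (cvgr_lt _ (ca y)).
  by near: z.
- move=> /cg Ug; near=> z.
  have /lt_geF -> : c < a z by near: z; exact: (cvgr_gt _ (ca y)).
  by near: z.
- move=> Uf; have Ug := Uf; rewrite (fg _ ay) in Ug.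
  near=> z; case: ifP => _; near: z; [exact: cf|exact: cg].
Unshelve. all: by end_near.
Qed.

End UnitInterval.


(* Homotopy classes of loops at x; the product p * q runs p first, then q. *)
Section FundamentalGroup.
Variables (R : realType) (T : topologicalType) (x : T).

Local Notation I := (unit_itv R).
Local Notation loop := {path I from x to x in T}.

Definition homotopic (p q : loop) : Prop := exists H : I * I -> T,
  [/\ continuous H,
      forall t, H (t, zero) = p t, forall t, H (t, one) = q t,
      forall s, H (zero, s) = x & forall s, H (one, s) = x].

Lemma itv_val0 : itv_val (zero : I) = 0.
Proof. by rewrite clamp01K // lexx ler01. Qed.

Lemma itv_val1 : itv_val (one : I) = 1.
Proof. by rewrite clamp01K // lexx ler01. Qed.

Definition itv_mapI (a : R -> R) (u : I) : I := clamp01 (a (itv_val u)).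

Lemma continuous_itv_mapI (a : R -> R) :
  continuous a -> continuous (itv_mapI a).
Proof.
move=> ca u; apply: (continuous_comp (f := a \o @itv_val R)).
  by apply: continuous_comp; [exact: continuous_itv_val|exact: ca].
exact: continuous_clamp01.
Qed.

Lemma continuous_pair_map (Y U V : topologicalType) (f : Y -> U) (g : Y -> V) :
  continuous f -> continuous g -> continuous (fun y => (f y, g y)).
Proof. by move=> cf cg y; apply: cvg_pair; [exact: cf|exact: cg]. Qed.

Lemma continuous_fst (U V : topologicalType) : continuous (@fst U V).
Proof. by move=> u; exact: cvg_fst. Qed.

Lemma continuous_snd (U V : topologicalType) : continuous (@snd U V).
Proof. by move=> u; exact: cvg_snd. Qed.

Lemma continuous_circ (U V Y : topologicalType) (f : U -> V) (g : V -> Y) :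
  continuous f -> continuous g -> continuous (g \o f).
Proof. by move=> cf cg u; apply: continuous_comp; [exact: cf|exact: cg]. Qed.

Lemma homotopic_refl (p : loop) : homotopic p p.
Proof.
exists (p \o fst); split=> //= [|_|_]; [|exact: path_zero|exact: path_one].
by apply: continuous_circ; [exact: continuous_fst|exact: cts_fun].
Qed.

Lemma continuous_onem : continuous (fun t : R => 1 - t).
Proof. by move=> t; apply: cvgB; [exact: cvg_cst|exact: cvg_id]. Qed.

Lemma continuous_affine (a b : R) : continuous (fun t : R => a * t + b).
Proof.
move=> t; apply: cvgD; last exact: cvg_cst.
by apply: cvgM; [exact: cvg_cst|exact: cvg_id].
Qed.

Lemma homotopic_sym (p q : loop) : homotopic p q -> homotopic q p.
Proof.
case=> H [cH H0 H1 Hz Ho].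
exists (fun u => H (u.1, itv_mapI (fun t => 1 - t) u.2)); split=> //=.
- apply: (continuous_circ _ cH); apply: continuous_pair_map.
    exact: continuous_fst.
  apply: continuous_circ; first exact: continuous_snd.
  exact/continuous_itv_mapI/continuous_onem.
- by move=> t; rewrite /itv_mapI itv_val0 subr0 -H1.
- by move=> t; rewrite /itv_mapI itv_val1 subrr -H0.
Qed.

Lemma homotopic_trans (q p r : loop) :
  homotopic p q -> homotopic q r -> homotopic p r.
Proof.
case=> H [cH H0 H1 Hz Ho] [K [cK K0 K1 Kz Ko]].
exists (fun u => if itv_val u.2 <= 2^-1
  then H (u.1, itv_mapI (fun t => 2 * t + 0) u.2)
  else K (u.1, itv_mapI (fun t => 2 * t + -1) u.2)); split.
- apply: (@continuous_glue R (I * I)%type T (fun u => itv_val u.2)).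
  + by apply: continuous_circ; [exact: continuous_snd|exact: continuous_itv_val].
  + apply: (continuous_circ _ cH); apply: continuous_pair_map.
      exact: continuous_fst.
    apply: continuous_circ; first exact: continuous_snd.
    exact/continuous_itv_mapI/continuous_affine.
  + apply: (continuous_circ _ cK); apply: continuous_pair_map.
      exact: continuous_fst.
    apply: continuous_circ; first exact: continuous_snd.
    exact/continuous_itv_mapI/continuous_affine.
  + move=> [t s] /= sE; rewrite /itv_mapI sE addr0 mulfV ?pnatr_eq0 // subrr.
    by rewrite [LHS]H1 [RHS]K0.
- by move=> t /=; rewrite itv_val0 invr_ge0 ler0n /itv_mapI itv_val0 mulr0 addr0 -H0.
- move=> t /=; rewrite itv_val1 /itv_mapI itv_val1 mulr1 ifF; last by lra.
  by rewrite [2 + -1](_ : _ = 1) ?[LHS]K1 //; lra.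
- by move=> s /=; rewrite Hz Kz if_same.
- by move=> s /=; rewrite Ho Ko if_same.
Qed.

Definition homotopicb (p q : loop) : bool := `[< homotopic p q >].

Fact homotopicb_equiv : equiv_class_of homotopicb.
Proof.
apply: EquivClass.
- by move=> p; apply/asboolP; exact: homotopic_refl.
- by move=> p q; apply/asboolP/asboolP; exact: homotopic_sym.
- move=> q p r /asboolP pq /asboolP qr; apply/asboolP.
  exact: homotopic_trans pq qr.
Qed.

Canonical homotopicb_rel := EquivRelPack homotopicb_equiv.

Definition fundamental_group : Type := {eq_quot homotopicb}.
HB.instance Definition _ := Choice.on fundamental_group.
HB.instance Definition _ := EqQuotient.on fundamental_group.

Definition loop_class (p : loop) : fundamental_group := \pi p.

Lemma loop_classP (p q : loop) :
  loop_class p = loop_class q <-> homotopic p q.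
Proof. by split=> [/eqmodP/asboolP|pq] //; apply/eqmodP/asboolP. Qed.

Section Concatenation.
Variables p q : loop.

Definition loop_cat_fun (t : I) : T :=
  if itv_val t <= 2^-1 then p (clamp01 (2 * itv_val t))
  else q (clamp01 (2 * itv_val t - 1)).

Fact loop_cat_cts : continuous loop_cat_fun.
Proof.
have -> : loop_cat_fun = fun t => if itv_val t <= 2^-1
    then p (itv_mapI (fun t => 2 * t + 0) t)
    else q (itv_mapI (fun t => 2 * t + -1) t).
  by apply/funext => t; rewrite /itv_mapI addr0.
apply: continuous_glue.
- exact: continuous_itv_val.
- apply: continuous_circ; last exact: cts_fun.
  exact/continuous_itv_mapI/continuous_affine.
- apply: continuous_circ; last exact: cts_fun.
  exact/continuous_itv_mapI/continuous_affine.
- move=> t tE; rewrite /itv_mapI tE addr0 mulfV ?pnatr_eq0 // subrr.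
  by rewrite [LHS]path_one [RHS]path_zero.
Qed.

Fact loop_cat_zero : loop_cat_fun zero = x.
Proof.
rewrite /loop_cat_fun itv_val0 invr_ge0 ler0n mulr0.
exact: (path_zero (s := p)).
Qed.

Fact loop_cat_one : loop_cat_fun one = x.
Proof.
rewrite /loop_cat_fun itv_val1 ifF; last by lra.
rewrite [2 * 1 - 1](_ : _ = 1); last by lra.
exact: (path_one (s := q)).
Qed.

Definition loop_cat : loop := mk_path loop_cat_cts loop_cat_zero loop_cat_one.

Lemma loop_catE (t : I) : loop_cat t =
  if itv_val t <= 2^-1 then p (clamp01 (2 * itv_val t))
  else q (clamp01 (2 * itv_val t - 1)).
Proof. by []. Qed.

Lemma loop_catEl (t : R) : 0 <= t <= 2^-1 ->
  loop_cat (clamp01 t) = p (clamp01 (2 * t)).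
Proof.
by move=> /andP[t0 t2]; rewrite loop_catE clamp01K ?t2 //; lra.
Qed.

Lemma loop_catEr (t : R) : 2^-1 < t <= 1 ->
  loop_cat (clamp01 t) = q (clamp01 (2 * t - 1)).
Proof.
by move=> /andP[t2 t1]; rewrite loop_catE clamp01K ?(lt_geF t2) //; lra.
Qed.

End Concatenation.

Section Reverse.
Variable p : loop.

Definition loop_rev_fun (t : I) : T := p (clamp01 (1 - itv_val t)).

Fact loop_rev_cts : continuous loop_rev_fun.
Proof.
apply: (@continuous_circ _ _ _ (itv_mapI (fun t => 1 - t)) p).
  exact/continuous_itv_mapI/continuous_onem.
exact: cts_fun.
Qed.

Fact loop_rev_zero : loop_rev_fun zero = x.
Proof. by rewrite /loop_rev_fun itv_val0 subr0; exact: (path_one (s := p)). Qed.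

Fact loop_rev_one : loop_rev_fun one = x.
Proof. by rewrite /loop_rev_fun itv_val1 subrr; exact: (path_zero (s := p)). Qed.

Definition loop_rev : loop := mk_path loop_rev_cts loop_rev_zero loop_rev_one.

Lemma loop_revE (t : I) : loop_rev t = p (clamp01 (1 - itv_val t)).
Proof. by []. Qed.

End Reverse.

Definition loop_cst : loop := cst x.

Lemma homotopic_reparam (p l m : loop) (a b : R -> R) :
  continuous a -> continuous b -> a 0 = b 0 -> a 1 = b 1 ->
  (forall t, l t = p (clamp01 (a (itv_val t)))) ->
  (forall t, m t = p (clamp01 (b (itv_val t)))) -> homotopic l m.
Proof.
move=> ca cb ab0 ab1 lE mE.
pose A (u : I * I) : R := a (itv_val u.1).
pose B (u : I * I) : R := b (itv_val u.1).
pose S (u : I * I) : R := itv_val u.2.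
have cA : continuous A.
  apply: continuous_circ; last exact: ca.
  by apply: continuous_circ; [exact: continuous_fst|exact: continuous_itv_val].
have cB : continuous B.
  apply: continuous_circ; last exact: cb.
  by apply: continuous_circ; [exact: continuous_fst|exact: continuous_itv_val].
have cS : continuous S.
  by apply: continuous_circ; [exact: continuous_snd|exact: continuous_itv_val].
exists (fun u : I * I => p (clamp01 (A u + S u * (B u - A u)))); split.
- apply: (@continuous_circ _ _ _ (fun u => clamp01 (A u + S u * (B u - A u))) p);
    last exact: cts_fun.
  apply: (@continuous_circ _ _ _ (fun u => A u + S u * (B u - A u)) (@clamp01 R)).
    move=> u; apply: cvgD; first exact: cA.
    by apply: cvgM; [exact: cS|apply: cvgB; [exact: cB|exact: cA]].
  exact: continuous_clamp01.
- by move=> t; rewrite /S itv_val0 mul0r addr0 lE.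
- by move=> t; rewrite /S itv_val1 mul1r addrC subrK mE.
- move=> s; rewrite /A /B /= itv_val0 ab0 subrr mulr0 addr0 -ab0.
  by rewrite -itv_val0 -lE path_zero.
- move=> s; rewrite /A /B /= itv_val1 ab1 subrr mulr0 addr0 -ab1.
  by rewrite -itv_val1 -lE path_one.
Qed.

Lemma homotopic_cat (p p' q q' : loop) :
  homotopic p p' -> homotopic q q' ->
  homotopic (loop_cat p q) (loop_cat p' q').
Proof.
case=> H [cH H0 H1 Hz Ho] [K [cK K0 K1 Kz Ko]].
exists (fun u => if itv_val u.1 <= 2^-1
  then H (itv_mapI (fun t => 2 * t + 0) u.1, u.2)
  else K (itv_mapI (fun t => 2 * t + -1) u.1, u.2)); split.
- apply: (@continuous_glue R (I * I)%type T (fun u => itv_val u.1)).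
  + by apply: continuous_circ; [exact: continuous_fst|exact: continuous_itv_val].
  + apply: (continuous_circ _ cH); apply: continuous_pair_map;
      last exact: continuous_snd.
    apply: continuous_circ; first exact: continuous_fst.
    exact/continuous_itv_mapI/continuous_affine.
  + apply: (continuous_circ _ cK); apply: continuous_pair_map;
      last exact: continuous_snd.
    apply: continuous_circ; first exact: continuous_fst.
    exact/continuous_itv_mapI/continuous_affine.
  + move=> [t s] /= sE; rewrite /itv_mapI sE addr0 mulfV ?pnatr_eq0 // subrr.
    by rewrite [LHS]Ho [RHS]Kz.
- by move=> t; rewrite H0 K0 /itv_mapI addr0.
- by move=> t; rewrite H1 K1 /itv_mapI addr0.
- by move=> s; rewrite /= itv_val0 invr_ge0 ler0n /itv_mapI itv_val0 mulr0 addr0 [LHS]Hz.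
- move=> s; rewrite /= itv_val1 ifF; last by lra.
  rewrite /itv_mapI itv_val1 [2 * 1 + -1](_ : _ = 1); last by lra.
  by rewrite [LHS]Ko.
Qed.

Lemma homotopic_rev (p q : loop) :
  homotopic p q -> homotopic (loop_rev p) (loop_rev q).
Proof.
case=> H [cH H0 H1 Hz Ho].
exists (fun u => H (itv_mapI (fun t => 1 - t) u.1, u.2)); split.
- apply: (continuous_circ _ cH); apply: continuous_pair_map;
    last exact: continuous_snd.
  apply: continuous_circ; first exact: continuous_fst.
  exact/continuous_itv_mapI/continuous_onem.
- by move=> t; rewrite H0.
- by move=> t; rewrite H1.
- by move=> s; rewrite /itv_mapI itv_val0 subr0 [LHS]Ho.
- by move=> s; rewrite /itv_mapI itv_val1 subrr [LHS]Hz.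
Qed.

Let continuous_maxf (f g : R -> R) :
  continuous f -> continuous g -> continuous (f \max g).
Proof. by move=> cf cg t; apply: continuous_max; [exact: cf|exact: cg]. Qed.

Let continuous_minf (f g : R -> R) :
  continuous f -> continuous g -> continuous (f \min g).
Proof. by move=> cf cg t; apply: continuous_min; [exact: cf|exact: cg]. Qed.

Let continuous_double : continuous (fun t : R => 2 * t).
Proof.
by move=> t; apply: cvgM; [exact: cvg_cst|exact: cvg_id].
Qed.

Lemma loop_cat_cstr (p : loop) : homotopic (loop_cat p loop_cst) p.
Proof.
apply: (@homotopic_reparam p _ _ ((fun t => 2 * t) \min cst 1) id).
- by apply: continuous_minf => //; exact: cst_continuous.
- by move=> t; exact: cvg_id.
- by rewrite /= mulr0 min_l // ler01.
- by rewrite /= mulr1 min_r // ler1n.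
- move=> t; rewrite loop_catE /=.
  case: leP => t2; first by rewrite min_l //; lra.
  by rewrite min_r ?[RHS]path_one //; lra.
- by move=> t; rewrite itv_valK.
Qed.

Lemma loop_cat_cstl (p : loop) : homotopic (loop_cat loop_cst p) p.
Proof.
apply: (@homotopic_reparam p _ _ (cst 0 \max (fun t => 2 * t + -1)) id).
- by apply: continuous_maxf; [exact: cst_continuous|exact: continuous_affine].
- by move=> t; exact: cvg_id.
- by rewrite /= max_l //; lra.
- by rewrite /= max_r //; lra.
- move=> t; rewrite loop_catE /=.
  case: leP => t2; last by rewrite max_r //; lra.
  by rewrite max_l ?[RHS]path_zero //; lra.
- by move=> t; rewrite itv_valK.
Qed.

Lemma loop_cat_revr (p : loop) : homotopic (loop_cat p (loop_rev p)) loop_cst.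
Proof.
apply: (@homotopic_reparam p _ _
  ((fun t => 2 * t) \min (fun t => -2 * t + 2)) (cst 0)).
- by apply: continuous_minf => //; exact: continuous_affine.
- exact: cst_continuous.
- by rewrite /= mulr0 min_l //; lra.
- by rewrite /= min_r //; lra.
- move=> t; rewrite loop_catE /=.
  have /andP[t0 t1] := itv_val01 t.
  case: leP => t2; first by rewrite min_l //; lra.
  rewrite loop_revE clamp01K; last by lra.
  by rewrite min_r; [congr (p (clamp01 _)); lra|lra].
- by move=> t; rewrite [RHS]path_zero.
Qed.

Lemma loop_revK (p : loop) : homotopic (loop_rev (loop_rev p)) p.
Proof.
apply: (@homotopic_reparam p _ _ id id) => //; try by move=> t; exact: cvg_id.
- move=> t; have /andP[t0 t1] := itv_val01 t.
  by rewrite !loop_revE clamp01K; [congr (p (clamp01 _)); lra|lra].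
- by move=> t; rewrite itv_valK.
Qed.

Lemma loop_cat_assoc (p q r : loop) :
  homotopic (loop_cat p (loop_cat q r)) (loop_cat (loop_cat p q) r).
Proof.
apply: homotopic_sym.
apply: (@homotopic_reparam (loop_cat p (loop_cat q r)) _ _
  (((fun t => 2 * t) \min (fun t => 1 * t + 4^-1)) \min
     (fun t => 2^-1 * t + 2^-1)) id).
- apply: continuous_minf; last exact: continuous_affine.
  by apply: continuous_minf => //; exact: continuous_affine.
- by move=> t; exact: cvg_id.
- by rewrite /= !min_l //; lra.
- by rewrite /= !min_r //; lra.
- move=> u; have /andP[t0 t1] := itv_val01 u.
  rewrite -{1}[u]itv_valK; move: (itv_val u) t0 t1 => {u} t t0 t1 /=.
  have [t2|t2] := leP t 2^-1; last first.
    rewrite [LHS]loop_catEr; last by lra.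
    rewrite [Num.min _ (_ + 2^-1)]min_r; last by rewrite le_min; lra.
    rewrite loop_catEr; last by lra.
    rewrite loop_catEr; last by lra.
    by congr (r (clamp01 _)); lra.
  rewrite [LHS]loop_catEl; last by lra.
  have [t4|t4] := leP (2 * t) 2^-1.
    rewrite loop_catEl; last by lra.
    rewrite [Num.min (2 * _) _]min_l; last by lra.
    rewrite min_l; last by lra.
    by rewrite loop_catEl //; lra.
  rewrite [LHS]loop_catEr; last by lra.
  rewrite [Num.min (2 * _) _]min_r; last by lra.
  rewrite min_l; last by lra.
  rewrite loop_catEr; last by lra.
  rewrite loop_catEl; last by lra.
  by congr (q (clamp01 _)); lra.
- by move=> t; rewrite itv_valK.
Qed.

Definition fundamental_group_mul (a b : fundamental_group) :=
  loop_class (loop_cat (repr a) (repr b)).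
Definition fundamental_group_inv (a : fundamental_group) :=
  loop_class (loop_rev (repr a)).
Definition fundamental_group_one := loop_class loop_cst.

Lemma repr_loop_class (p : loop) : homotopic (repr (loop_class p)) p.
Proof. by apply/loop_classP; rewrite /loop_class reprK. Qed.

Lemma fundamental_group_mulE (p q : loop) :
  fundamental_group_mul (loop_class p) (loop_class q) =
  loop_class (loop_cat p q).
Proof. by apply/loop_classP/homotopic_cat; exact: repr_loop_class. Qed.

Lemma fundamental_group_invE (p : loop) :
  fundamental_group_inv (loop_class p) = loop_class (loop_rev p).
Proof. by apply/loop_classP/homotopic_rev; exact: repr_loop_class. Qed.

Lemma loop_classW (P : fundamental_group -> Prop) :
  (forall p, P (loop_class p)) -> forall a, P a.
Proof. by move=> Pp a; rewrite -[a]reprK; exact: Pp. Qed.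

Fact fundamental_group_mulA : associative fundamental_group_mul.
Proof.
elim/loop_classW => p; elim/loop_classW => q; elim/loop_classW => r.
rewrite !fundamental_group_mulE.
by apply/loop_classP; exact: loop_cat_assoc.
Qed.

Fact fundamental_group_mul1 : left_id fundamental_group_one fundamental_group_mul.
Proof.
elim/loop_classW => p; rewrite fundamental_group_mulE.
by apply/loop_classP; exact: loop_cat_cstl.
Qed.

Fact fundamental_group_mulr1 :
  right_id fundamental_group_one fundamental_group_mul.
Proof.
elim/loop_classW => p; rewrite fundamental_group_mulE.
by apply/loop_classP; exact: loop_cat_cstr.
Qed.

Fact fundamental_group_mulrV : right_inverse fundamental_group_one
  fundamental_group_inv fundamental_group_mul.
Proof.
elim/loop_classW => p; rewrite fundamental_group_invE fundamental_group_mulE.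
by apply/loop_classP; exact: loop_cat_revr.
Qed.

Fact fundamental_group_mulVr : left_inverse fundamental_group_one
  fundamental_group_inv fundamental_group_mul.
Proof.
elim/loop_classW => p; rewrite fundamental_group_invE fundamental_group_mulE.
apply/loop_classP.
apply: homotopic_trans (loop_cat_revr (loop_rev p)).
by apply: homotopic_cat; [exact: homotopic_refl|apply/homotopic_sym/loop_revK].
Qed.

HB.instance Definition _ := isGroup.Build fundamental_group
  fundamental_group_mulA fundamental_group_mul1 fundamental_group_mulr1
  fundamental_group_mulVr fundamental_group_mulrV.

End FundamentalGroup.

Local Open Scope complex_scope.

(* The library only puts the norm topology on R[i]^o; carry it over to R[i], so
   that vectors and matrices over R[i] are topological spaces. *)
#[non_forgetful_inheritance]
HB.instance Definition _ (R : realType) := GRing.ComAlgebra.copy R[i] R[i]^o.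
#[non_forgetful_inheritance]
HB.instance Definition _ (R : realType) := Vector.copy R[i] R[i]^o.
#[non_forgetful_inheritance]
HB.instance Definition _ (R : realType) := NormedModule.copy R[i] R[i]^o.

Section MatrixRepresentations.
Variables (R : realType) (d : nat).

Definition mxexp (A : 'M[R[i]]_d) : 'M[R[i]]_d :=
  limn (series (fun k => (k`!%:R)^-1 *: A ^+ k)).

Definition is_representation (B : groupType) (rho : B -> 'M[R[i]]_d) : Prop :=
  rho 1%g = 1%:M /\ forall a b, rho (a * b)%g = rho a *m rho b.

Definition equivalent_rep (B : Type) (rho rho' : B -> 'M[R[i]]_d) : Prop :=
  exists2 P : 'M[R[i]]_d, P \in unitmx &
    forall b, P *m rho b = rho' b *m P.

End MatrixRepresentations.

(* V0 = R^n carries a faithful representation rW of W, acting on column vectors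
   on the left, and V = C^n is its complexification.  The invariant scalar product
   of V0 is arbitrary, so fixing a basis of V0 loses no generality. *)
Section ReflectionArrangement.
Variables (R : realType) (n : nat) (W : finGroupType).
Variable rW : mx_representation R [set: W]%G n.

Local Notation V0 := 'cV[R]_n.
Local Notation V := 'cV[R[i]]_n.
Local Notation I := (unit_itv R).

Definition cplx (x : V0) : V := map_mx (real_complex R) x.

Definition W_mx (w : W) : 'M[R[i]]_n := map_mx (real_complex R) (rW w).

Definition W_act (w : W) (v : V) : V := W_mx w *m v.

(* W is a finite group, so this says exactly that Ker(s - 1) is a hyperplane and
   s has finite order. *)
Definition is_reflection (s : W) : bool := \rank (rW s - 1%:M) == 1%N.

Definition is_reflection_group : Prop :=
  mx_faithful rW /\ <<[set s | is_reflection s]%SET>>%g = [set: W]%SET.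

Definition fix_space (w : W) : {vspace V} :=
  lker (linfun (mulmx (W_mx w - 1%:M) : V -> V)).

Definition arrangement : seq {vspace V} :=
  [seq fix_space s | s <- enum W & is_reflection s].

(* Elements are the distinct subspaces Ker(s - 1) of V, s a reflection of W. *)
Definition hyperplane : predArgType := seq_sub arrangement.
HB.instance Definition _ := Finite.on hyperplane.

Definition hyperplane_space (H : hyperplane) : {vspace V} := ssval H.
Coercion hyperplane_space : hyperplane >-> space.

Lemma fix_spaceP (w : W) (v : V) : reflect (W_act w v = v) (v \in fix_space w).
Proof.
rewrite memv_ker lfunE /= mulmxBl mul1mx subr_eq0; exact: eqP.
Qed.

Lemma W_act1 (v : V) : W_act 1%g v = v.
Proof. by rewrite /W_act /W_mx repr_mx1 map_mx1 mul1mx. Qed.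

Lemma W_actM (w w' : W) (v : V) : W_act (w * w')%g v = W_act w (W_act w' v).
Proof. by rewrite /W_act /W_mx repr_mxM ?inE // map_mxM mulmxA. Qed.

Lemma W_actK (w : W) : cancel (W_act w) (W_act w^-1%g).
Proof. by move=> v; rewrite -W_actM mulVg W_act1. Qed.

Lemma W_actVK (w : W) : cancel (W_act w^-1%g) (W_act w).
Proof. by move=> v; rewrite -W_actM mulgV W_act1. Qed.

Lemma is_reflectionJ (s w : W) : is_reflection (s ^ w)%g = is_reflection s.
Proof.
have uw u : rW u \in unitmx by apply: repr_mx_unit; rewrite inE.
rewrite /is_reflection conjgE !repr_mxM ?inE //.
have -> : rW (w^-1)%g *m (rW s *m rW w) - 1%:M =
          rW (w^-1)%g *m (rW s - 1%:M) *m rW w.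
  rewrite mulmxBr mulmx1 mulmxBl mulmxA; congr (_ - _).
  by rewrite -repr_mxM ?inE // mulVg repr_mx1.
by rewrite mxrankMfree ?row_free_unit // eqmxMfull // row_full_unit.
Qed.

Definition image_space (w : W) (U : {vspace V}) : {vspace V} :=
  (linfun (mulmx (W_mx w) : V -> V) @: U)%VS.

Lemma image_spaceP (w : W) (U : {vspace V}) (v : V) :
  (v \in image_space w U) = (W_act w^-1%g v \in U).
Proof.
apply/memv_imgP/idP => [[u Uu ->]|Uv].
  by rewrite lfunE /= -/(W_act w u) W_actK.
by exists (W_act w^-1%g v) => //; rewrite lfunE /= -/(W_act w _) W_actVK.
Qed.

Fact image_space_arrangement (w : W) (H : hyperplane) :
  image_space w H \in arrangement.
Proof.
case: H => U /= /mapP[s]; rewrite mem_filter => /andP[rs _] ->.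
apply/mapP; exists (s ^ w^-1)%g.
  by rewrite mem_filter is_reflectionJ rs mem_enum inE.
apply/vspaceP => v; rewrite image_spaceP.
apply/fix_spaceP/fix_spaceP => [vE|].
  by rewrite conjgE invgK !W_actM vE W_actVK.
by rewrite conjgE invgK !W_actM => {2}<-; rewrite W_actK.
Qed.

Definition hyperplane_act (w : W) (H : hyperplane) : hyperplane :=
  SeqSub (image_space_arrangement w H).

Definition is_essential : Prop := (\bigcap_(H : hyperplane) H)%VS = 0%VS.

(* G is the Gram matrix of the scalar product. *)
Definition invariant_scalar_product (G : 'M[R]_n) : Prop :=
  [/\ G^T = G, forall x : V0, x != 0 -> 0 < (x^T *m G *m x) 0 0
    & forall w, (rW w)^T *m G *m rW w = G].

Definition arr_complement : set V := [set v | forall H : hyperplane, v \notin H].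

(* V0 minus the real hyperplanes H `&` V0. *)
Definition real_complement : set V0 := cplx @^-1` arr_complement.

Definition is_chamber (C : set V0) : Prop :=
  exists2 x, real_complement x & C = connected_component real_complement x.

(* H `&` closure C spans H `&` V0, i.e. it is a face of C of codimension one. *)
Definition is_wall (C : set V0) (H : hyperplane) : Prop :=
  forall U : {vspace V0},
    (forall x, closure C x -> cplx x \in H -> x \in U) ->
    forall x, cplx x \in H -> x \in U.

Definition cplx_point (x : real_complement) : arr_complement :=
  exist _ (cplx (set_val x)) (mem_set (set_mem (valP x))).

Definition orbit_relb (x y : arr_complement) : bool :=
  [exists w : W, set_val y == W_act w (set_val x)].

Fact orbit_relb_equiv : equiv_class_of orbit_relb.
Proof.
apply: EquivClass => [x|x y|y x t].
- by apply/existsP; exists 1%g; rewrite W_act1.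
- by apply/existsP/existsP => -[w /eqP ->]; exists w^-1%g; rewrite W_actK.
- move=> /existsP[w /eqP yE] /existsP[w' /eqP tE].
  by apply/existsP; exists (w' * w)%g; rewrite W_actM -yE tE.
Qed.

Canonical orbit_rel := EquivRelPack orbit_relb_equiv.

Definition orbit_space := quotient_topology {eq_quot orbit_relb}.
HB.instance Definition _ := Topological.on orbit_space.
HB.instance Definition _ := Quotient.on orbit_space.

Definition to_orbit (x : arr_complement) : orbit_space := \pi_orbit_space x.

(* Being C^1 up to both endpoints of [a, b]. *)
Definition C1_between (a b : R) (f : R -> R) : Prop :=
  exists g : R -> R, [/\ forall t, derivable g t 1, continuous (derive1 g)
    & {in `[a, b], f =1 g}].

Definition piecewise_C1 (f : R -> R) : Prop :=
  exists2 s : seq R, itv_partition 0 1 s &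
    forall k, (k < size s)%N ->
      C1_between (nth 0 (0 :: s) k) (nth 0 s k) f.

Definition piecewise_C1_path (g : R -> V) : Prop := forall j,
  piecewise_C1 (fun t => complex.Re (g t j 0)) /\
  piecewise_C1 (fun t => complex.Im (g t j 0)).

(* The junk values of derive1 at the finitely many breakpoints of a piecewise C^1
   path do not affect the integrals below. *)
Definition velocity (g : R -> V) (t : R) : V :=
  \col_j (derive1 (fun u => complex.Re (g u j 0)) t +i*
          derive1 (fun u => complex.Im (g u j 0)) t).

Definition integral01 (f : R -> R[i]) : R[i] :=
  (\int[lebesgue_measure]_(t in `[0, 1]) complex.Re (f t)) +i*
  (\int[lebesgue_measure]_(t in `[0, 1]) complex.Im (f t)).

(* The integral of d(a)/a along the path g : [0, 1] -> V. *)
Definition integral_dlog (a : 'Hom(V, R[i])) (g : R -> V) : R[i] :=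
  integral01 (fun t => a (velocity g t) / a (g t)).

Local Notation d := #|hyperplane|.

Definition basis_vec (H : hyperplane) : 'cV[R[i]]_d :=
  delta_mx (enum_rank H) 0.

Definition permutation_rep (w : W) : 'M[R[i]]_d :=
  \matrix_(a, b) (enum_val a == hyperplane_act w (enum_val b))%:R.

Definition hyperplane_proj (H : hyperplane) : 'M[R[i]]_d :=
  delta_mx (enum_rank H) (enum_rank H).

Section BraidGroup.
Variable z : real_complement.

Definition braid_group : groupType :=
  fundamental_group R (to_orbit (cplx_point z)).

(* g is a path in X starting at z whose image in X/W is a loop of class sigma. *)
Definition is_lift (sigma : braid_group) (g : I -> arr_complement) : Prop :=
  [/\ continuous g, g zero = cplx_point z &
    exists l, loop_class l = sigma /\ forall t, l t = to_orbit (g t)].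

Definition path_of (g : I -> arr_complement) (t : R) : V :=
  set_val (g (clamp01 t)).

(* Any two lifts are homotopic in X with fixed endpoints; a piecewise C^1 one is
   picked so that closed 1-forms can be integrated along it. *)
Definition braid_lift (sigma : braid_group) : I -> arr_complement :=
  xget (cst (cplx_point z))
    [set g | is_lift sigma g /\ piecewise_C1_path (path_of g)].

Definition braid_proj (sigma : braid_group) : W :=
  xget 1%g [set w | exists2 g, is_lift sigma g &
                      set_val (g one) = W_act w (cplx (set_val z))].

(* The three successive pieces of the lift of an Artin generator, each run over
   one third of [0, 1]. *)
Definition artin_path (s : W) (xp xm : V0) (eps t : R) : V :=
  if t <= 3^-1 then cplx (xp + (1 - (1 - eps) * (3 * t)) *: xm)
  else if t <= 2 / 3 then
    cplx xp + (eps%:C * (cos (pi * (3 * t - 1)) +i* sin (pi * (3 * t - 1))))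
              *: cplx xm
  else W_act s (cplx (xp + (1 - (1 - eps) * (3 - 3 * t)) *: xm)).

Definition is_artin_generator (G : 'M[R]_n) (H : hyperplane) (s : W)
    (sigma : braid_group) : Prop :=
  braid_proj sigma = s /\
  exists xp xm : V0,
    [/\ set_val z = xp + xm, cplx xp \in H,
        forall y, cplx y \in H -> y^T *m G *m xm = 0
      & \forall eps \near 0^'+, exists2 g, is_lift sigma g &
          forall t, set_val (g t) = artin_path s xp xm eps (itv_val t)].

Definition monodromy (alpha : hyperplane -> 'Hom(V, R[i])) (h : R[i])
    (sigma : braid_group) : 'M[R[i]]_d :=
  (\prod_(H : hyperplane)
     mxexp ((h * integral_dlog (alpha H) (path_of (braid_lift sigma)))
            *: hyperplane_proj H))
  *m permutation_rep (braid_proj sigma).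

End BraidGroup.

End ReflectionArrangement.

(* Main.v *)
(* All matrices involved are monomial: R_h(sigma) has entry exp (h J_H(sigma)) at
   (H, pi(sigma)^-1 H), where J_H(sigma) is the integral of omega_H along a lift of
   sigma, a cocycle with exp (J_H(sigma)) = alpha_H(pi(sigma) z) / alpha_H(z).

   Let nu_H = <z, a_H> be the distance from z to H, a_H being the unit normal of H on
   the side of z.  Since s_i z and z lie on the same side of every wall H <> H_i, the
   explicit lift of sigma_i gives J_H(sigma_i) = ln (nu_(s_i H) / nu_H) for H <> H_i
   and J_H(sigma_i) = i pi for H = H_i.  Hence conjugation by diag (nu_H^h) turns
   R_h(sigma_i) into R_0(s_i) exp (i pi h p_(H_i)).  Likewise diag (nu_H) turns R_1 into
   a representation of W by signs, and diag (nu_H^2) intertwines R_(h+2) and R_h.  The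
   traces of R_1(sigma_i) and R_0(sigma_i) differ by 2.

   J_H(sigma) does not depend on the lift: W acts freely on the complement, so that
   two lifts whose images in the orbit space are uniformly close remain close, and
   their values under alpha_H have a ratio with positive real part, hence a canonical
   logarithm; a homotopy is cut into finitely many such steps. *)
From HB Require Import structures.
Require Import Defs.
From mathcomp Require Import all_boot all_order all_algebra all_fingroup.
From mathcomp Require Import all_character generic_quotient.
From mathcomp Require Import all_classical all_reals all_analysis.
From mathcomp Require Import measurable_realfun homotopy complex ring lra.

Set Implicit Arguments.
Unset Strict Implicit.
Unset Printing Implicit Defensive.

Import Order.TTheory GRing.Theory Num.Theory.
Import numFieldNormedType.Exports.

Local Open Scope classical_set_scope.
Local Open Scope ring_scope.
Local Open Scope complex_scope.
Local Open Scope quotient_scope.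

(** [monodromy] integrates along a chosen piecewise C^1 lift, and the lift chosen for a product is
    not the concatenation of the chosen lifts. Even the multiplicativity of R_h thus rests on
    independence of the lift. So J_H is characterised as the final value of any continuous logarithm
    of alpha_H / alpha_H(z) along any continuous lift, starting at 0; the integral serves only to
    produce one such logarithm.

    A loop in the orbit space gives orbits with arbitrary, jumping representatives. Continuity is
    therefore measured modulo W with a W-invariant norm, and lifting proceeds by steps that are
    small compared with the distance between distinct points of one orbit.

    Freeness of the action is the algebraic core. It follows from the exchange condition, phrased
    through the hyperplanes that separate a regular vector from its image. The same notion defines
    simple reflections: only their own hyperplane separates. Walls have this property, which is why
    z and s_i z lie on the same side of the other hyperplanes.

    As z and its images are real, exp(J_H(sigma)) is a sign times nu_(w^-1 H) / nu_H with w =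
    pi(sigma). These signs form a cocycle on W. *)

Local Notation Re := complex.Re.
Local Notation Im := complex.Im.

(** * The complex exponential and continuous logarithms *)

Section ComplexExponential.
Variable R : realType.
Implicit Types (a b c d : R[i]) (t : R).

Lemma cReM a b : Re (a * b) = Re a * Re b - Im a * Im b.
Proof. by case: a b => [? ?] [? ?]. Qed.

Lemma cImM a b : Im (a * b) = Re a * Im b + Im a * Re b.
Proof. by case: a b => [? ?] [? ?]. Qed.

Lemma cReD a b : Re (a + b) = Re a + Re b.
Proof. by case: a b => [? ?] [? ?]. Qed.

Lemma cImD a b : Im (a + b) = Im a + Im b.
Proof. by case: a b => [? ?] [? ?]. Qed.

Lemma cReN a : Re (- a) = - Re a.
Proof. by case: a. Qed.

Lemma cImN a : Im (- a) = - Im a.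
Proof. by case: a. Qed.

Lemma complex_eqP a b : Re a = Re b -> Im a = Im b -> a = b.
Proof. by case: a b => [? ?] [? ?] /= -> ->. Qed.

Lemma Re_sum I (r : seq I) (P : pred I) (F : I -> R[i]) :
  Re (\sum_(i <- r | P i) F i) = \sum_(i <- r | P i) Re (F i).
Proof. by apply: (big_morph (@complex.Re R)) => //; exact: cReD. Qed.

Lemma Im_sum I (r : seq I) (P : pred I) (F : I -> R[i]) :
  Im (\sum_(i <- r | P i) F i) = \sum_(i <- r | P i) Im (F i).
Proof. by apply: (big_morph (@complex.Im R)) => //; exact: cImD. Qed.

(** The closed form e^x (cos y + i sin y). [mxexp] is a limit of partial sums, and the two are
    reconciled in [cvg_series_cexp]. *)
Definition cexp c : R[i] :=
  (expR (Re c) * cos (Im c)) +i* (expR (Re c) * sin (Im c)).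

Lemma cexpD a b : cexp (a + b) = cexp a * cexp b.
Proof.
by apply: complex_eqP; rewrite ?cReM ?cImM /= ?cReD ?cImD expRD ?cosD ?sinD; ring.
Qed.

Lemma cexp0 : cexp 0 = 1.
Proof. by apply: complex_eqP; rewrite /= expR0 ?cos0 ?sin0 ?mul1r. Qed.

Lemma cexp_neq0 a : cexp a != 0.
Proof.
apply/eqP => ea; have := cexpD a (- a); rewrite subrr cexp0 ea mul0r => /eqP.
by rewrite oner_eq0.
Qed.

Lemma cexpN a : cexp (- a) = (cexp a)^-1.
Proof.
apply: (mulfI (cexp_neq0 a)); rewrite -cexpD subrr cexp0 divff //.
exact: cexp_neq0.
Qed.

(** Coefficients of the real power series of t |-> Re (d exp(t c)). The factor [d] makes the family
    stable under differentiation, which replaces [d] by [d * c]; taking [d] = 1 and [d] = i gives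
    the real part and minus the imaginary part. *)
Let pcoef d c (k : nat) : R := Re (d * c ^+ k) / k`!%:R.

Let pcoef_diffs d c : pseries_diffs (pcoef d c) = pcoef (d * c) c.
Proof.
apply/funext => k; rewrite /pseries_diffs /pcoef factS natrM exprS mulrA.
by rewrite mulrCA invfM [_.+1%:R * _]mulrA mulfV ?pnatr_eq0 // mul1r.
Qed.

Let ler_normc_Re a : `|Re a| <= ComplexField.Normc.normc a.
Proof.
case: a => x y /=; rewrite -sqrtr_sqr ler_wsqrtr // lerDl; exact: sqr_ge0.
Qed.

Let normc_ge0 a : 0 <= ComplexField.Normc.normc a.
Proof. exact: le_trans (normr_ge0 _) (ler_normc_Re a). Qed.

Let normcX a k :
  ComplexField.Normc.normc (a ^+ k) = ComplexField.Normc.normc a ^+ k.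
Proof.
elim: k => [|k IH]; first exact: ComplexField.Normc.normc1.
by rewrite !exprS ComplexField.Normc.normcM IH.
Qed.

Let is_cvg_pcoef d c t : cvgn (pseries (pcoef d c) t).
Proof.
apply: normed_cvg; set M := ComplexField.Normc.normc d.
apply: (@series_le_cvg _ _
  (fun k => M * exp_coeff (ComplexField.Normc.normc c * `|t|) k)).
- by move=> k; rewrite normr_ge0.
- move=> k; rewrite mulr_ge0 ?normc_ge0 // exp_coeff_ge0 //.
  by rewrite mulr_ge0 ?normc_ge0.
- move=> k; rewrite /pcoef /exp_coeff /= !normrM normrX normfV.
  rewrite (@ger0_norm _ k`!%:R) // exprMn.
  rewrite [leRHS](_ : _ = M * ComplexField.Normc.normc c ^+ k / k`!%:R * `|t| ^+ k);
    last by ring.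
  rewrite ler_wpM2r ?exprn_ge0 // ler_wpM2r ?invr_ge0 //.
  apply: le_trans (ler_normc_Re _) _.
  by rewrite ComplexField.Normc.normcM normcX.
- have -> : (fun k => M * exp_coeff (ComplexField.Normc.normc c * `|t|) k) =
      M *: exp_coeff (ComplexField.Normc.normc c * `|t|) by [].
  rewrite seriesZ; apply: is_cvgZr; exact: is_cvg_series_exp_coeff.
Qed.

Let psum d c t : R := limn (pseries (pcoef d c) t).

Let is_derive_psum d c t : is_derive t 1 (psum d c) (psum (d * c) c t).
Proof.
rewrite /psum -pcoef_diffs; apply: (@pseries_snd_diffs _ _ (`|t| + 1)).
- exact: is_cvg_pcoef.
- rewrite pcoef_diffs; exact: is_cvg_pcoef.
- rewrite !pcoef_diffs; exact: is_cvg_pcoef.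
- by rewrite [`|_ + 1|]ger0_norm ?addr_ge0 // ltrDl.
Qed.

Let psum_linear d c x y : psum (d * (x +i* y)) c =
  (fun t => x * psum d c t + y * psum (d * 'i) c t).
Proof.
apply/funext => t; rewrite /psum.
have -> : pseries (pcoef (d * (x +i* y)) c) t =
    (x *: pseries (pcoef d c) t) + (y *: pseries (pcoef (d * 'i) c) t).
  rewrite /pseries -!seriesZ -seriesD; congr series.
  apply/funext => k; rewrite /= !fctE.
  rewrite /GRing.scale /= /pcoef.
  rewrite [d * (x +i* y)](_ : _ = x%:C * d + y%:C * (d * 'i)); last first.
    case: d => d1 d2; simpc; congr (_ +i* _); ring.
  rewrite mulrDl cReD -!mulrA !(@cReM _%:C) /= !mul0r !subr0; ring.
apply: cvg_lim => //; apply: cvgD; apply: cvgMr; exact: is_cvg_pcoef.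
Qed.

(** U = [psum 1 c] and V = [psum 'i c] solve U' = xU + yV, V' = xV - yU. The integrating factor
    e^(-xt) followed by a rotation of angle yt turns them into constants, determined at t = 0. *)
Let psum1iE c t : psum 1 c t = expR (Re c * t) * cos (Im c * t) /\
  psum 'i c t = - (expR (Re c * t) * sin (Im c * t)).
Proof.
case: c => x y /=; set c := x +i* y.
have dU (u : R) : is_derive u (1 : R) (psum 1 c) (x * psum 1 c u + y * psum 'i c u).
  apply: is_derive_eq (is_derive_psum 1 c u) _.
  by rewrite psum_linear mul1r.
have psumN : psum ('i * 'i) c = fun u => - psum 1 c u.
  rewrite [_ * _](_ : _ = 1 * (-1 +i* 0)); last first.
    by rewrite mul1r; apply: complex_eqP; rewrite ?cReM ?cImM /=; ring.
  by rewrite psum_linear; apply/funext => u; rewrite mul0r addr0 mulN1r.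
have dV (u : R) : is_derive u (1 : R) (psum 'i c) (x * psum 'i c u - y * psum 1 c u).
  apply: is_derive_eq (is_derive_psum 'i c u) _.
  by rewrite psum_linear psumN mulrN.
pose A u := expR (- x * u) * (psum 1 c u * cos (y * u) - psum 'i c u * sin (y * u)).
pose B u := expR (- x * u) * (psum 1 c u * sin (y * u) + psum 'i c u * cos (y * u)).
have dl (k u : R) : is_derive u (1 : R) (fun v => k * v) k.
  by apply: is_derive_eq (is_deriveZ k (is_derive_id u 1)) _; rewrite /GRing.scale /= mulr1.
have dE (u : R) : is_derive u (1 : R) (fun v => expR (- x * v)) (expR (- x * u) * - x).
  exact: (@is_derive1_comp _ expR (fun v => - x * v)).
have dC (u : R) : is_derive u (1 : R) (fun v => cos (y * v)) (- sin (y * u) * y).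
  exact: (@is_derive1_comp _ cos (fun v => y * v)).
have dS (u : R) : is_derive u (1 : R) (fun v => sin (y * v)) (cos (y * u) * y).
  exact: (@is_derive1_comp _ sin (fun v => y * v)).
have dA (u : R) : is_derive u (1 : R) A 0.
  apply: is_derive_eq; rewrite /GRing.scale /=; ring.
have dB (u : R) : is_derive u (1 : R) B 0.
  apply: is_derive_eq; rewrite /GRing.scale /=; ring.
have psum0 d : psum d c 0 = Re d.
  apply: cvg_lim => //; rewrite /pseries -(cvg_shiftS _ _).
  have -> : (fun k => series (fun i => pcoef d c i * 0 ^+ i) k.+1) = cst (Re d).
    apply/funext => k; rewrite /series /= big_nat_recl // big1 => [|i _].
      by rewrite addr0 expr0 mulr1 /pcoef expr0 mulr1 fact0 divr1.
    by rewrite exprS mul0r mulr0.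
  exact: cvg_cst.
have A1 : A t = 1.
  rewrite (is_derive_0_is_cst t 0 dA) /A !mulr0 expR0 cos0 sin0 !psum0 /=; ring.
have B0 : B t = 0.
  rewrite (is_derive_0_is_cst t 0 dB) /B !mulr0 expR0 cos0 sin0 !psum0 /=; ring.
have E1 : expR (x * t) * expR (- x * t) = 1 by rewrite -expRD mulNr subrr expR0.
have CS := cos2Dsin2 (y * t).
have UE : psum 1 c t =
    expR (x * t) * (A t * cos (y * t) + B t * sin (y * t)).
  rewrite /A /B; apply/esym.
  transitivity (expR (x * t) * expR (- x * t) * psum 1 c t *
    (cos (y * t) ^+ 2 + sin (y * t) ^+ 2)); first by ring.
  by rewrite E1 CS !mulr1 mul1r.
have VE : psum 'i c t =
    expR (x * t) * (B t * cos (y * t) - A t * sin (y * t)).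
  rewrite /A /B; apply/esym.
  transitivity (expR (x * t) * expR (- x * t) * psum 'i c t *
    (cos (y * t) ^+ 2 + sin (y * t) ^+ 2)); first by ring.
  by rewrite E1 CS !mulr1 mul1r.
by rewrite UE VE A1 B0; split; ring.
Qed.

Lemma cvg_series_Re_cexp d c :
  series (fun k => Re (d * c ^+ k) / k`!%:R) @ \oo --> Re (d * cexp c).
Proof.
have -> : series (fun k => Re (d * c ^+ k) / k`!%:R) = pseries (pcoef d c) 1.
  by rewrite /pseries; congr series; apply/funext => k /=; rewrite expr1n mulr1.
have [U1 V1] := psum1iE c 1; rewrite !mulr1 in U1 V1.
suff <- : psum d c 1 = Re (d * cexp c) by exact: is_cvg_pcoef.
case: d => x y; rewrite -[x +i* y]mul1r psum_linear !mul1r U1 V1 cReM /=; ring.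
Qed.

(** This reduces the topology of complex vectors and matrices to real functions, for which the
    continuity lemmas of analysis are available. *)
Lemma cvg_mx_ReIm (T : Type) (F : set_system T) (FF : Filter F) (m n : nat)
    (f : T -> 'M[R[i]]_(m, n)) (M : 'M[R[i]]_(m, n)) :
  f @ F --> M <-> forall i j,
    ((fun x => Re (f x i j)) @ F --> Re (M i j)) /\
    ((fun x => Im (f x i j)) @ F --> Im (M i j)).
Proof.
split=> [fM i j|fM].
  have ball_fM (e : R) : 0 < e -> \forall x \near F, `|M i j - f x i j| < e%:C.
    move=> e0; have /cvg_ballP /(_ e%:C) := fM.
    rewrite ltcR => /(_ e0); apply: filterS => x [_ /(_ i j)]; exact.
  split; apply/cvgrPdist_lt => e /ball_fM; apply: filterS => x.
    rewrite normc_def ltcR; apply: le_lt_trans.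
    rewrite -cReN -cReD; set a := _ - _.
    by rewrite -sqrtr_sqr ler_wsqrtr // lerDl sqr_ge0.
  rewrite normc_def ltcR; apply: le_lt_trans.
  rewrite -cImN -cImD; set a := _ - _.
  by rewrite -sqrtr_sqr ler_wsqrtr // lerDr sqr_ge0.
(* A positive element of [R[i]] has zero imaginary part, so radii of balls are real. *)
apply/cvg_ballP => -[e e'] /[1!ltcE] /= /andP[/eqP -> e0].
have e20 : 0 < e / 2 by lra.
suff near_ij : \forall x \near F, forall ij : 'I_m * 'I_n,
    `|M ij.1 ij.2 - f x ij.1 ij.2| < e%:C.
  by apply: filterS near_ij => x ft; split=> [|i j]; [rewrite ltcR|exact: (ft (i, j))].
apply: filter_forall => -[i j] /=; have [fR fI] := fM i j.
near=> x; rewrite normc_def ltcR.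
have aR : `|Re (M i j) - Re (f x i j)| < e / 2.
  by near: x; move/cvgrPdist_lt : fR; apply.
have aI : `|Im (M i j) - Im (f x i j)| < e / 2.
  by near: x; move/cvgrPdist_lt : fI; apply.
rewrite -cReN -cReD in aR; rewrite -cImN -cImD in aI; set a := _ - _ in aR aI *.
rewrite -[ltRHS](ger0_norm (ltW e0)) -sqrtr_sqr ltr_sqrt ?exprn_gt0 //.
rewrite -[Re a ^+ 2]real_normK ?num_real // -[Im a ^+ 2]real_normK ?num_real //.
have := normr_ge0 (Re a); have := normr_ge0 (Im a); nra.
Unshelve. all: by end_near. Qed.

Let Re_real_mul (x : R) a : Re (x%:C * a) = x * Re a.
Proof. by rewrite cReM /= mul0r subr0. Qed.

Let fact_inv (k : nat) : (k`!%:R)^-1 = ((k`!%:R : R)^-1)%:C :> R[i].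
Proof. by rewrite fmorphV rmorph_nat. Qed.

Lemma cvg_series_cexp d c :
  (Re (series (fun k => (k`!%:R)^-1 * (d * c ^+ k)) N) @[N --> \oo] --> Re (d * cexp c)) /\
  (Im (series (fun k => (k`!%:R)^-1 * (d * c ^+ k)) N) @[N --> \oo] --> Im (d * cexp c)).
Proof.
have RE e N : Re (series (fun k => (k`!%:R)^-1 * (e * c ^+ k)) N) =
    series (fun k => Re (e * c ^+ k) / k`!%:R) N.
  rewrite /series /= Re_sum; apply: eq_bigr => k _.
  by rewrite fact_inv Re_real_mul mulrC.
split; first by rewrite (funext (RE d)); exact: cvg_series_Re_cexp.
have ImE a : Im a = Re (- 'i * a) by rewrite cReM /= ; ring.
rewrite ImE mulrA.
rewrite (_ : (fun N => _) = series (fun k => Re (- 'i * d * c ^+ k) / k`!%:R)).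
  exact: cvg_series_Re_cexp.
apply/funext => N; rewrite -RE ImE /series /= mulr_sumr; congr Re.
by apply: eq_bigr => k _; rewrite mulrCA !mulrA.
Qed.

Lemma mxexp_delta (n : nat) c (k : 'I_n) :
  mxexp (c *: delta_mx k k) = 1%:M + (cexp c - 1) *: delta_mx k k.
Proof.
(* [0 ^+ l] is 1 for l = 0 and 0 otherwise. The formula thus covers the zeroth power, and the part
   complementary to the idempotent contributes an exponential series at 0. *)
have dX l : (c *: delta_mx k k) ^+ l =
    (0 ^+ l)%:M - (0 ^+ l) *: delta_mx k k + c ^+ l *: delta_mx k k :> 'M[R[i]]_n.
  elim: l => [|l IH]; first by rewrite !expr0 !scale1r subrK.
  rewrite exprSr IH exprS mul0r scale0r raddf0 subr0 add0r.
  rewrite -[_ * _]/(_ *m _) mulmxDl mulmxBl mul_scalar_mx.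
  by rewrite -!scalemxAl -!scalemxAr mul_delta_mx subrr add0r scalerA -exprSr.
apply: cvg_lim; first exact: (@norm_hausdorff _ 'M[R[i]]_n).
apply/cvg_mx_ReIm => i j.
pose d : R[i] := (delta_mx k k : 'M[R[i]]_n) i j.
pose e : R[i] := (1%:M : 'M[R[i]]_n) i j - d.
have sE N : (series (fun l => (l`!%:R)^-1 *: (c *: delta_mx k k) ^+ l) N : 'M[R[i]]_n) i j =
    series (fun l => (l`!%:R)^-1 * (e * 0 ^+ l)) N +
    series (fun l => (l`!%:R)^-1 * (d * c ^+ l)) N.
  rewrite /series /= summxE -big_split; apply: eq_bigr => l _.
  transitivity ((l`!%:R)^-1 * (e * 0 ^+ l + d * c ^+ l)); last exact: mulrDr.
  rewrite dX !mxE; congr (_ * _); rewrite /e /d !mxE; ring.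
have [eR eI] := cvg_series_cexp e 0; have [dR dI] := cvg_series_cexp d c.
rewrite cexp0 mulr1 in eR eI.
have -> : (1%:M + (cexp c - 1) *: delta_mx k k : 'M[R[i]]_n) i j = e + d * cexp c.
  by rewrite /e /d !mxE; ring.
split.
  rewrite cReD (_ : (fun N => _) = fun N =>
    Re (series (fun l => (l`!%:R)^-1 * (e * 0 ^+ l)) N) +
    Re (series (fun l => (l`!%:R)^-1 * (d * c ^+ l)) N)); first exact: cvgD.
  by apply/funext => N; rewrite sE cReD.
rewrite cImD (_ : (fun N => _) = fun N =>
  Im (series (fun l => (l`!%:R)^-1 * (e * 0 ^+ l)) N) +
  Im (series (fun l => (l`!%:R)^-1 * (d * c ^+ l)) N)); first exact: cvgD.
by apply/funext => N; rewrite sE cImD.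
Qed.

(** The principal logarithm, with the argument given by [atan]; this is correct on the half-plane Re
    > 0, the only place where it is used. *)
Definition clog a : R[i] :=
  ln (Num.sqrt (Re a ^+ 2 + Im a ^+ 2)) +i* atan (Im a / Re a).

Lemma clogK a : 0 < Re a -> cexp (clog a) = a.
Proof.
case: a => x y /= x0; rewrite /clog /=.
set r := Num.sqrt _; set q := y / x.
have q0 : 0 < 1 + q ^+ 2 by have := sqr_ge0 q; lra.
have rE : r = x * Num.sqrt (1 + q ^+ 2).
  rewrite -[X in X * _](ger0_norm (ltW x0)) -sqrtr_sqr -sqrtrM ?sqr_ge0 //.
  by congr Num.sqrt; rewrite /q; field; lra.
have s0 : Num.sqrt (1 + q ^+ 2) != 0 by rewrite gt_eqF // sqrtr_gt0.
have r0 : 0 < r by rewrite rE mulr_gt0 // sqrtr_gt0.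
have c0 : cos (atan q) = (Num.sqrt (1 + q ^+ 2))^-1 := cos_atan q.
have sinE : sin (atan q) = q * cos (atan q).
  by rewrite -{2}(atanK q) /tan -mulrA mulVf ?mulr1 // c0 invr_neq0.
rewrite /cexp /= lnK ?posrE // sinE c0 rE.
by congr (_ +i* _); rewrite /q; field; rewrite s0 //= gt_eqF.
Qed.

Lemma clog1 : clog 1 = 0.
Proof. by rewrite /clog /= expr1n expr0n addr0 sqrtr1 ln1 mul0r atan0. Qed.

Definition ccontinuous (T : topologicalType) (f : T -> R[i]) :=
  continuous (fun x => Re (f x)) /\ continuous (fun x => Im (f x)).

Section Ccontinuous.
Variable T : topologicalType.
Implicit Types f g : T -> R[i].

Lemma ccontinuous_cst a : ccontinuous (fun _ : T => a).
Proof. by split=> x; exact: cvg_cst. Qed.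

Lemma ccontinuousD f g : ccontinuous f -> ccontinuous g ->
  ccontinuous (fun x => f x + g x).
Proof.
move=> [f1 f2] [g1 g2]; split=> x; under eq_fun do rewrite ?cReD ?cImD;
  rewrite ?cReD ?cImD; apply: cvgD; by [exact: f1|exact: f2|exact: g1|exact: g2].
Qed.

Lemma ccontinuousN f : ccontinuous f -> ccontinuous (fun x => - f x).
Proof.
move=> [f1 f2]; split=> x; under eq_fun do rewrite ?cReN ?cImN;
  rewrite ?cReN ?cImN; apply: cvgN; by [exact: f1|exact: f2].
Qed.

Lemma ccontinuousM f g : ccontinuous f -> ccontinuous g ->
  ccontinuous (fun x => f x * g x).
Proof.
move=> [f1 f2] [g1 g2]; split=> x; under eq_fun do rewrite ?cReM ?cImM;
  rewrite ?cReM ?cImM; [apply: cvgB|apply: cvgD]; apply: cvgM;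
  by [exact: f1|exact: f2|exact: g1|exact: g2].
Qed.

Lemma ccontinuousV f : ccontinuous f -> (forall x, f x != 0) ->
  ccontinuous (fun x => (f x)^-1).
Proof.
move=> [f1 f2] f0.
have n0 x : Re (f x) ^+ 2 + Im (f x) ^+ 2 != 0.
  apply: contra (f0 x) => /eqP e; apply/eqP; apply: complex_eqP => /=;
    apply/eqP; rewrite -sqrf_eq0; apply/eqP;
    by move: e (sqr_ge0 (Re (f x))) (sqr_ge0 (Im (f x))); lra.
have cn : continuous (fun x => (Re (f x) ^+ 2 + Im (f x) ^+ 2)^-1).
  move=> x; apply: cvgV => //; apply: cvgD;
    apply: cvgM; by [exact: f1|exact: f2].
have RV a : Re a^-1 = Re a * (Re a ^+ 2 + Im a ^+ 2)^-1 by case: a.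
have IV a : Im a^-1 = - Im a * (Re a ^+ 2 + Im a ^+ 2)^-1.
  by case: a => x y; rewrite mulNr.
split=> x; under eq_fun do rewrite ?RV ?IV; rewrite ?RV ?IV; apply: cvgM;
  try exact: cn; first exact: f1.
by apply: cvgN; exact: f2.
Qed.

Lemma ccontinuous_cexp f : ccontinuous f -> ccontinuous (fun x => cexp (f x)).
Proof.
move=> [f1 f2]; split=> x /=; apply: cvgM.
- by apply: continuous_cvg; [exact: continuous_expR|exact: f1].
- by apply: continuous_cvg; [exact: continuous_cos|exact: f2].
- by apply: continuous_cvg; [exact: continuous_expR|exact: f1].
- by apply: continuous_cvg; [exact: continuous_sin|exact: f2].
Qed.

Lemma ccontinuous_clog f : ccontinuous f -> (forall x, 0 < Re (f x)) ->
  ccontinuous (fun x => clog (f x)).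
Proof.
move=> [f1 f2] f0; split=> x /=.
  apply: (@continuous_comp _ _ _
    (fun x => Num.sqrt (Re (f x) ^+ 2 + Im (f x) ^+ 2)) (@ln R)).
    apply: (@continuous_comp _ _ _
      (fun x => Re (f x) ^+ 2 + Im (f x) ^+ 2) Num.sqrt).
      by apply: cvgD; apply: cvgM; by [exact: f1|exact: f2].
    exact: sqrt_continuous.
  apply: continuous_ln; rewrite sqrtr_gt0.
  by have := exprn_gt0 2 (f0 x); have := sqr_ge0 (Im (f x)); lra.
apply: (@continuous_comp _ _ _ (fun x => Im (f x) / Re (f x)) (@atan R)).
  by apply: cvgM; [exact: f2|apply: cvgV; [rewrite gt_eqF|exact: f1]].
exact: continuous_atan.
Qed.

End Ccontinuous.

Lemma Re_cexp_eq1 a : cexp a = 1 -> Re a = 0 /\ cos (Im a) = 1.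
Proof.
case: a => x y [eR eI] /=.
have e0 : 0 < expR x by exact: expR_gt0.
have : expR x ^+ 2 = 1.
  rewrite -[LHS]mulr1 -[X in _ * X](cos2Dsin2 y).
  transitivity ((expR x * cos y) ^+ 2 + (expR x * sin y) ^+ 2); first by ring.
  by rewrite eR eI expr1n expr0n addr0.
move/eqP; rewrite sqrf_eq1 => /orP[/eqP ex|/eqP ex]; last by lra.
rewrite ex mul1r in eR; split=> //.
by apply: (@expR_inj R); rewrite ex expR0.
Qed.

(* A continuous logarithm of the constant path 1 takes its values in the discrete
   set 2 i pi Z. *)
Lemma continuous_log1 (L : R -> R[i]) : ccontinuous L -> L 0 = 0 ->
  (forall t, 0 <= t <= 1 -> cexp (L t) = 1) ->
  forall t, 0 <= t <= 1 -> L t = 0.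
Proof.
move=> [_ cI] L0 L1 t t01; have [Re0 _] := Re_cexp_eq1 (L1 t t01).
apply: complex_eqP => //=; apply/eqP/negPn/negP => It0.
have ct : continuous (fun x => `|Im (L x)|).
  by move=> x; apply: cvg_norm; exact: cI.
have It : 0 < `|Im (L t)| by rewrite normr_gt0.
(* By the intermediate value theorem |Im L| attains this value, which lies in ]0, 1] and hence in
   ]0, pi[, where the cosine is not 1. *)
have v0 : 0 < Num.min `|Im (L t)| 1 by rewrite lt_min It ltr01.
have [] := @IVT R (fun x => `|Im (L x)|) 0 t (Num.min `|Im (L t)| 1).
- by lra.
- exact: continuous_subspaceT.
- by rewrite L0 /= normr0 min_l ?normr_ge0 // max_r ?normr_ge0 // (ltW v0) /= ge_min lexx.
move=> u; rewrite in_itv /= => /andP[u0 ut] vE.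
have u01 : 0 <= u <= 1 by lra.
have [_] := Re_cexp_eq1 (L1 u u01).
have -> : cos (Im (L u)) = cos `|Im (L u)|.
  by case: (ger0P (Im (L u))) => // _; rewrite cosN.
move=> c1; have /cos_inj : cos (Num.min `|Im (L t)| 1) = cos 0 by rewrite -vE c1 cos0.
have := pi_ge2 R; rewrite !in_itv /= => pi2.
have v1 : Num.min `|Im (L t)| 1 <= 1 by rewrite ge_min lexx orbT.
move: v0 v1 pi2; move: (Num.min _ 1) => m; clear=> m0 m1 pi2 mE.
have mp : 0 <= m <= pi.
  by rewrite (ltW m0) (le_trans m1) // (le_trans _ pi2) // ler1n.
have zp : 0 <= (0 : R) <= pi by apply/andP; split=> //; apply: le_trans pi2.
by move: m0; rewrite (mE mp zp) ltxx.
Qed.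

Lemma continuous_sumR (T : topologicalType) (I : Type) (r : seq I)
    (f : I -> T -> R) : (forall i, continuous (f i)) ->
  continuous (fun x => \sum_(i <- r) f i x).
Proof.
move=> cf; elim: r => [|i r IH] x.
  by under eq_fun do rewrite big_nil; exact: cvg_cst.
rewrite (_ : (fun y => _) = fun y => f i y + \sum_(j <- r) f j y).
  by apply: cvgD; [exact: cf|exact: IH].
by apply/funext => y; rewrite big_cons.
Qed.

End ComplexExponential.
(** * Real reflection groups *)

Section RealReflectionGroup.
Variables (R : realType) (n : nat) (W : finGroupType).
Variable rW : mx_representation R [set: W]%G n.
Variable G : 'M[R]_n.
Hypothesis Ginv : invariant_scalar_product rW G.
Implicit Types (x y a b : 'cV[R]_n) (s t w : W).

Definition dot x y : R := (x^T *m G *m y) 0 0.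

Lemma dotC x y : dot x y = dot y x.
Proof.
case: Ginv => Gt _ _; rewrite /dot.
transitivity ((x^T *m G *m y)^T 0 0); first by rewrite [RHS]mxE.
by rewrite !trmx_mul trmxK Gt mulmxA.
Qed.

Lemma dotDr x y a : dot x (y + a) = dot x y + dot x a.
Proof. by rewrite /dot mulmxDr mxE. Qed.

Lemma dotZr (k : R) x y : dot x (k *: y) = k * dot x y.
Proof. by rewrite /dot -scalemxAr mxE. Qed.

Lemma dotDl x y a : dot (x + y) a = dot x a + dot y a.
Proof. by rewrite ![dot _ a]dotC dotDr. Qed.

Lemma dotZl (k : R) x y : dot (k *: x) y = k * dot x y.
Proof. by rewrite ![dot _ y]dotC dotZr. Qed.

Lemma dotNl x y : dot (- x) y = - dot x y.
Proof. by rewrite -scaleN1r dotZl mulN1r. Qed.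

Lemma dotNr x y : dot x (- y) = - dot x y.
Proof. by rewrite -scaleN1r dotZr mulN1r. Qed.

Lemma dot_gt0 x : x != 0 -> 0 < dot x x.
Proof. by case: Ginv => _ + _; apply. Qed.

Lemma dot_eq0 x : dot x x = 0 -> x = 0.
Proof. by move=> d0; apply/eqP/negPn/negP => /dot_gt0; rewrite d0 ltxx. Qed.

Lemma dot_act w x y : dot (rW w *m x) (rW w *m y) = dot x y.
Proof.
case: Ginv => _ _ /(_ w) wG.
by rewrite /dot trmx_mul -[in RHS]wG !mulmxA.
Qed.

Lemma actM w w' x : rW (w * w')%g *m x = rW w *m (rW w' *m x).
Proof. by rewrite repr_mxM ?inE // mulmxA. Qed.

Lemma act1 x : rW 1%g *m x = x.
Proof. by rewrite repr_mx1 mul1mx. Qed.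

Lemma actK w x : rW w^-1%g *m (rW w *m x) = x.
Proof. by rewrite -actM mulVg act1. Qed.

Lemma actVK w x : rW w *m (rW w^-1%g *m x) = x.
Proof. by rewrite -actM mulgV act1. Qed.

Lemma dot_actl w x y : dot (rW w *m x) y = dot x (rW w^-1%g *m y).
Proof. by rewrite -(dot_act w^-1%g) actK. Qed.

(** The orthogonal reflection formula for a normal [a] of length one; the normalisation is stated
    separately wherever it matters. *)
Definition reflects t a := forall x, rW t *m x = x - (2 * dot x a) *: a.

(** Write rW t - 1 = u v by its rank. Invariance of the scalar product gives r(x) (2 <x, u> + r(x)
    <u, u>) = 0 for the linear form r(x) = v x, so r is proportional to <., u> and u is normal to
    the hyperplane. *)
Lemma reflection_normal t : is_reflection rW t ->
  exists a, dot a a = 1 /\ reflects t a.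
Proof.
rewrite /is_reflection => /eqP rk1; set M := rW t - 1%:M in rk1.
have [u [v ME]] : exists (u : 'cV[R]_n) (v : 'rV[R]_n), M = u *m v.
  have := mulmx_base M; move: (col_base M) (row_base M); rewrite rk1 => u v <-.
  by exists u, v.
have u0 : u != 0.
  by apply/eqP => u0; move: rk1; rewrite ME u0 mul0mx mxrank0.
have v0 : v != 0.
  by apply/eqP => v0; move: rk1; rewrite ME v0 mulmx0 mxrank0.
pose r x := (v *m x) 0 0.
have tE x : rW t *m x = x + r x *: u.
  rewrite -[rW t](subrK 1%:M) -/M mulmxDl mul1mx addrC ME -mulmxA; congr (_ + _).
  by rewrite [v *m x]mx11_scalar mul_mx_scalar.
have rD x y : r (x + y) = r x + r y by rewrite /r mulmxDr mxE.
have [j vj] := rV0Pn _ v0.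
pose x0 : 'cV[R]_n := delta_mx j 0.
have rx0 : r x0 != 0 by rewrite /r -colE mxE.
have du : 0 < dot u u by exact: dot_gt0.
have iso x : r x * (2 * dot x u + r x * dot u u) = 0.
  have := dot_act t x x; rewrite tE !dotDl !dotDr !dotZl !dotZr (dotC u x); lra.
have rE x : r x = - 2 * dot x u / dot u u.
  have rE1 y : r y != 0 -> r y = - 2 * dot y u / dot u u.
    move=> ry; have /eqP := iso y; rewrite mulf_eq0 (negPf ry) /= => /eqP e.
    by apply: (mulIf (lt0r_neq0 du)); rewrite divfK ?lt0r_neq0 //; lra.
  (* On the kernel of r the equation says nothing; the formula is recovered there by linearity from
     [x + x0] and [x0], both outside the kernel. *)
  have [ry|/rE1 //] := eqVneq (r x) 0.
  have ryx : r (x + x0) != 0 by rewrite rD ry add0r.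
  have := rE1 _ ryx; rewrite rD ry add0r (rE1 _ rx0) dotDl mulrDr mulrDl; lra.
exists ((Num.sqrt (dot u u))^-1 *: u).
have s0 : Num.sqrt (dot u u) != 0 by rewrite gt_eqF // sqrtr_gt0.
have ss : Num.sqrt (dot u u) * Num.sqrt (dot u u) = dot u u.
  by rewrite -expr2 sqr_sqrtr // ltW.
split=> [|x].
  by rewrite dotZl dotZr mulrA -invfM ss mulVf // gt_eqF.
rewrite tE rE dotZr scalerA -scaleNr; congr (_ + _ *: _).
by move: s0 ss; move: (Num.sqrt _) => q q0 <-; field.
Qed.

Lemma unit_normal_uniq t a b : dot a a = 1 -> dot b b = 1 ->
  reflects t a -> reflects t b -> a = b \/ a = - b.
Proof.
move=> a1 b1 ta tb; have := ta a; rewrite tb a1 => /addrI/oppr_inj.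
rewrite -!scalerA => /(scalerI (lt0r_neq0 (ltr0Sn R 1))) /esym.
rewrite scale1r => aE.
have ab : dot a b ^+ 2 = 1.
  by move: a1; rewrite {1}aE dotZl dotC -expr2.
have /orP[/eqP e|/eqP e] : (dot a b == 1) || (dot a b == -1).
- by rewrite -sqrf_eq1 ab.
- by left; rewrite aE e scale1r.
- by right; rewrite aE e scaleN1r.
Qed.

Hypothesis Wf : mx_faithful rW.

Lemma rW_inj w w' : (forall x, rW w *m x = rW w' *m x) -> w = w'.
Proof.
move=> ww; apply: (mx_faithful_inj Wf); rewrite ?inE //.
apply/matrixP => i j; have := ww (delta_mx j 0).
by rewrite -!colE => /colP /(_ i); rewrite !mxE.
Qed.

Lemma reflects_inj t t' a : reflects t a -> reflects t' a -> t = t'.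
Proof. by move=> ta ta'; apply: rW_inj => x; rewrite ta ta'. Qed.

Lemma reflectsN t a : reflects t a -> reflects t (- a).
Proof. by move=> ta x; rewrite ta dotNr scalerN mulrN scaleNr opprK. Qed.

Lemma reflectsJ t w a : reflects t a -> reflects (t ^ w) (rW w^-1%g *m a).
Proof.
by move=> ta x; rewrite conjgE !actM ta mulmxBr actK -scalemxAr dot_actl.
Qed.

Lemma reflectsK t a : dot a a = 1 -> reflects t a -> t^-1%g = t.
Proof.
move=> a1 ta; apply: rW_inj => x; rewrite -[RHS](actK t); congr (_ *m _).
rewrite (ta x) mulmxBr -scalemxAr !ta a1 mulr1 scalerBr scalerA.
rewrite -scalerBl -addrA -opprD -scalerDl (_ : 2 * dot x a + _ = 0) ?scale0r ?subr0 //.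
by ring.
Qed.

(** * Positive roots, simple reflections and the exchange condition *)

Definition regular (u : 'cV[R]_n) := forall t, is_reflection rW t -> rW t *m u != u.

Section RegularPoint.
Variable u : 'cV[R]_n.
Hypothesis ureg : regular u.
Local Notation T := (is_reflection rW).

(** The positive root of [t] for the chamber of [u], with all roots scaled to length one. *)
Definition root t : 'cV[R]_n :=
  xget 0 [set a | [/\ dot a a = 1, reflects t a & 0 < dot a u]].

Lemma rootP t : T t ->
  [/\ dot (root t) (root t) = 1, reflects t (root t) & 0 < dot (root t) u].
Proof.
move=> Tt; have [a [a1 ta]] := reflection_normal Tt.
have au : dot a u != 0.
  apply: contra (ureg Tt) => /eqP au.
  by rewrite ta dotC au mulr0 scale0r subr0.
rewrite /root; case: xgetP => [b -> //|/(_ (if 0 < dot a u then a else - a))].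
case: ltgtP au => // au _ []; split=> //.
- by rewrite dotNl dotNr opprK.
- exact: reflectsN.
- by rewrite dotNl oppr_gt0.
Qed.

Lemma root_uniq t a : dot a a = 1 -> reflects t a -> 0 < dot a u -> T t ->
  a = root t.
Proof.
move=> a1 ta au Tt; have [r1 tr ru] := rootP Tt.
have [//|aE] := unit_normal_uniq a1 r1 ta tr.
by move: au; rewrite aE dotNl oppr_gt0 ltNge (ltW ru).
Qed.

Lemma root_inj t t' : T t -> T t' -> root t = root t' -> t = t'.
Proof.
move=> Tt Tt' e; have [_ tr _] := rootP Tt; have [_ tr' _] := rootP Tt'.
by apply: reflects_inj tr _; rewrite e.
Qed.

Lemma reflectionK t : T t -> t^-1%g = t.
Proof. by move=> /rootP[r1 tr _]; exact: reflectsK tr. Qed.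

Lemma act_root t : T t -> rW t *m root t = - root t.
Proof.
move=> /rootP[r1 tr _]; rewrite tr r1 mulr1 -[X in X - _]scale1r -scalerBl.
by rewrite (_ : 1 - 2 = -1) ?scaleN1r //; lra.
Qed.

(** The hyperplane of [t] lies between u and w u. This is the geometric form of the inversion set of
    [w]. *)
Definition separates w t := dot (root t) (rW w *m u) < 0.

Lemma regular_act w : regular (rW w *m u).
Proof.
move=> t Tt; apply: contra (ureg (_ : T (t ^ w)%g)) => [/eqP e|].
  by rewrite conjgE !actM e actK.
by rewrite is_reflectionJ.
Qed.

Lemma dot_root_neq0 w t : T t -> dot (root t) (rW w *m u) != 0.
Proof.
move=> Tt; have [_ tr _] := rootP Tt.
apply: contra (regular_act w Tt) => /eqP d0.
by rewrite tr dotC d0 mulr0 scale0r subr0.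
Qed.

(** w^-1 carries the unit normal of [t] to one of the two unit normals of [t ^ w]; pairing with u
    decides which. *)
Lemma act_rootV w t : T t ->
  rW w^-1%g *m root t = if separates w t then - root (t ^ w)%g else root (t ^ w)%g.
Proof.
move=> Tt; have [r1 tr _] := rootP Tt; set a := rW _ *m _.
have a1 : dot a a = 1 by rewrite dot_act.
have ta : reflects (t ^ w)%g a by exact: reflectsJ.
have au : dot a u = dot (root t) (rW w *m u) by rewrite dot_actl invgK.
have TJ : T (t ^ w)%g by rewrite is_reflectionJ.
rewrite /separates; case: ifPn => [an|].
  apply/eqP; rewrite -eqr_oppLR; apply/eqP; apply: root_uniq => //.
  - by rewrite dotNl dotNr opprK.
  - exact: reflectsN.
  - by rewrite dotNl oppr_gt0 au.
rewrite -leNgt le_eqVlt eq_sym (negPf (dot_root_neq0 w Tt)) /= => ap.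
by apply: root_uniq => //; rewrite au.
Qed.

(** A hyperplane lies between u and w w' u exactly when it lies between one, and only one, of the
    pairs (u, w u) and (w u, w w' u); the second pair is pulled back by w. *)
Lemma separatesM w w' t : T t ->
  separates (w * w')%g t = separates w t (+) separates w' (t ^ w)%g.
Proof.
move=> Tt; rewrite {1}/separates actM -[w in rW w *m _]invgK -dot_actl.
rewrite act_rootV //; case: ifP => // _.
rewrite dotNl oppr_lt0 addTb /separates -leNgt le_eqVlt.
by rewrite eq_sym (negPf (dot_root_neq0 _ _)) // is_reflectionJ.
Qed.

Lemma separates1 t : T t -> separates 1%g t = false.
Proof. by move=> /rootP[_ _ tu]; rewrite /separates act1 ltNge ltW. Qed.

Lemma separates_self t : T t -> separates t t.
Proof.
move=> Tt; have [_ _ tu] := rootP Tt.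
by rewrite /separates -[t in rW t](reflectionK Tt) -dot_actl act_root // dotNl oppr_lt0.
Qed.

Definition simple s := T s && [forall t, T t ==> separates s t ==> (t == s)].

Lemma simpleP s : reflect (T s /\ forall t, T t -> separates s t -> t = s) (simple s).
Proof.
apply: (iffP andP) => -[Ts sP]; split=> //.
  by move=> t Tt st; apply/eqP; move/forallP: sP => /(_ t); rewrite Tt st.
by apply/forallP => t; apply/implyP => Tt; apply/implyP => st; apply/eqP/sP.
Qed.

Lemma dot_root_lt1 t t' : T t -> T t' -> t != t' -> dot (root t) (root t') < 1.
Proof.
move=> Tt Tt' tt'; have [r1 _ _] := rootP Tt; have [r1' _ _] := rootP Tt'.
have : root t - root t' != 0.
  by rewrite subr_eq0; apply: contra tt' => /eqP /(root_inj Tt Tt') ->.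
move/dot_gt0; rewrite !dotDl !dotDr !dotNl !dotNr r1 r1' (dotC (root t')); lra.
Qed.

(** <root t', t u> = <root t', u> - 2 <u, root t> <root t, root t'>, where the two pairings with u
    are positive, so a negative value needs a positive last factor. *)
Lemma separates_dot_gt0 t t' : T t -> T t' -> separates t t' ->
  0 < dot (root t) (root t').
Proof.
move=> Tt Tt'; have [_ tr tu] := rootP Tt; have [_ _ tu'] := rootP Tt'.
rewrite /separates tr dotDr dotNr dotZr => h.
rewrite ltNge; apply/negP => c0; rewrite (dotC u) (dotC (root t') (root t)) in h.
have : dot (root t) u * dot (root t) (root t') <= 0 by rewrite mulr_ge0_le0 // ltW.
lra.
Qed.

(* The hyperplane that the segment from u to w u crosses first (the nearest one to
   u among those) is a wall: if the reflection t in it is not simple, then its root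
   is a positive combination of two other roots, one of which beats it. *)
Lemma simple_separates w t0 : T t0 -> separates w t0 ->
  exists2 s, simple s & separates w s.
Proof.
(* X and Y are the distances of u and w u to the hyperplane. The segment crosses it at parameter X /
   (X + Y), which increases with X / Y. *)
move=> Tt0 wt0; pose X t := dot (root t) u; pose Y t := - dot (root t) (rW w *m u).
pose P t := T t && separates w t.
have Pt0 : P t0 by rewrite /P Tt0.
case: (@arg_minP _ _ _ t0 P (fun t => X t / Y t) Pt0) => t1 Pt1 min1.
(* Several hyperplanes may be crossed at the same first point; ties in X / Y are broken by the
   smallest X. *)
pose Q t := P t && (X t / Y t <= X t1 / Y t1).
have Qt1 : Q t1 by rewrite /Q Pt1 lexx.
case: (@arg_minP _ _ _ t1 Q X Qt1) => t /andP[/andP[Tt wt] tt1] min2.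
have Pt : P t by rewrite /P Tt.
have XYmin t' : P t' -> X t * Y t' <= X t' * Y t.
  move=> Pt'; have Y0 : 0 < Y t by rewrite /Y oppr_gt0.
  have Y0' : 0 < Y t' by rewrite /Y oppr_gt0; case/andP: Pt'.
  have := le_trans tt1 (min1 _ Pt').
  by rewrite ler_pdivrMr // mulrAC ler_pdivlMr.
have Xmin t' : P t' -> X t' * Y t <= X t * Y t' -> X t <= X t'.
  move=> Pt' h; apply: min2; rewrite /Q Pt' /=; apply: le_trans tt1.
  have Y0 : 0 < Y t by rewrite /Y oppr_gt0.
  have Y0' : 0 < Y t' by rewrite /Y oppr_gt0; case/andP: Pt'.
  by rewrite ler_pdivrMr // mulrAC ler_pdivlMr.
exists t => //; apply/simpleP; split=> // t' Tt' tt'; apply/eqP/negPn/negP => nt.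
have c0 := separates_dot_gt0 Tt Tt' tt'.
have c1 : dot (root t) (root t') < 1 by apply: dot_root_lt1 => //; rewrite eq_sym.
set c := dot _ _ in c0 c1; set t'' := (t' ^ t)%g.
have Tt'' : T t'' by rewrite is_reflectionJ.
(* As [t] separates across the hyperplane of [t'], it maps [root t'] to minus [root t'']; the
   reflection formula then expresses [root t] by the two roots. *)
have rE : (2 * c) *: root t = root t' + root t''.
  have [_ tr _] := rootP Tt.
  have := act_rootV t Tt'; rewrite tt' reflectionK // tr (dotC (root t')) -/c => e.
  by rewrite -[root t'']opprK -e opprB addrCA subrr addr0.
have XE : 2 * c * X t = X t' + X t'' by rewrite /X -dotDl -rE dotZl.
have YE : 2 * c * Y t = Y t' + Y t''.
  by rewrite /Y mulrN -dotZl rE dotDl opprD.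
have X0 : 0 < X t by have [] := rootP Tt.
have X0' : 0 < X t' by have [] := rootP Tt'.
have X0'' : 0 < X t'' by have [] := rootP Tt''.
have Y0 : 0 < Y t by rewrite /Y oppr_gt0.
have PY s : T s -> 0 < Y s -> P s by rewrite /P /separates /Y oppr_gt0 => ->.
(* If Y t' <= 0, then Y t'' >= 2c Y t while X t'' < 2c X t, so [t''] would be crossed strictly
   earlier than [t]. The other case is symmetric. *)
have [Y0'|Y0'] := ltP 0 (Y t'); last first.
  have Y0'' : 0 < Y t'' by nra.
  by have := XYmin t'' (PY _ Tt'' Y0''); nra.
have [Y0''|Y0''] := ltP 0 (Y t''); last first.
  by have := XYmin t' (PY _ Tt' Y0'); nra.
(* X t / Y t is the mediant of two ratios that are not smaller, so all three agree. The tie-break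
   then gives X t <= X t' and X t <= X t'', hence 2 X t <= 2c X t, against c < 1. *)
have h1 := XYmin t' (PY _ Tt' Y0'); have h2 := XYmin t'' (PY _ Tt'' Y0'').
have e : X t * (Y t' + Y t'') = (X t' + X t'') * Y t by rewrite -YE -XE; ring.
have := Xmin t' (PY _ Tt' Y0'); have := Xmin t'' (PY _ Tt'' Y0'').
by move=> /(_ _) m2 /(_ _) m1; nra.
Qed.

Definition simple_word (r : seq W) := all simple r.
Local Notation wprod r := (\prod_(s <- r) s)%g.

(** Induction on the number of hyperplanes closer to u. If [t] is not simple, some simple s lies
    between u and t u; the roots of s and t then have positive scalar product, so the hyperplane of
    s t s is closer to u, and t = s (s t s) s. *)
Lemma reflection_word t : T t -> exists2 r, simple_word r & wprod r = t.
Proof.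
pose X t := dot (root t) u.
have [k] := ubnP #|[set t' | T t' & X t' < X t]%SET|.
elim: k t => // k IH t Xk Tt.
have [st|nst] := boolP (simple t).
  by exists [:: t]; rewrite /simple_word /= ?st // big_seq1.
have [s ss ts] := simple_separates Tt (separates_self Tt).
have nts : t != s by apply: contra nst => /eqP ->.
have [Ts sP] := simpleP _ ss.
have TJ : T (t ^ s)%g by rewrite is_reflectionJ.
have XJ : X (t ^ s)%g < X t.
  have := act_rootV s Tt; rewrite reflectionK //.
  case: ifP => [/(sP _ Tt) e|_ rE]; first by rewrite e eqxx in nts.
  have [_ sr su] := rootP Ts.
  rewrite /X -rE sr dotDl dotNl dotZl (dotC (root t) (root s)) (dotC (root s) (root t)).
  have c0 := separates_dot_gt0 Tt Ts ts.
  by rewrite gtrDl oppr_lt0 !mulr_gt0.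
have [] := IH (t ^ s)%g _ TJ.
  rewrite ltnS in Xk; apply: leq_trans Xk.
  apply: proper_card; apply/properP; split.
    by apply/fintype.subsetP => t'; rewrite !inE => /andP[-> /lt_trans]; exact.
  by exists (t ^ s)%g; rewrite !inE TJ ?XJ // ltxx.
move=> r sr rE; exists (s :: rcons r s).
  by rewrite /simple_word /= all_rcons ss.
rewrite big_cons big_rcons rE /= conjgE reflectionK //.
have s2 : (s * s = 1)%g by rewrite -{1}(reflectionK Ts) mulVg.
by rewrite !mulgA s2 mul1g -mulgA s2 mulg1.
Qed.

(** The gallery of the word crosses the hyperplane of [t] at some letter. Since a simple letter
    crosses only its own hyperplane, multiplying by [t] deletes that letter. *)
Lemma exchange r t : simple_word r -> T t -> separates (wprod r) t ->
  exists2 r', simple_word r' & (size r' < size r)%N /\ wprod r' = (t * wprod r)%g.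
Proof.
elim: r t => [|s r IH] t /=; first by rewrite big_nil => _ Tt; rewrite separates1.
move=> /andP[ss sr] Tt; have [Ts sP] := simpleP _ ss.
rewrite big_cons separatesM //; have [st _|_] := boolP (separates s t).
  exists r => //; rewrite ltnSn; split=> //.
  by rewrite (sP _ Tt st) mulgA -{1}(reflectionK Ts) mulVg mul1g.
rewrite addFb => /(IH _ sr)[|r' sr' [rr' r'E]]; first by rewrite is_reflectionJ.
exists (s :: r'); first by rewrite /simple_word /= ss.
split; first by rewrite ltnS.
by rewrite big_cons r'E conjgE !mulgA mulgV mul1g.
Qed.

(** If s w' separates nothing, the hyperplane of s must be crossed again by w'. Exchange then
    rewrites s w' as a word shorter than w', and induction on the length applies. *)
Lemma wprod_eq1 r : simple_word r -> (forall t, T t -> ~~ separates (wprod r) t) ->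
  wprod r = 1%g.
Proof.
have [k] := ubnP (size r); elim: k r => // k IH [|s r] /=; first by rewrite big_nil.
rewrite ltnS => rk /andP[ss sr]; have [Ts _] := simpleP _ ss.
rewrite big_cons => sep; have := sep _ Ts; rewrite separatesM // separates_self //.
rewrite addTb negbK conjgE mulKg.
move=> /(exchange sr Ts)[r' sr' [rr' r'E]]; rewrite -r'E; apply: IH => //.
  exact: ltn_trans rr' rk.
by rewrite r'E.
Qed.

Hypothesis Wgen : <<[set s | T s]%SET>>%g = [set: W]%SET.

Lemma word_of w : exists2 r, simple_word r & wprod r = w.
Proof.
have /gen_prodgP[k [c cT ->]] : w \in <<[set s | T s]%SET>>%g by rewrite Wgen inE.
elim/big_ind: _ => [|w1 w2 [r1 s1 <-] [r2 s2 <-]|i _].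
- by exists [::] => //; rewrite big_nil.
- by exists (r1 ++ r2); rewrite ?big_cat //; apply/allP => s; rewrite mem_cat => /orP[];
    [exact: (allP s1)|exact: (allP s2)].
- by apply: reflection_word; have := cT i; rewrite inE.
Qed.

(** An element that fixes u separates u from its image by no hyperplane at all. *)
Lemma regular_fix w : rW w *m u = u -> w = 1%g.
Proof.
move=> wu; have [r sr rE] := word_of w; rewrite -rE; apply: wprod_eq1 => // t Tt.
by rewrite /separates rE wu -leNgt ltW //; have [] := rootP Tt.
Qed.

End RegularPoint.

(** * Complexification: freeness on the complement, and walls *)

Lemma fix_space_cplx w (v : 'cV[R[i]]_n) : W_act rW w v = v <->
  rW w *m map_mx (@complex.Re R) v = map_mx (@complex.Re R) v /\
  rW w *m map_mx (@complex.Im R) v = map_mx (@complex.Im R) v.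
Proof.
have Rw : map_mx (@complex.Re R) (W_act rW w v) = rW w *m map_mx (@complex.Re R) v.
  apply/matrixP => i j; rewrite !mxE Re_sum; apply: eq_bigr => k _.
  by rewrite !mxE cReM /= mul0r subr0.
have Iw : map_mx (@complex.Im R) (W_act rW w v) = rW w *m map_mx (@complex.Im R) v.
  apply/matrixP => i j; rewrite !mxE Im_sum; apply: eq_bigr => k _.
  by rewrite !mxE cImM /= mul0r addr0.
split=> [wv|]; first by rewrite -Rw -Iw wv.
rewrite -Rw -Iw => -[/matrixP e1 /matrixP e2]; apply/matrixP => i j.
by apply: complex_eqP; [have := e1 i j|have := e2 i j]; rewrite !mxE.
Qed.

Lemma cplx_fix w (x : 'cV[R]_n) : W_act rW w (cplx x) = cplx x <-> rW w *m x = x.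
Proof.
rewrite fix_space_cplx.
have -> : map_mx (@complex.Re R) (cplx x) = x by apply/matrixP => i j; rewrite !mxE.
have -> : map_mx (@complex.Im R) (cplx x) = 0 by apply/matrixP => i j; rewrite !mxE.
by rewrite mulmx0; split=> [[]|].
Qed.

Lemma hyperplane_reflection (H : hyperplane rW) :
  exists2 t, is_reflection rW t & fix_space rW t = H.
Proof.
case: H => U HU /=; have /mapP[t] := HU.
by rewrite mem_filter => /andP[Tt _] ->; exists t.
Qed.

Lemma reflection_hyperplane t : is_reflection rW t ->
  exists H : hyperplane rW, fix_space rW t = H.
Proof.
move=> Tt; have Ht : fix_space rW t \in arrangement rW.
  by apply/mapP; exists t; rewrite // mem_filter Tt mem_enum.
by exists (SeqSub Ht).
Qed.

Lemma real_complement_regular (x : 'cV[R]_n) : real_complement rW x <-> regular x.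
Proof.
split=> [xX t Tt|xr H].
  have [H HE] := reflection_hyperplane Tt.
  by have := xX H; rewrite -HE; apply: contra => /eqP /cplx_fix /fix_spaceP.
have [t Tt <-] := hyperplane_reflection H.
by apply: contra (xr t Tt) => /fix_spaceP /cplx_fix ->.
Qed.

Hypothesis Wgen : <<[set s | is_reflection rW s]%SET>>%g = [set: W]%SET.

(* If v avoids all hyperplanes, so does some real combination of its real and
   imaginary parts. *)
Lemma complement_free (v : 'cV[R[i]]_n) w :
  arr_complement rW v -> W_act rW w v = v -> w = 1%g.
Proof.
move=> vX /fix_space_cplx []; set x := map_mx _ _; set y := map_mx _ _ => wx wy.
pose bad t k := rW t *m (x + k *: y) = x + k *: y.
(* For each t one value of k at which x + k y is fixed by t is recorded, if there is any, and k is
   taken beyond them all. A second such value for the same t would make t fix x and y, hence v. *)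
pose f t := xget 0 [set k | bad t k].
pose k := 1 + \sum_t `|f t|.
have fk t : f t < k.
  rewrite /k (bigD1 t) //=; have := ler_norm (f t).
  have : 0 <= \sum_(i | i != t) `|f i| by apply: sumr_ge0.
  lra.
apply: (@regular_fix (x + k *: y)) => //; last by rewrite mulmxDr -scalemxAr wx wy.
move=> t Tt; apply/eqP => bk.
have bf : bad t (f t) by rewrite /f; case: xgetP => [? -> //|/(_ k)].
have [H HE] := reflection_hyperplane Tt.
have /negP := vX H; rewrite -HE; apply; apply/fix_spaceP/fix_space_cplx.
rewrite -/x -/y.
have yE : rW t *m y = y.
  have : (k - f t) *: (rW t *m y) = (k - f t) *: y.
    move: bk bf; rewrite /bad !mulmxDr -!scalemxAr => bk bf.
    rewrite !scalerBl; apply: (addrI (rW t *m x + f t *: (rW t *m y))).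
    rewrite {2}bf -!addrA ![f t *: _ + _]addrC !subrK bk; done.
  by apply: scalerI; rewrite subr_eq0 gt_eqF.
split=> //; move: bk; rewrite mulmxDr -scalemxAr yE; exact: addIr.
Qed.

Lemma continuous_dot_act a w : continuous (fun x : 'cV[R]_n => dot a (rW w *m x)).
Proof.
pose k j : R := (a^T *m G *m rW w) 0 j.
rewrite (_ : (fun x => _) = fun x : 'cV[R]_n => \sum_(j < n) k j * x j 0).
  apply: continuous_sumR => j x.
  exact: (cvgM (cvg_cst (k j)) (@coord_continuous R n 1 j 0 x)).
by apply/funext => y; rewrite /dot mulmxA mxE.
Qed.

Lemma chamber_sign (C : set 'cV[R]_n) (f : 'cV[R]_n -> R) x y :
  connected C -> continuous f -> (forall x, C x -> f x != 0) ->
  C x -> C y -> 0 < f x -> 0 < f y.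
Proof.
move=> cC cf f0 Cx Cy fx; rewrite lt_neqAle eq_sym f0 //= leNgt; apply/negP => fy.
have /connected_intervalP itv : connected (f @` C).
  by apply: connected_continuous_connected => //; exact: continuous_subspaceT.
have [|c Cc fc] := itv (f y) (f x) (ex_intro2 _ _ y Cy erefl) (ex_intro2 _ _ x Cx erefl) 0.
  by rewrite !ltW.
by have := f0 c Cc; rewrite fc eqxx.
Qed.

(** Let the hyperplane of [t] separate z and s z. Then [root z t] is nonnegative on the closure of C
    and nonpositive on the closure of s C. It vanishes on the face H meets in the closure of C,
    hence on H, which this face spans; so t = s. *)
Lemma wall_simple (C : set 'cV[R]_n) (z : 'cV[R]_n) (H : hyperplane rW) s :
  is_chamber rW C -> C z -> is_wall C H -> is_reflection rW s ->
  fix_space rW s = H -> simple z s.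
Proof.
move=> [x0 x0X CE] Cz wall Ts sH.
have CX c : C c -> regular c.
  by rewrite CE => /connected_component_sub /real_complement_regular.
have cC : connected C by rewrite CE; exact: component_connected.
have zr := CX _ Cz; apply/simpleP => //; split=> // t Tt st.
have [r1 tr tz] := rootP zr Tt; have [r1' sr sz] := rootP zr Ts.
have nz w c : C c -> dot (root z t) (rW w *m c) != 0.
  move=> /CX cr; have := @regular_act c cr w t Tt; apply: contra => /eqP d0.
  by rewrite tr dotC d0 mulr0 scale0r subr0.
have pos c : C c -> 0 < dot (root z t) c.
  move=> Cc; rewrite -[c]act1.
  apply: (@chamber_sign C (fun x => dot (root z t) (rW 1%g *m x)) z) => //.
    exact: continuous_dot_act.
    by move=> y Cy; exact: nz.
  by rewrite act1.
have neg c : C c -> 0 < dot (- root z t) (rW s *m c).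
  move=> Cc; apply: (@chamber_sign C (fun x => dot (- root z t) (rW s *m x)) z) => //.
    exact: continuous_dot_act.
    by move=> y Cy; rewrite dotNl oppr_eq0; exact: nz.
  by rewrite dotNl oppr_gt0.
have closedP a w c : (forall y, C y -> 0 < dot a (rW w *m y)) -> closure C c ->
    0 <= dot a (rW w *m c).
  move=> aC; rewrite closureE => /(_ [set y | 0 <= dot a (rW w *m y)]); apply; split.
    exact: (iffLR (continuous_closedP _) (@continuous_dot_act a w) _ (@closed_ge _ 0)).
  by move=> y /aC /ltW.
pose U := lker (linfun (mulmx ((root z t)^T *m G)) : 'Hom('cV[R]_n, 'cV[R]_1)).
have UP y : (y \in U) = (dot (root z t) y == 0).
  rewrite memv_ker lfunE /= /dot; apply/eqP/eqP => [->|e]; first by rewrite mxE.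
  by apply/matrixP => i j; rewrite !ord1 e mxE.
have HP y : cplx y \in (H : {vspace _}) <-> rW s *m y = y.
  by rewrite -sH; split=> [/fix_spaceP/cplx_fix|/cplx_fix ?] //; apply/fix_spaceP.
have UC y : closure C y -> cplx y \in (H : {vspace _}) -> y \in U.
  move=> Cy /HP sy; rewrite UP eq_le.
  have := closedP _ 1%g y _ Cy; rewrite act1 => -> ; last by move=> c /pos; rewrite act1.
  have := closedP _ s y neg Cy; rewrite dotNl sy oppr_ge0 => ->; done.
have := wall U UC; set a := root z t in r1 tr *; set b := root z s in r1' sr *.
(* The component of a orthogonal to b lies in H, so a is orthogonal to it. This gives <a, b>^2 =
   1. *)
move=> /(_ (a - dot a b *: b)); rewrite HP UP sr dotDl dotNl dotZl r1' mulr1 subrr.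
rewrite mulr0 scale0r subr0 => /(_ erefl); rewrite dotDr dotNr dotZr r1 => /eqP ab.
have : a - dot a b *: b = 0.
  by apply: dot_eq0; rewrite !dotDl !dotDr !dotNl !dotNr !dotZl !dotZr r1 r1' (dotC b a); lra.
move/subr0_eq => aE; apply: reflects_inj tr _ => y; rewrite sr [in RHS]aE.
rewrite dotZr scalerA mulrA; congr (_ - _ *: _).
have e : dot a b * dot a b = 1 by lra.
by rewrite mulrAC -[LHS]mulr1 -e; ring.
Qed.

End RealReflectionGroup.
(** * An invariant norm *)

Section OrbitMetric.
Variables (R : realType) (n : nat) (W : finGroupType).
Variable rW : mx_representation R [set: W]%G n.
Local Notation V := 'cV[R[i]]_n.
Local Notation act := (W_act rW).
Implicit Types (u v : V) (w : W) (r e : R).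

(** A submultiplicative norm with values in [R], whereas the norm of [R[i]] takes values in
    [R[i]]. *)
Definition cnorm1 (a : R[i]) : R := `|Re a| + `|Im a|.

Lemma cnorm1_ge0 a : 0 <= cnorm1 a.
Proof. by rewrite addr_ge0. Qed.

Lemma cnorm1D a b : cnorm1 (a + b) <= cnorm1 a + cnorm1 b.
Proof.
rewrite /cnorm1 cReD cImD.
by have := ler_normD (Re a) (Re b); have := ler_normD (Im a) (Im b); lra.
Qed.

Lemma cnorm1N a : cnorm1 (- a) = cnorm1 a.
Proof. by rewrite /cnorm1 cReN cImN !normrN. Qed.

Lemma cnorm1M a b : cnorm1 (a * b) <= cnorm1 a * cnorm1 b.
Proof.
rewrite /cnorm1 cReM cImM; set p := Re a; set q := Im a; set k := Re b; set l := Im b.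
have := ler_normB (p * k) (q * l); have := ler_normD (p * l) (q * k).
rewrite !normrM mulrDl !mulrDr; lra.
Qed.

Lemma cnorm1_real (k : R) a : cnorm1 (k%:C * a) = `|k| * cnorm1 a.
Proof. by rewrite /cnorm1 cReM cImM /= !mul0r subr0 addr0 !normrM mulrDr. Qed.

Lemma cnorm1_eq0 a : cnorm1 a = 0 -> a = 0.
Proof.
move=> /eqP; rewrite paddr_eq0 // !normr_eq0 => /andP[/eqP ? /eqP ?].
exact: complex_eqP.
Qed.

Lemma W_actB w u v : act w (u - v) = act w u - act w v.
Proof. by rewrite /W_act mulmxBr. Qed.

(** Summing the l1 norm over W makes it invariant, so that distances between orbits can be measured
    from any representative. *)
Definition Wnorm v : R := \sum_w \sum_(j < n) cnorm1 (act w v j 0).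

Lemma Wnorm_ge0 v : 0 <= Wnorm v.
Proof. by apply: sumr_ge0 => w _; apply: sumr_ge0 => j _; exact: cnorm1_ge0. Qed.

Lemma Wnorm_act w v : Wnorm (act w v) = Wnorm v.
Proof.
rewrite /Wnorm [RHS](reindex_inj (mulIg w)) /=.
by apply: eq_bigr => w' _; apply: eq_bigr => j _; rewrite W_actM.
Qed.

Lemma WnormD u v : Wnorm (u + v) <= Wnorm u + Wnorm v.
Proof.
rewrite /Wnorm -big_split; apply: ler_sum => w _; rewrite -big_split.
by apply: ler_sum => j _; rewrite /W_act mulmxDr mxE; exact: cnorm1D.
Qed.

Lemma WnormN v : Wnorm (- v) = Wnorm v.
Proof.
by apply: eq_bigr => w _; apply: eq_bigr => j _; rewrite /W_act mulmxN mxE cnorm1N.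
Qed.

Lemma WnormBC u v : Wnorm (u - v) = Wnorm (v - u).
Proof. by rewrite -WnormN opprB. Qed.

Lemma Wnorm_dist u v (x : V) : Wnorm (u - v) <= Wnorm (u - x) + Wnorm (x - v).
Proof. by have := WnormD (u - x) (x - v); rewrite addrA subrK. Qed.

Lemma Wnorm_real (k : R) v : Wnorm (k%:C *: v) = `|k| * Wnorm v.
Proof.
rewrite /Wnorm mulr_sumr; apply: eq_bigr => w _; rewrite mulr_sumr.
by apply: eq_bigr => j _; rewrite /W_act -scalemxAr mxE cnorm1_real.
Qed.

Lemma Wnorm0 : Wnorm 0 = 0.
Proof. by rewrite -(scale0r (0 : V)) (Wnorm_real 0) normr0 mul0r. Qed.

Lemma coord_le_Wnorm v j : cnorm1 (v j 0) <= Wnorm v.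
Proof.
rewrite /Wnorm (bigD1 1%g) //= (bigD1 j) //= W_act1 -addrA lerDl addr_ge0 //.
  by apply: sumr_ge0 => ? _; exact: cnorm1_ge0.
by apply: sumr_ge0 => ? _; apply: sumr_ge0 => ? _; exact: cnorm1_ge0.
Qed.

Lemma Wnorm_eq0 v : Wnorm v = 0 -> v = 0.
Proof.
move=> v0; apply/matrixP => j i; rewrite ord1 mxE; apply: cnorm1_eq0.
by apply/le_anti; rewrite cnorm1_ge0 -v0 coord_le_Wnorm.
Qed.

Lemma linform_bound (I : finType) (a : I -> 'Hom(V, R[i])) :
  exists2 A : R, 0 < A & forall i v, cnorm1 (a i v) <= A * Wnorm v.
Proof.
exists (1 + \sum_i \sum_j cnorm1 (a i (delta_mx j 0))).
  apply: ltr_wpDr => //; apply: sumr_ge0 => ? _; apply: sumr_ge0 => ? _.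
  exact: cnorm1_ge0.
move=> i v; have -> : a i v = \sum_j v j 0 * a i (delta_mx j 0).
  rewrite {1}[v]matrix_sum_delta linear_sum; apply: eq_bigr => j _.
  by rewrite big_ord1 linearZ.
apply: le_trans (_ : \sum_j cnorm1 (a i (delta_mx j 0)) * Wnorm v <= _).
  elim/big_ind2: _ => [|p p' q q' pp qq|j _].
  - by rewrite /cnorm1 /= normr0 addr0.
  - by apply: le_trans (cnorm1D _ _) _; exact: lerD.
  apply: le_trans (cnorm1M _ _) _; rewrite mulrC ler_wpM2l ?cnorm1_ge0 //.
  exact: coord_le_Wnorm.
rewrite -mulr_suml ler_wpM2r ?Wnorm_ge0 // (bigD1 i) //= addrCA lerDl addr_ge0 //.
by apply: sumr_ge0 => ? _; apply: sumr_ge0 => ? _; exact: cnorm1_ge0.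
Qed.

Definition vcontinuous (T : topologicalType) (g : T -> V) :=
  forall j, ccontinuous (fun x => g x j 0).

Section Vcontinuous.
Variable T : topologicalType.
Implicit Types g h : T -> V.

Lemma vcontinuousP g : continuous g <-> vcontinuous g.
Proof.
split=> [cg j|cg x].
  by split=> x; have /cvg_mx_ReIm /(_ j 0) [] := cg x.
by apply/cvg_mx_ReIm => i j; rewrite ord1; have [cr ci] := cg i; split; [exact: cr|exact: ci].
Qed.

Lemma vcontinuous_cst v : vcontinuous (fun _ : T => v).
Proof. by move=> j; exact: ccontinuous_cst. Qed.

Lemma vcontinuousD g h : vcontinuous g -> vcontinuous h ->
  vcontinuous (fun x => g x + h x).
Proof.
move=> cg ch j; under [X in ccontinuous X]eq_fun do rewrite mxE.
exact: ccontinuousD.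
Qed.

Lemma vcontinuousB g h : vcontinuous g -> vcontinuous h ->
  vcontinuous (fun x => g x - h x).
Proof.
move=> cg ch j; under [X in ccontinuous X]eq_fun do rewrite !mxE.
exact/ccontinuousD/ccontinuousN.
Qed.

Lemma vcontinuousZ (k : T -> R[i]) g : ccontinuous k -> vcontinuous g ->
  vcontinuous (fun x => k x *: g x).
Proof.
move=> ck cg j; under [X in ccontinuous X]eq_fun do rewrite !mxE.
exact: ccontinuousM.
Qed.

Lemma ccontinuous_sum (I : Type) (r : seq I) (f : I -> T -> R[i]) :
  (forall i, ccontinuous (f i)) -> ccontinuous (fun x => \sum_(i <- r) f i x).
Proof.
move=> cf; split; under [X in continuous X]eq_fun do rewrite ?Re_sum ?Im_sum;
  by apply: continuous_sumR => i; have [] := cf i.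
Qed.

Lemma vcontinuous_sum (I : Type) (r : seq I) (f : I -> T -> V) :
  (forall i, vcontinuous (f i)) -> vcontinuous (fun x => \sum_(i <- r) f i x).
Proof.
move=> cf j; under [X in ccontinuous X]eq_fun do rewrite summxE.
by apply: ccontinuous_sum => i; exact: cf.
Qed.

Lemma vcontinuous_act w g : vcontinuous g -> vcontinuous (fun x => act w (g x)).
Proof.
move=> cg j; under [X in ccontinuous X]eq_fun do rewrite mxE.
by apply: ccontinuous_sum => i; apply: ccontinuousM => //; exact: ccontinuous_cst.
Qed.

Lemma vcontinuous_linform (a : 'Hom(V, R[i])) g :
  vcontinuous g -> ccontinuous (fun x => a (g x)).
Proof.
move=> cg; rewrite (_ : (fun x => _) = fun x => \sum_j g x j 0 * a (delta_mx j 0)).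
  by apply: ccontinuous_sum => j; apply: ccontinuousM => //; exact: ccontinuous_cst.
apply/funext => x; rewrite {1}[g x]matrix_sum_delta linear_sum.
by apply: eq_bigr => j _; rewrite big_ord1 linearZ.
Qed.

Lemma continuous_Wnorm g : vcontinuous g -> continuous (fun x => Wnorm (g x)).
Proof.
move=> cg; apply: continuous_sumR => w; apply: continuous_sumR => j x.
have [c1 c2] := vcontinuous_act w cg j.
by apply: cvgD; apply: cvg_norm; [exact: c1|exact: c2].
Qed.

Lemma Wnorm_vcontinuous g :
  (forall x e, 0 < e -> \forall y \near x, Wnorm (g x - g y) < e) -> vcontinuous g.
Proof.
move=> gN j; split=> x; apply/cvgrPdist_lt => e /(gN x); apply: filterS => y;
  apply: le_lt_trans; apply: le_trans (coord_le_Wnorm _ j); rewrite !mxE /cnorm1.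
  by rewrite cReD cReN lerDl.
by rewrite cImD cImN lerDr.
Qed.

End Vcontinuous.
End OrbitMetric.
(** * Lifting paths from the orbit space *)

Lemma ltr_double (K : realFieldType) (r a b : K) :
  a < r -> b < r -> 2 * r <= a + b -> False.
Proof. by lra. Qed.

Lemma lerD_absorb (K : realFieldType) (r a b : K) :
  8 * r <= a + b -> a <= r -> 0 <= r -> 4 * r <= b.
Proof. by lra. Qed.

Lemma lt_minP (K : realFieldType) (x a b : K) : x < Num.min a b -> x < a /\ x < b.
Proof. by rewrite lt_min => /andP. Qed.

(* Unifying two distinct values of these functions would unfold matrix products. *)
Local Opaque W_act Wnorm.

Section Lifting.
Variables (R : realType) (n : nat) (W : finGroupType).
Variable rW : mx_representation R [set: W]%G n.
Local Notation V := 'cV[R[i]]_n.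
Local Notation X := (arr_complement rW).
Local Notation act := (W_act rW).
Local Notation Wnorm := (Wnorm rW).
Variable alpha : hyperplane rW -> 'Hom(V, R[i]).
Hypothesis alphaP : forall H, lker (alpha H) = H.
Hypothesis Xfree : forall (v : V) (w : W), X v -> act w v = v -> w = 1%g.
Variable A : R.
Hypothesis A0 : 0 < A.
Hypothesis AP : forall H (v : V), cnorm1 (alpha H v) <= A * Wnorm v.
Implicit Types (u v : V) (w : W) (r e : R) (H : hyperplane rW).

Lemma complementE v : X v <-> forall H, alpha H v != 0.
Proof. by split=> vX H; have := vX H; rewrite -alphaP memv_ker. Qed.

Lemma complement_act w v : X v -> X (act w v).
Proof.
move=> vX H; apply: contra (vX (hyperplane_act w^-1%g H)) => wvH.
by rewrite /= image_spaceP invgK.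
Qed.

(* Quantitative membership in X, uniform over the orbit of v. *)
Definition well_inside r v :=
  (forall w, w != 1%g -> 2 * r <= Wnorm (v - act w v)) /\
  (forall H w, 4 * A * r <= cnorm1 (alpha H (act w v))).

Lemma well_inside_act r w v : well_inside r v -> well_inside r (act w v).
Proof.
move=> [v1 v2]; split=> [w' w'1|H w']; last by rewrite -W_actM.
have -> : act w v - act w' (act w v) = act w (v - act (w' ^ w)%g v).
  by rewrite W_actB conjgE !W_actM W_actVK.
rewrite Wnorm_act; apply: v1; apply: contra w'1 => /eqP e.
by rewrite -(conjgK w w') e conj1g.
Qed.

Lemma well_insideW r r' v : r <= r' -> well_inside r' v -> well_inside r v.
Proof.
move=> rr [v1 v2]; split=> [w w1|H w].
  by apply: le_trans (v1 w w1); rewrite ler_wpM2l.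
by apply: le_trans (v2 H w); rewrite ler_wpM2l // mulr_ge0 // ltW.
Qed.

Lemma well_inside_ex v : X v -> exists2 r, 0 < r & well_inside r v.
Proof.
move=> vX.
have posmin (I : finType) (P : pred I) (f : I -> R) : (forall i, P i -> 0 < f i) ->
    exists2 m, 0 < m & forall i, P i -> m <= f i.
  move=> f0; exists (\big[Num.min/1]_(i | P i) f i).
    by elim/big_ind: _ => // x y x0 y0; rewrite lt_min x0.
  by move=> i Pi; rewrite (bigD1 i) //= ge_min lexx.
have [|m1 m10 m1P] := @posmin W (fun w => w != 1%g) (fun w => Wnorm (v - act w v)).
  move=> w w1; rewrite lt_neqAle Wnorm_ge0 andbT eq_sym; apply: contra w1 => /eqP.
  by move=> /(@Wnorm_eq0 _ _ _ rW) /subr0_eq /esym /(Xfree vX) ->.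
have [|m2 m20 m2P] := @posmin (hyperplane rW * W)%type predT
    (fun Hw => cnorm1 (alpha Hw.1 (act Hw.2 v))).
  move=> [H w] _ /=; rewrite lt_neqAle cnorm1_ge0 andbT eq_sym.
  apply/eqP => /cnorm1_eq0 e.
  by have /complementE /(_ H) := complement_act w vX; rewrite e eqxx.
exists (Num.min (m1 / 2) (m2 / (4 * A))).
  by rewrite lt_min !divr_gt0 // mulr_gt0.
split=> [w w1|H w].
  apply: le_trans (m1P w w1).
  by rewrite mulrC -ler_pdivlMr // ge_min lexx.
apply: le_trans (m2P (H, w) isT).
by rewrite mulrC -ler_pdivlMr ?mulr_gt0 // ge_min lexx orbT.
Qed.

(** Moving u by less than r costs at most 2r out of the 4r available in the first condition, and at
    most A r out of 8 A r in the second. *)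
Lemma well_inside_near r w u v : well_inside (2 * r) u -> Wnorm (u - act w v) < r ->
  well_inside r v.
Proof.
move=> /= gu uv; rewrite -[v](W_actK rW w); apply: well_inside_act.
move: (act w v) uv => {}v uv; case: gu => u1 u2; split=> [w' w1|H w'].
  have := u1 w' w1; have := Wnorm_dist rW u (act w' u) v.
  have := Wnorm_dist rW v (act w' u) (act w' v).
  rewrite -W_actB Wnorm_act (WnormBC rW v u).
  move: (Wnorm (u - v)) (Wnorm (u - act w' u)) (Wnorm (v - act w' u)) uv.
  by move: (Wnorm (v - act w' v)) => a b c d bd h1 h2 h3; lra.
have uE : alpha H (act w' u) = alpha H (act w' (u - v)) + alpha H (act w' v).
  by rewrite W_actB linearB /= subrK.
have := u2 H w'; rewrite uE.
have := cnorm1D (alpha H (act w' (u - v))) (alpha H (act w' v)).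
have := AP H (act w' (u - v)); rewrite Wnorm_act => AP1 D1.
have Ar : A * Wnorm (u - v) <= A * r by rewrite ler_wpM2l // ltW.
have Ar0 : 0 <= A * r by rewrite mulr_ge0 // ltW // (le_lt_trans _ uv) // Wnorm_ge0.
have -> : 4 * A * (2 * r) = 8 * (A * r) by ring.
have -> : 4 * A * r = 4 * (A * r) by ring.
move=> h; have {}h := le_trans h D1; have Ar1 := le_trans AP1 Ar.
by move: h Ar1 Ar0; exact: (@lerD_absorb R).
Qed.

Lemma well_inside_neq0 r v H : 0 < r -> well_inside r v -> alpha H v != 0.
Proof.
move=> r0 [_ /(_ H 1%g)]; rewrite W_act1 => h; apply/eqP => v0; move: h.
by rewrite v0 /cnorm1 /= normr0 addr0 leNgt !mulr_gt0.
Qed.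

(** Two translates within r of u are less than 2r apart, so they are given by the same group
    element. This plays the part of an evenly covered neighbourhood. *)
Lemma near_orbit_uniq r u v w w' : well_inside r v -> Wnorm (u - act w v) < r ->
  Wnorm (u - act w' v) < r -> w = w'.
Proof.
move=> [gv _] uw uw'; apply/eqP; rewrite eq_mulVg1; apply/negPn/negP => ww.
have := gv _ ww; rewrite -(Wnorm_act rW w) W_actB -W_actM mulKVg.
move=> h; have := le_trans h (Wnorm_dist rW (act w v) (act w' v) u).
rewrite (WnormBC rW (act w v) u).
exact: (@ltr_double R r (Wnorm (u - act w v)) (Wnorm (u - act w' v)) uw uw').
Qed.

(** Continuity of the image of f in V / W, expressed on representatives: f may jump inside an
    orbit. *)
Definition wcontinuous (T : topologicalType) (f : T -> V) :=
  forall x e, 0 < e -> \forall y \near x, exists w, Wnorm (f x - act w (f y)) < e.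

Lemma wcontinuous_comp (T U : topologicalType) (f : T -> V) (g : U -> T) :
  wcontinuous f -> continuous g -> wcontinuous (f \o g).
Proof. by move=> wf cg x e e0; exact: (cg x _ (wf (g x) e e0)). Qed.

Lemma vcontinuous_near (T : topologicalType) (g : T -> V) : vcontinuous g ->
  forall x e, 0 < e -> \forall y \near x, Wnorm (g x - g y) < e.
Proof.
move=> cg x e e0.
have : continuous (fun y => Wnorm (g x - g y)).
  by apply: continuous_Wnorm; apply: vcontinuousB => //; exact: vcontinuous_cst.
by move=> /(_ x) /cvgr_lt; apply; rewrite subrr Wnorm0.
Qed.

Lemma vcontinuousW (T : topologicalType) (g : T -> V) : vcontinuous g -> wcontinuous g.
Proof.
move=> /vcontinuous_near cg x e e0; apply: filterS (cg x e e0) => y.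
by exists 1%g; rewrite W_act1.
Qed.

Definition is_wlift (f g : R -> V) :=
  vcontinuous g /\ forall t, 0 <= t <= 1 -> exists w, g t = act w (f t).

(** At each time only one representative lies within r of u, and this forced choice is
    continuous. *)
Lemma local_wlift r (f : R -> V) u : wcontinuous f -> (forall t, well_inside r (f t)) ->
  (forall t, exists w, Wnorm (u - act w (f t)) < r) ->
  exists h : R -> V, [/\ vcontinuous h, forall t, exists w, h t = act w (f t) &
                       forall t, Wnorm (u - h t) < r].
Proof.
move=> cf gf /choice[w wP]; exists (fun t => act (w t) (f t)); split=> //; last first.
  by move=> t; exists (w t).
apply: (@Wnorm_vcontinuous _ _ _ rW) => t e e0.
(* The second bound keeps the translate of f t' inside the ball of radius r about u, so that it is
   the representative already chosen there. *)
have m0 : 0 < Num.min e (r - Wnorm (u - act (w t) (f t))).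
  by rewrite lt_min e0 subr_gt0 wP.
have := cf t _ m0; apply: filterS => t' [w'] /lt_minP[e1 e2].
suff <- : (w t * w')%g = w t' by rewrite W_actM -W_actB Wnorm_act.
apply: (near_orbit_uniq (r := r) (u := u) (gf t')) => //.
apply: le_lt_trans (Wnorm_dist rW _ _ (act (w t) (f t))) _.
by rewrite W_actM -W_actB Wnorm_act -ltrBrDl.
Qed.

Section PathLifting.
Variables (f : R -> V) (r : R) (M : nat).
Hypothesis cf : wcontinuous f.
Hypothesis r0 : 0 < r.
Hypothesis gf : forall t, well_inside r (f t).
Hypothesis M0 : (0 < M)%N.
Hypothesis fM : forall t t', `|t - t'| <= M%:R^-1 ->
  exists w, Wnorm (f t - act w (f t')) < r.

Lemma wlift_ex z : (exists w, z = act w (f 0)) -> (forall t, t <= 0 -> f t = f 0) ->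
  exists2 g, is_wlift f g & g 0 = z.
Proof.
move=> zf f0.
have Mp : 0 < M%:R^-1 :> R by rewrite invr_gt0 ltr0n.
have [g [cg g0 gP]] : exists g : R -> V, [/\ vcontinuous g, g 0 = z &
    forall t, exists w, g t = act w (f (Num.min t (M%:R / M%:R)))].
  elim: {1}M => [|k [g [cg g0 gP]]].
    (* At stage 0 the truncated path is f (min t 0), constant because f is constant on negative
       times. *)
    exists (fun _ => z); split=> //; first exact: vcontinuous_cst.
    by move=> t; rewrite f0 // mul0r ge_min lexx orbT.
  pose a : R := k%:R / M%:R; pose b : R := k.+1%:R / M%:R.
  have bE : b = a + M%:R^-1 by rewrite /b /a -natr1 mulrDl mul1r.
  have a0 : 0 <= a by rewrite divr_ge0.
  have [w0 gaE] := gP a; rewrite -/a minxx in gaE.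
  (* Freezing f outside [a, b] keeps all values within one step of f a, as [local_wlift] requires at
     every real time. *)
  pose f1 t := f (Num.max a (Num.min t b)).
  have cf1 : wcontinuous f1.
    apply: (wcontinuous_comp cf) => t.
    apply: (@continuous_max R R (cst a) (fun t => Num.min t b)); first exact: cvg_cst.
    by apply: (@continuous_min R R id (cst b)); [exact: cvg_id|exact: cvg_cst].
  have [|h [ch hP hN]] := @local_wlift r f1 (g a) cf1 (fun t => gf _).
    move=> t; have [|w wN] := fM (t := a) (t' := Num.max a (Num.min t b)).
      rewrite distrC ger0_norm ?subr_ge0 ?le_max ?lexx //.
      by rewrite lerBlDl -bE ge_max bE lerDl (ltW Mp) /= ge_min lexx orbT.
    by exists (w0 * w)%g; rewrite gaE W_actM -W_actB Wnorm_act.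
  have ha : h a = g a.
    have [w1 haE] := hP a.
    have f1a : f1 a = f a by rewrite /f1 bE min_l ?maxxx // lerDl ltW.
    rewrite haE gaE f1a; congr (act _ _).
    apply: (near_orbit_uniq (r := r) (u := g a) (gf a)); first by rewrite -f1a -haE.
    by rewrite gaE subrr Wnorm0.
  exists (fun t => if t <= a then g t else h t); split.
  - apply/vcontinuousP; apply: continuous_glue.
    + by move=> t; exact: cvg_id.
    + exact/vcontinuousP.
    + exact/vcontinuousP.
    + by move=> t ->.
  - by rewrite a0.
  move=> t; rewrite -/b; case: (leP t a) => ta.
    have [w gtE] := gP t; exists w; rewrite gtE -/a !min_l //.
    by rewrite bE (le_trans ta) // lerDl ltW.
  have [w htE] := hP t; exists w; rewrite htE /f1 max_r //.
  by rewrite le_min (ltW ta) bE lerDl ltW.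
exists g => //; split=> // t /andP[_ t1]; have [w ->] := gP t; exists w.
by rewrite divff ?pnatr_eq0 -?lt0n // min_l.
Qed.

End PathLifting.

(** The distance starts at 0. If it reached r, then at a time where it equals r the translate of h
    closer than r to g would differ from h, though the two are less than 2r apart. *)
Lemma close_wlifts r (g h : R -> V) : 0 < r -> vcontinuous g -> vcontinuous h ->
  g 0 = h 0 -> (forall t, 0 <= t <= 1 -> well_inside r (h t)) ->
  (forall t, 0 <= t <= 1 -> exists w, Wnorm (g t - act w (h t)) < r) ->
  forall t, 0 <= t <= 1 -> Wnorm (g t - h t) < r.
Proof.
move=> r0 cg ch gh0 gh ghN t /andP[t0 t1]; rewrite ltNge; apply/negP => rt.
have cN : continuous (fun s => Wnorm (g s - h s)).
  by apply: continuous_Wnorm; exact: vcontinuousB.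
have [] := @IVT R (fun s => Wnorm (g s - h s)) 0 t r t0.
- exact: continuous_subspaceT.
- by rewrite gh0 subrr Wnorm0 ge_min le_max (ltW r0) rt orbT.
move=> s; rewrite in_itv /= => /andP[s0 st] sE.
have s01 : 0 <= s <= 1 by rewrite s0 (le_trans st).
have [w wN] := ghN s s01; have [e|w1] := eqVneq w 1%g.
  by move: wN; rewrite e W_act1 sE ltxx.
have [/(_ w w1) + _] := gh s s01.
move=> h1; have := le_trans h1 (Wnorm_dist rW (h s) (act w (h s)) (g s)).
rewrite (WnormBC rW (h s) (g s)) sE.
by move: (Wnorm (g s - act w (h s))) wN => a *; lra.
Qed.

(* q = p exp(L) for a continuous L vanishing at both endpoints: the paths p and q in
   C^* have the same endpoints and the same increment of logarithm. *)
Definition log_equivalent (p q : R -> R[i]) := exists L : R -> R[i],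
  [/\ ccontinuous L, L 0 = 0, L 1 = 0 &
      forall t, 0 <= t <= 1 -> q t = p t * cexp (L t)].

Lemma log_equivalent_trans p q s :
  log_equivalent p q -> log_equivalent q s -> log_equivalent p s.
Proof.
move=> [L [cL L0 L1 LP]] [K [cK K0 K1 KP]]; exists (fun t => L t + K t); split.
- exact: ccontinuousD.
- by rewrite L0 K0 addr0.
- by rewrite L1 K1 addr0.
- by move=> t t01; rewrite KP // LP // cexpD mulrA.
Qed.

(** With d = q - p, the l1 norms satisfy |d| |p| <= |p|^2 / 4, at most half of the squared modulus
    of p; hence Re (d / p) >= -1/2. This is where the factor 4 of [well_inside] comes from. *)
Lemma Re_ratio_gt0 (p q : R[i]) : p != 0 -> cnorm1 (q - p) <= cnorm1 p / 4 ->
  0 < Re (q / p).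
Proof.
move=> p0; have -> : q / p = (q - p) / p + 1 by rewrite mulrBl divff // subrK.
move: (q - p) => d dp.
rewrite cReD /=; have : 0 < cnorm1 p.
  by rewrite lt_neqAle cnorm1_ge0 andbT eq_sym; apply: contra p0 => /eqP /cnorm1_eq0 ->.
case: p d p0 dp => a b [c e] _; rewrite /cnorm1 /= => dp p0.
set m := a ^+ 2 + b ^+ 2.
have m0 : (`|a| + `|b|) ^+ 2 <= 2 * m.
  rewrite /m -[a ^+ 2]real_normK ?num_real // -[b ^+ 2]real_normK ?num_real //.
  by have := sqr_ge0 (`|a| - `|b|); lra.
have mp : 0 < m by have := exprn_gt0 2 p0; lra.
have -> : c * (a / m) - e * - (b / m) + 1 = (c * a + e * b + m) / m.
  by field; rewrite gt_eqF.
apply: divr_gt0 => //.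
have ca : - (`|c| * `|a|) <= c * a by have := ler_norm (- (c * a)); rewrite normrN normrM; lra.
have eb : - (`|e| * `|b|) <= e * b by have := ler_norm (- (e * b)); rewrite normrN normrM; lra.
have : (`|c| + `|e|) * (`|a| + `|b|) <= (`|a| + `|b|) ^+ 2 / 4.
  by rewrite expr2 mulrAC ler_wpM2r // ltW.
have : 0 <= `|c| * `|b| by rewrite mulr_ge0.
have : 0 <= `|e| * `|a| by rewrite mulr_ge0.
lra.
Qed.

Lemma continuous_itv_clamp : continuous (fun t : R => itv_val (clamp01 t)).
Proof.
move=> t; apply: (@continuous_comp _ _ _ (@clamp01 R) (@itv_val R)).
  exact: continuous_clamp01.
exact: continuous_itv_val.
Qed.

Lemma vcontinuous_comp (T U : topologicalType) (g : T -> V) (h : U -> T) :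
  vcontinuous g -> continuous h -> vcontinuous (g \o h).
Proof.
move=> /vcontinuousP cg ch; apply/vcontinuousP => x.
by apply: continuous_comp; [exact: ch|exact: cg].
Qed.

(** The logarithm sought is [clog] of the ratio: |alpha_H(h - g)| <= A r while |alpha_H(g)| >= 4 A
    r, so the ratio stays in the right half-plane and equals 1 at both ends. *)
Lemma close_log_equivalent r H (g h : R -> V) : 0 < r ->
  vcontinuous g -> vcontinuous h -> g 0 = h 0 -> g 1 = h 1 ->
  (forall t, 0 <= t <= 1 -> well_inside r (g t)) ->
  (forall t, 0 <= t <= 1 -> Wnorm (g t - h t) < r) ->
  log_equivalent (fun t => alpha H (g t)) (fun t => alpha H (h t)).
Proof.
move=> r0 cg ch gh0 gh1 gg gh.
pose c t : R := itv_val (clamp01 t); have c01 t : 0 <= c t <= 1 by exact: itv_val01.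
have p0 t : alpha H (g (c t)) != 0 by exact: well_inside_neq0 (gg _ (c01 t)).
have cc t : 0 <= t <= 1 -> c t = t by exact: clamp01K.
have q0 t : 0 < Re (alpha H (h (c t)) / alpha H (g (c t))).
  apply: Re_ratio_gt0 => //; rewrite -linearB.
  apply: le_trans (AP _ _) _; rewrite ler_pdivlMr //.
  have [_ /(_ H 1%g)] := gg _ (c01 t); rewrite W_act1; apply: le_trans.
  rewrite mulrC mulrA ler_wpM2l ?mulr_ge0 ?(ltW A0) //.
  by rewrite WnormBC; apply: ltW; apply: gh.
exists (fun t => clog (alpha H (h (c t)) / alpha H (g (c t)))).
have z01 : 0 <= (0 : R) <= 1 by rewrite lexx ler01.
have o01 : 0 <= (1 : R) <= 1 by rewrite lexx ler01.
split.
- apply: ccontinuous_clog => //; apply: ccontinuousM.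
    apply: vcontinuous_linform; apply: (vcontinuous_comp ch); exact: continuous_itv_clamp.
  apply: ccontinuousV => //.
  apply: vcontinuous_linform; apply: (vcontinuous_comp cg); exact: continuous_itv_clamp.
- by rewrite -[LHS]/(clog _) cc // -gh0 divff ?clog1 // -(cc 0 z01).
- by rewrite -[LHS]/(clog _) cc // -gh1 divff ?clog1 // -(cc 1 o01).
- move=> t t01; rewrite clogK // !cc // mulrC divfK //.
  by rewrite -(cc t t01).
Qed.

Definition clampR (t : R) : R := itv_val (clamp01 t).

Lemma clampR01 t : 0 <= clampR t <= 1.
Proof. exact: itv_val01. Qed.

Lemma clampRE t : 0 <= t <= 1 -> clampR t = t.
Proof. exact: clamp01K. Qed.

Lemma clampR_ge1 t : 1 <= t -> clampR t = 1.
Proof. by move=> t1; rewrite /clampR clamp01_ge1 // clamp01K // ler01 lexx. Qed.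

Lemma clampR_le0 t : t <= 0 -> clampR t = 0.
Proof. by move=> t0; rewrite /clampR clamp01_le0 // clamp01K // ler01 lexx. Qed.

Lemma clampR_dist t t' : `|clampR t - clampR t'| <= `|t - t'|.
Proof.
have cE x : clampR x = Num.max 0 (Num.min x 1) by [].
have wlog_le a b : a <= b -> `|clampR a - clampR b| <= `|a - b|.
  move=> ab; rewrite distrC (distrC a) [leRHS]ger0_norm ?subr_ge0 //.
  rewrite !cE; case: (lerP a 1) => a1; case: (lerP b 1) => b1;
  case: (lerP 0 a) => a0; case: (lerP 0 b) => b0;
  rewrite ?(max_r ler01) ?(max_l (ltW a0)) ?(max_r a0) ?(max_l (ltW b0)) ?(max_r b0);
  by rewrite ler_norml; lra.
case: (leP t t') => [|/ltW] /wlog_le //.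
by rewrite distrC (distrC t').
Qed.

Definition unit_square : set (R * R) := `[0, 1]%classic `*` `[0, 1]%classic.

Lemma unit_squareP p : unit_square (clampR p.1, clampR p.2).
Proof. by split; rewrite /= in_itv /= clampR01. Qed.

Lemma near_covering_unit_square : near_covering unit_square.
Proof.
by apply/compact_near_coveringP; apply: compact_setX; exact: segment_compact.
Qed.

(** Here [D e] stands for a relation of being e-close, kept abstract because it is used both for a
    distance in V and for closeness modulo W. *)
Lemma lebesgue_number (D : R -> R * R -> R * R -> Prop) :
  (forall e p q, D e p q -> D e q p) ->
  (forall e p q x, D (e / 2) p x -> D (e / 2) x q -> D e p q) ->
  (forall x e, 0 < e -> \forall y \near x, D e x y) ->
  forall e, 0 < e -> exists2 M : nat, (0 < M)%N & forall p q, unit_square p ->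
    `|p.1 - q.1| <= M%:R^-1 -> `|p.2 - q.2| <= M%:R^-1 -> D e p q.
Proof.
move=> Dsym Dtri Dnear e e0.
pose P (m : nat) p := forall q, `|p.1 - q.1| <= m.+1%:R^-1 ->
  `|p.2 - q.2| <= m.+1%:R^-1 -> D e p q.
suff : \forall m \near \oo, unit_square `<=` P m.
  by move=> /filter_ex [m mP]; exists m.+1 => // p q Kp; exact: mP.
apply: near_covering_unit_square => x Kx.
have e20 : 0 < e / 2 by rewrite divr_gt0.
have /nbhs_ballP[d /= d0 dP] := Dnear x (e / 2) e20.
have d2 : 0 < d / 2 by rewrite divr_gt0.
have dd : d / 2 < d by rewrite ltr_pdivrMr // ltr_pMr // ltr1n.
exists (ball x (d / 2), [set m | m.+1%:R^-1 < d / 2]).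
  split; first exact: nbhsx_ballx.
  exact: (near_infty_natSinv_lt (PosNum d2)).
move=> [p m] [/= [p1 p2] md] q q1 q2; apply: (Dtri _ _ _ x).
  by apply/Dsym/dP; split; [apply: lt_trans p1 dd|apply: lt_trans p2 dd].
apply: dP; split; rewrite /ball /= [d]splitr.
  by apply: le_lt_trans (ler_distD p.1 _ _) _; apply: ltrD p1 (le_lt_trans q1 md).
by apply: le_lt_trans (ler_distD p.2 _ _) _; apply: ltrD p2 (le_lt_trans q2 md).
Qed.

Lemma uniform_inside (f : R * R -> V) : wcontinuous f -> (forall p, X (f p)) ->
  exists2 r, 0 < r & forall p, unit_square p -> well_inside r (f p).
Proof.
move=> cf fX; pose P (m : nat) p := well_inside m.+1%:R^-1 (f p).
suff : \forall m \near \oo, unit_square `<=` P m.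
  by move=> /filter_ex [m mP]; exists m.+1%:R^-1.
apply: near_covering_unit_square => x Kx.
have [r r0 rP] := well_inside_ex (fX x).
have r2 : 0 < r / 2 by rewrite divr_gt0.
exists ([set y | exists w, Wnorm (f x - act w (f y)) < r / 2],
        [set m | m.+1%:R^-1 < r / 2]).
  split; first exact: cf.
  exact: (near_infty_natSinv_lt (PosNum r2)).
move=> [p m] [/= [w wN] md]; apply: (@well_insideW _ (r / 2)); first exact: ltW.
apply: well_inside_near wN; rewrite mulrC divfK //.
Qed.

Lemma wcontinuous_near_sym r u v w : Wnorm (u - act w v) < r ->
  Wnorm (v - act w^-1%g u) < r.
Proof. by rewrite WnormBC -(Wnorm_act rW w^-1%g) W_actB W_actK WnormBC WnormBC. Qed.

Lemma Wnorm_lt_split r u v (x : V) : Wnorm (u - v) < r / 2 -> Wnorm (v - x) < r / 2 ->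
  Wnorm (u - x) < r.
Proof.
by move=> h1 h2; rewrite [r]splitr; apply: le_lt_trans (Wnorm_dist rW u x v) (ltrD h1 h2).
Qed.

Lemma wcontinuous_uniform (f : R * R -> V) : wcontinuous f ->
  forall e, 0 < e -> exists2 M : nat, (0 < M)%N & forall p q, unit_square p ->
    `|p.1 - q.1| <= M%:R^-1 -> `|p.2 - q.2| <= M%:R^-1 ->
    exists w, Wnorm (f p - act w (f q)) < e.
Proof.
move=> cf; apply: lebesgue_number => [e p q [w wN]|e p q x [w wN] [w' wN']|].
- by exists w^-1%g; exact: wcontinuous_near_sym.
- exists (w * w')%g; apply: Wnorm_lt_split wN _.
  by rewrite W_actM -W_actB Wnorm_act.
- exact: cf.
Qed.

(** * Homotopy invariance of endpoints and logarithms *)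

Section Homotopy.
Variables (F : R * R -> V) (z : V).
Hypothesis cF : wcontinuous F.
Hypothesis FX : forall p, X (F p).
Hypothesis Fclamp : forall t s, F (t, s) = F (clampR t, clampR s).
Hypothesis F0 : forall s, exists w, z = act w (F (0, s)).
Hypothesis F1 : forall s, exists w, z = act w (F (1, s)).

Let slice s t := F (t, s).

Let wcontinuous_slice s : wcontinuous (slice s).
Proof.
apply: (wcontinuous_comp (f := F) cF (g := fun t => (t, s))).
by apply: continuous_pair_map => t; [exact: cvg_id|exact: cvg_cst].
Qed.

Lemma slice_wlift_ex s : exists2 g, is_wlift (slice s) g & g 0 = z.
Proof.
have [r r0 rP] := uniform_inside cF FX.
have [M M0 MP] := wcontinuous_uniform cF r0.
apply: (@wlift_ex (slice s) r M) => //.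
- by move=> t; rewrite /slice Fclamp; apply: rP; exact: (unit_squareP (t, s)).
- move=> t t' tt'; rewrite /slice !(Fclamp _ s); apply: MP => /=.
  + exact: (unit_squareP (t, s)).
  + exact: le_trans (clampR_dist _ _) tt'.
  + by rewrite subrr normr0 invr_ge0.
- exact: F0.
- move=> t t0; rewrite /slice Fclamp [RHS]Fclamp; congr (F (_, _)).
  by rewrite /clampR clamp01_le0.
Qed.

(** Lifts of slices at parameters at most 1/M apart remain close, so they share their endpoint and
    their logarithmic increment. Going through M slices, each lifted separately, avoids lifting the
    homotopy as a whole. *)
Lemma homotopic_wlifts g0 g1 :
  is_wlift (slice 0) g0 -> g0 0 = z -> is_wlift (slice 1) g1 -> g1 0 = z ->
  g0 1 = g1 1 /\
  forall H, log_equivalent (fun t => alpha H (g0 t)) (fun t => alpha H (g1 t)).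
Proof.
have [r r0 rP] := uniform_inside cF FX.
have [M M0 MP] := wcontinuous_uniform cF r0.
have Fr t s : well_inside r (F (t, s)).
  by rewrite Fclamp; apply: rP; exact: (unit_squareP (t, s)).
have zr : well_inside r z by have [w ->] := F0 0; exact: well_inside_act.
have o01 : 0 <= (1 : R) <= 1 by rewrite lexx ler01.
have close s s' g h : `|s - s'| <= M%:R^-1 -> is_wlift (slice s) g -> g 0 = z ->
    is_wlift (slice s') h -> h 0 = z -> g 1 = h 1 /\
    forall H, log_equivalent (fun t => alpha H (g t)) (fun t => alpha H (h t)).
  move=> ss' [cg gP] gz [ch hP] hz.
  have gN t : 0 <= t <= 1 -> Wnorm (g t - h t) < r.
    apply: close_wlifts => //; first by rewrite gz hz.
      by move=> {}t t01; have [w ->] := hP t t01; exact: (well_inside_act w (Fr t s')).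
    move=> {}t t01; have [w wE] := gP t t01; have [w' w'E] := hP t t01.
    have [w0 w0N] : exists w0, Wnorm (F (t, s) - act w0 (F (t, s'))) < r.
      rewrite (Fclamp t s) (Fclamp t s'); apply: MP => /=.
      + exact: (unit_squareP (t, s)).
      + by rewrite subrr normr0 invr_ge0.
      + exact: le_trans (clampR_dist _ _) ss'.
    exists (w * w0 * w'^-1)%g.
    by rewrite wE w'E !W_actM W_actK -W_actB Wnorm_act.
  (* Both endpoints lie in the orbit of z and are closer than r, so they coincide. *)
  have gh1 : g 1 = h 1.
    have [w wE] := gP 1 o01; have [w' w'E] := hP 1 o01.
    have [a aE] := F1 s; have [a' a'E] := F1 s'.
    have gE : g 1 = act (w * a^-1)%g z by rewrite W_actM aE W_actK.
    have hE : h 1 = act (w' * a'^-1)%g z by rewrite W_actM a'E W_actK.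
    rewrite gE hE; congr (act _ z).
    apply: (near_orbit_uniq (r := r) (u := g 1) zr); first by rewrite gE subrr Wnorm0.
    by rewrite -hE; exact: gN.
  split=> // H; apply: (@close_log_equivalent r) => //; first by rewrite gz hz.
  by move=> t t01; have [w ->] := gP t t01; exact: (well_inside_act w (Fr t s)).
have chain k h : is_wlift (slice (k%:R / M%:R)) h -> h 0 = z -> is_wlift (slice 0) g0 ->
    g0 0 = z -> g0 1 = h 1 /\
    forall H, log_equivalent (fun t => alpha H (g0 t)) (fun t => alpha H (h t)).
  move=> + + g0P g0z; elim: k h => [|k IH] h hP hz.
    by apply: (close 0 (0%:R / M%:R)) => //; rewrite mul0r subrr normr0 invr_ge0.
  have [h' h'P h'z] := slice_wlift_ex (k%:R / M%:R).
  have [e1 l1] := IH h' h'P h'z.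
  have [|e2 l2] := close (k%:R / M%:R) (k.+1%:R / M%:R) h' h _ h'P h'z hP hz.
    by rewrite -mulrBl -natr1 opprD addNKr mulN1r normrN ger0_norm ?invr_ge0.
  by split=> [|H]; [rewrite e1|exact: log_equivalent_trans (l1 H) (l2 H)].
move=> g0P g0z g1P g1z; apply: (chain M) => //.
by rewrite divff // pnatr_eq0 -lt0n.
Qed.

End Homotopy.

(** * Polygonal approximation of lifts *)

Section Polygon.
Variable g : R -> V.
Hypothesis cg : vcontinuous g.
Variable M : nat.
Hypothesis M0 : (0 < M)%N.

Let node k : V := g (k%:R / M%:R).

(** The clamped coefficients make past increments count fully and future ones not at all; continuity
    needs no gluing, and the past increments telescope. *)
Definition polygon t : V := node 0 +
  \sum_(k < M) (clampR (M%:R * t - k%:R))%:C *: (node k.+1 - node k).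

Lemma polygonE t k : (k < M)%N -> k%:R <= M%:R * t <= k.+1%:R ->
  polygon t = node k + (M%:R * t - k%:R)%:C *: (node k.+1 - node k).
Proof.
move=> kM /andP[kt tk]; rewrite /polygon.
rewrite -(big_mkord xpredT (fun j => (clampR (M%:R * t - j%:R))%:C *: (node j.+1 - node j))).
rewrite (big_cat_nat (n := k)) //= ?(ltnW kM) // (big_ltn kM).
rewrite (eq_big_nat _ _ (F2 := fun j => node j.+1 - node j)); last first.
  move=> j /andP[_ jk]; rewrite clampR_ge1 -?[1%:C]/(1 : R[i]) ?scale1r //.
  have : j.+1%:R <= k%:R :> R by rewrite ler_nat.
  by rewrite -natr1; lra.
rewrite [\sum_(k.+1 <= j < M) _]big1_seq ?addr0; last first.
  move=> j; rewrite mem_index_iota => /andP[_ /andP[kj _]].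
  rewrite clampR_le0 -?[0%:C]/(0 : R[i]) ?scale0r //.
  have : k.+1%:R <= j%:R :> R by rewrite ler_nat.
  by lra.
rewrite clampRE; last by rewrite -natr1 in tk; lra.
by rewrite telescope_sumr // addrA addrCA subrr addr0.
Qed.

Lemma vcontinuous_polygon : vcontinuous polygon.
Proof.
apply: vcontinuousD; first exact: vcontinuous_cst.
apply: vcontinuous_sum => k; apply: vcontinuousZ; last exact: vcontinuous_cst.
split; last by move=> t; exact: cvg_cst.
exact: (@continuous_circ R R R (fun x : R => M%:R * x + - k%:R) clampR
  (@continuous_affine R _ _) continuous_itv_clamp).
Qed.

Let MR : 0 < M%:R :> R. Proof. by rewrite ltr0n. Qed.

Lemma polygon0 : polygon 0 = g 0.
Proof.
rewrite (@polygonE 0 0) // ?mulr0 ?lexx ?ler01 //.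
by rewrite subrr scale0r addr0 /node mul0r.
Qed.

Lemma polygon1 : polygon 1 = g 1.
Proof.
have kM : (M.-1 < M)%N by rewrite prednK.
have kt : M.-1%:R <= M%:R * (1 : R) <= M.-1.+1%:R.
  by rewrite mulr1 prednK // lexx ler_nat leq_pred.
rewrite (polygonE kM kt) mulr1 prednK //.
have -> : M%:R - M.-1%:R = 1 :> R by rewrite -{1}(prednK M0) -natr1 addrAC subrr add0r.
by rewrite -[1%:C]/(1 : R[i]) scale1r addrC subrK /node divff // gt_eqF.
Qed.

Lemma nat_interval m (x : R) : (0 < m)%N -> 0 <= x <= m%:R ->
  exists2 k, (k < m)%N & k%:R <= x <= k.+1%:R.
Proof.
elim: m => // m IH _ /andP[x0 xm]; have [mx|mx] := leP m%:R x.
  by exists m => //; rewrite mx.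
have [||k km kx] := IH; first by rewrite -(ltr_nat R) (le_lt_trans x0).
  by rewrite x0 ltW.
by exists k => //; rewrite ltnS ltnW.
Qed.

Lemma polygon_close r t : 0 <= t <= 1 ->
  (forall t t', 0 <= t <= 1 -> 0 <= t' <= 1 -> `|t - t'| <= M%:R^-1 ->
    Wnorm (g t - g t') < r) ->
  Wnorm (polygon t - g t) <= r.
Proof.
move=> t01 gM; have /andP[t0 t1] := t01.
have [|k kM kt] := @nat_interval M (M%:R * t) M0.
  by rewrite mulr_ge0 //= ler_piMr.
have /andP[kt1 kt2] := kt.
rewrite (polygonE kM kt); set l := M%:R * t - k%:R.
have l0 : 0 <= l by rewrite subr_ge0.
have l1 : l <= 1 by rewrite /l; rewrite -natr1 in kt2; lra.
have -> : node k + l%:C *: (node k.+1 - node k) - g t =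
    (1 - l)%:C *: (node k - g t) + l%:C *: (node k.+1 - g t).
  have -> : (1 - l)%:C = 1 - l%:C :> R[i].
    by apply: complex_eqP => //=; rewrite subr0.
  by apply/matrixP => i j; rewrite !mxE; ring.
have dist j : (j <= M)%N -> `|M%:R * t - j%:R| <= 1 -> Wnorm (node j - g t) <= r.
  move=> jM h; rewrite WnormBC; apply/ltW/gM => //.
    by rewrite divr_ge0 //= ler_pdivrMr // mul1r ler_nat.
  rewrite (_ : t - _ = (M%:R * t - j%:R) / M%:R); last by field; rewrite gt_eqF.
  by rewrite normrM normfV (ger0_norm (ltW MR)) ler_piMl // invr_ge0 ltW.
apply: le_trans (WnormD _ _ _) _; rewrite !Wnorm_real !ger0_norm ?subr_ge0 //.
have h1 : Wnorm (node k - g t) <= r by apply: dist; rewrite ?ger0_norm // ltnW.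
have h2 : Wnorm (node k.+1 - g t) <= r.
  by apply: dist => //; rewrite ler_norml -natr1; rewrite /l in l0 l1; apply/andP; split; lra.
apply: le_trans (_ : (1 - l) * r + l * r <= _); last by rewrite -mulrDl subrK mul1r.
by rewrite lerD // ler_wpM2l // subr_ge0.
Qed.

Lemma path_nodes (m k : nat) :
  path <%O (k%:R / M%:R : R) [seq j.+1%:R / M%:R | j <- iota k m] /\
  last (k%:R / M%:R : R) [seq j.+1%:R / M%:R | j <- iota k m] = (k + m)%:R / M%:R.
Proof.
elim: m k => [|m IH] k /=; first by rewrite addn0.
have [pk lk] := IH k.+1; rewrite pk lk addSnnS; split=> //.
by rewrite andbT ltr_pM2r ?invr_gt0 // ltr_nat.
Qed.

Lemma C1_between_affine (a b c d e : R) (f : R -> R) :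
  {in `[a, b], forall t, f t = c + (e * t - d)} -> C1_between a b f.
Proof.
move=> fE; exists (fun t => c + (e * t - d)).
have dg (t : R) : is_derive t (1 : R) (fun t => c + (e * t - d)) e.
  apply: is_derive_eq; rewrite /GRing.scale /=; ring.
split=> [t||t tab]; last exact: fE.
  by have [] := dg t.
rewrite (_ : derive1 _ = cst e); first exact: cst_continuous.
by apply/funext => t; rewrite derive1E; have [_ ->] := dg t.
Qed.

Lemma piecewise_C1_polygon : piecewise_C1_path (fun t => polygon (clampR t)).
Proof.
have nodes : itv_partition 0 1 [seq j.+1%:R / M%:R : R | j <- iota 0 M].
  have [] := path_nodes M 0; rewrite add0n mul0r divff ?gt_eqF // => p l.
  by split=> //; rewrite l.
have C1 (Q : R[i] -> R) : (forall (a : R[i]) b (k : R), Q (a + k%:C * b) = Q a + k * Q b) ->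
    forall j, piecewise_C1 (fun t => Q (polygon (clampR t) j 0)).
  move=> QD j; exists [seq j.+1%:R / M%:R : R | j <- iota 0 M] => // k.
  rewrite size_map size_iota => kM.
  have -> : nth 0 (0 :: [seq j.+1%:R / M%:R : R | j <- iota 0 M]) k = k%:R / M%:R.
    case: k kM => [|k] kM /=; first by rewrite mul0r.
    by rewrite (nth_map 0%N) ?size_iota ?(ltnW kM) // nth_iota ?(ltnW kM).
  rewrite (nth_map 0%N) ?size_iota // nth_iota // add0n.
  set b := Q ((node k.+1 - node k) j 0).
  apply: (@C1_between_affine _ _ (Q (node k j 0)) (k%:R * b) (M%:R * b)) => t.
  rewrite in_itv /= => /andP[]; rewrite ler_pdivrMr // ler_pdivlMr // !(mulrC t) => kt tk.
  have t0 : 0 <= t by rewrite -(pmulr_rge0 _ MR) (le_trans _ kt).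
  have t1 : t <= 1.
    by rewrite -(ler_pM2l MR) mulr1 (le_trans tk) // ler_nat.
  rewrite clampRE ?t0 // (polygonE kM) ?kt // !mxE QD -/b.
  by rewrite /b !mxE; ring.
by move=> j; split; apply: C1 => a b k; rewrite ?cReD ?cImD ?cReM ?cImM /= mul0r ?subr0 ?addr0.
Qed.

End Polygon.

(** The last clause is the straight-line homotopy inside X, which shows that the polygon lifts the
    same braid. It holds because the displacement changes alpha_H by at most A r, where |alpha_H(g)|
    >= 4 A r. *)
Lemma polygon_ex (g : R -> V) : vcontinuous g -> (forall t, 0 <= t <= 1 -> X (g t)) ->
  exists p : R -> V, [/\ vcontinuous p, p 0 = g 0, p 1 = g 1,
    piecewise_C1_path (fun t => p (clampR t)) &
    forall t s, 0 <= t <= 1 -> 0 <= s <= 1 -> X (g t + s%:C *: (p t - g t))].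
Proof.
move=> cg gX.
have cgc : vcontinuous (fun q : R * R => g (clampR q.1)).
  apply: (vcontinuous_comp (g := g) cg) => q.
  apply: (@continuous_comp _ _ _ fst clampR); first exact: continuous_fst.
  exact: continuous_itv_clamp.
have [r r0 rP] : exists2 r, 0 < r & forall q, unit_square q -> well_inside r (g (clampR q.1)).
  apply: uniform_inside; first exact: vcontinuousW.
  by move=> q; apply: gX; exact: clampR01.
have [M M0 MP] : exists2 M : nat, (0 < M)%N & forall p q, unit_square p ->
    `|p.1 - q.1| <= M%:R^-1 -> `|p.2 - q.2| <= M%:R^-1 ->
    Wnorm (g (clampR p.1) - g (clampR q.1)) < r.
  apply: (@lebesgue_number (fun e p q => Wnorm (g (clampR p.1) - g (clampR q.1)) < e)) => //.
  - by move=> e p q; rewrite WnormBC.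
  - by move=> e p q x; exact: Wnorm_lt_split.
  - exact: (vcontinuous_near cgc).
have z01 : 0 <= (0 : R) <= 1 by rewrite lexx ler01.
exists (polygon g M); split.
- exact: vcontinuous_polygon.
- exact: polygon0.
- exact: polygon1.
- exact: piecewise_C1_polygon.
move=> t s t01 /andP[s0 s1]; apply/complementE => H; apply/eqP => e.
have tr : well_inside r (g t).
  by rewrite -(clampRE t01); apply: (rP (t, 0)); split; rewrite /= in_itv.
have d : Wnorm (polygon g M t - g t) <= r.
  apply: polygon_close => // a b a01 b01 ab.
  have /(_ _ _) := MP (a, 0) (b, 0); rewrite /= !clampRE // subrr normr0 invr_ge0 ler0n.
  by apply=> //; split; rewrite /= in_itv.
have [_ /(_ H 1%g)] := tr; rewrite W_act1.
have -> : alpha H (g t) = - (s%:C * alpha H (polygon g M t - g t)).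
  by apply/eqP; rewrite -addr_eq0; move/eqP: e; rewrite linearD linearZ.
rewrite cnorm1N cnorm1_real ger0_norm // leNgt => /negP; apply.
have Ar : 0 < A * r by rewrite mulr_gt0.
apply: le_lt_trans (_ : A * r < _).
  apply: le_trans (_ : 1 * cnorm1 (alpha H (polygon g M t - g t)) <= _).
    by rewrite ler_wpM2r // cnorm1_ge0.
  by rewrite mul1r; apply: le_trans (AP _ _) _; rewrite ler_wpM2l // ltW.
by rewrite -mulrA ltr_pMl // ltr1n.
Qed.
End Lifting.
Local Transparent W_act Wnorm.
(** * Integrals of logarithmic forms *)

Lemma integrable_disjoint_setU (R : realType) d (T : measurableType d)
    (nu : {measure set T -> \bar R}) (A B : set T) (f : T -> \bar R) :
  measurable A -> measurable B -> [disjoint A & B] ->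
  nu.-integrable A f -> nu.-integrable B f -> nu.-integrable (A `|` B) f.
Proof.
move=> mA mB AB /integrableP[mfA fA] /integrableP[mfB fB]; apply/integrableP.
have mf := iffRL (measurable_funU _ mA mB) (conj mfA mfB).
split=> //; rewrite ge0_integral_setU //; first by rewrite lte_add_pinfty.
exact: measurableT_comp.
Qed.

Section PathIntegral.
Variable R : realType.
Local Notation mu := (@lebesgue_measure R).
Implicit Types (a b c t : R) (k u : R -> R).

Lemma integrable_point a (f : R -> \bar R) : mu.-integrable `[a, a] f.
Proof.
rewrite set_itv1; apply: null_set_integrable => //; first exact: measurable_fun_set1.
exact: lebesgue_measure_set1.
Qed.

Lemma disjoint_itv (a b : itv_bound R) c d :
  [disjoint [set` Interval a (BSide d c)] & [set` Interval (BSide d c) b]].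
Proof.
apply/disj_setPS => x [] /=; rewrite !itv_boundlr => /andP[_ h1] /andP[h2 _].
by have := le_trans h1 h2; case: d h1 h2 => /=; rewrite /Order.le /= ?ltxx.
Qed.

Lemma integrable_cat k a b c : a <= b -> b <= c ->
  mu.-integrable `[a, b] (EFin \o k) -> mu.-integrable `[b, c] (EFin \o k) ->
  mu.-integrable `[a, c] (EFin \o k) /\
  \int[mu]_(t in `[a, c]) k t = \int[mu]_(t in `[a, b]) k t + \int[mu]_(t in `[b, c]) k t.
Proof.
move=> ab bc iab ibc.
have ibc' : mu.-integrable `]b, c] (EFin \o k).
  by apply: integrableS ibc => //; apply: subset_itvr; rewrite bnd_simp.
have iac : mu.-integrable `[a, c] (EFin \o k).
  rewrite (@itv_bndbnd_setU _ _ _ (BRight b)) ?bnd_simp //.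
  by apply: integrable_disjoint_setU => //; exact: disjoint_itv.
split=> //; apply/eqP; rewrite addrC -subr_eq; apply/eqP.
by rewrite Rintegral_itvB ?bnd_simp // Rintegral_itv_obnd_cbnd.
Qed.

(** Agreement on the open interval is all that is available: at breakpoints [derive1] may take
    arbitrary values. *)
Lemma Rintegral_eq_oo k u a b : a < b -> {in `]a, b[, k =1 u} ->
  mu.-integrable `[a, b] (EFin \o u) ->
  mu.-integrable `[a, b] (EFin \o k) /\
  \int[mu]_(t in `[a, b]) k t = \int[mu]_(t in `[a, b]) u t.
Proof.
move=> ab ku iu.
have iuoo : mu.-integrable `]a, b[ (EFin \o u).
  by apply: integrableS iu => //; exact: subset_itv_oo_cc.
have kuE : {in `]a, b[%classic, EFin \o k =1 EFin \o u}.
  by move=> t; rewrite inE => /ku /= ->.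
have ikoo : mu.-integrable `]a, b[ (EFin \o k).
  by apply: eq_integrable iuoo => // t /kuE.
split.
  rewrite (@itv_bndbnd_setU _ _ _ (BRight a)) ?bnd_simp ?ltW //.
  apply: integrable_disjoint_setU => //; [exact: disjoint_itv|exact: integrable_point|].
  rewrite (@itv_bndbnd_setU _ _ _ (BLeft b)) ?bnd_simp ?ltW //.
  by apply: integrable_disjoint_setU => //; [exact: disjoint_itv|exact: integrable_point].
rewrite /Rintegral (@integral_itv_bndoo R a b _ true false (measurable_int mu ikoo)).
rewrite (@integral_itv_bndoo R a b _ true false (measurable_int mu iuoo)).
by congr fine; apply: eq_integral => t /kuE.
Qed.

Definition clamp_itv a b t := Num.max a (Num.min t b).

Lemma continuous_clamp_itv a b : continuous (clamp_itv a b).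
Proof.
move=> t; apply: (@continuous_max R R (cst a) (fun t => Num.min t b)); first exact: cvg_cst.
by apply: (@continuous_min R R id (cst b)); [exact: cvg_id|exact: cvg_cst].
Qed.

Lemma clamp_itv_in a b t : a <= b -> a <= clamp_itv a b t <= b.
Proof. by move=> ab; rewrite /clamp_itv le_max lexx ge_max ab ge_min lexx orbT. Qed.

Lemma clamp_itvE a b t : a <= t <= b -> clamp_itv a b t = t.
Proof. by move=> /andP[ta tb]; rewrite /clamp_itv min_l // max_r. Qed.

Lemma primitive_ex k a b : a < b -> continuous k -> exists K : R -> R,
  [/\ forall t, a <= t <= b -> is_derive t 1 K (k t),
      mu.-integrable `[a, b] (EFin \o k) &
      \int[mu]_(t in `[a, b]) k t = K b - K a].
Proof.
(* Starting the primitive at a - 1 gives a two-sided derivative at the endpoints of [a, b] too. *)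
move=> ab ck; pose K t := \int[mu]_(s in `[a - 1, t]) k s; exists K.
have ik x y : mu.-integrable `[x, y] (EFin \o k).
  apply: continuous_compact_integrable; first exact: segment_compact.
  exact: continuous_subspaceT.
have a1 : a - 1 <= a by lra.
split=> // [t /andP[ta tb]|].
  have [||dK KE] := @continuous_FTC1_closed R k (a - 1) t (b + 1) _ (ik _ _) _ (ck t); [lra|lra|].
  by apply: DeriveDef; [exact: dK|rewrite -derive1E; exact: KE].
by have [_] := integrable_cat a1 (ltW ab) (ik _ _) (ik _ _); rewrite /K; lra.
Qed.

(* k integrates the logarithm of f over [a, b]. *)
Definition log_integrand (f k : R -> R[i]) a b := exists L : R -> R[i],
  [/\ ccontinuous L, L a = 0 & forall t, a <= t <= b -> f t = f a * cexp (L t)] /\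
  [/\ mu.-integrable `[a, b] (EFin \o (fun t => Re (k t))),
      mu.-integrable `[a, b] (EFin \o (fun t => Im (k t))),
      \int[mu]_(t in `[a, b]) Re (k t) = Re (L b) &
      \int[mu]_(t in `[a, b]) Im (k t) = Im (L b)].

Lemma log_integrand_cat (f k : R -> R[i]) a b c : a < b -> b < c ->
  log_integrand f k a b -> log_integrand f k b c -> log_integrand f k a c.
Proof.
move=> ab bc [L [[[L1 L2] La LP] [i1 i2 I1 I2]]] [K [[[K1 K2] Kb KP] [j1 j2 J1 J2]]].
exists (fun t => if t <= b then L t else L b + K t); split; split.
- have glue (Q : R[i] -> R) : (forall x y, Q (x + y) = Q x + Q y) ->
      continuous (fun t => Q (L t)) -> continuous (fun t => Q (K t)) ->
      continuous (fun t => Q (if t <= b then L t else L b + K t)).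
    move=> QD cL cK.
    rewrite (_ : (fun t => _) = fun t => if t <= b then Q (L t) else Q (L b) + Q (K t)).
      apply: (@continuous_glue R R R id) => //; first by move=> t; exact: cvg_id.
        by move=> t; apply: cvgD; [exact: cvg_cst|exact: cK].
      by move=> t ->; rewrite Kb -QD addr0.
    by apply/funext => t; case: ifP => // _; rewrite QD.
  by split; apply: glue => //; [exact: cReD|exact: cImD].
- by rewrite (ltW ab).
- move=> t /andP[ta tc]; case: leP => tb; first by rewrite LP ?ta.
  by rewrite cexpD mulrA -LP ?(ltW ab) ?lexx // KP // (ltW tb).
- by have [] := integrable_cat (ltW ab) (ltW bc) i1 j1.
- by have [] := integrable_cat (ltW ab) (ltW bc) i2 j2.
- have [_ ->] := integrable_cat (ltW ab) (ltW bc) i1 j1.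
  by rewrite I1 J1 (lt_geF bc) cReD.
have [_ ->] := integrable_cat (ltW ab) (ltW bc) i2 j2.
by rewrite I2 J2 (lt_geF bc) cImD.
Qed.

Lemma zero_derivative_cst (f : R -> R) a b : a < b ->
  (forall t, a <= t <= b -> is_derive t 1 f 0) ->
  forall t, a <= t <= b -> f t = f a.
Proof.
move=> ab df t /andP[]; rewrite le_eqVlt => /predU1P[-> //|ta] tb.
have [||x _ e] := @MVT R f (fun=> 0) a t ta.
- move=> x; rewrite in_itv /= => /andP[ax xt]; apply: df.
  by rewrite (ltW ax) (le_trans (ltW xt)).
- apply: derivable_within_continuous => x; rewrite in_itv /= => /andP[ax xt].
  by have [] := df x _; [rewrite ax (le_trans xt)|].
by apply/eqP; rewrite -subr_eq0 e mul0r.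
Qed.

(** With Z a primitive of f'/f, the function f exp(-Z) has zero derivative, hence f = f(a) exp(Z -
    Z(a)). The computation is carried out on real and imaginary parts. *)
Lemma log_integrand_C1 (f k : R -> R[i]) (P Q : R -> R) a b : a < b ->
  (forall t, derivable P t 1) -> continuous (derive1 P) ->
  (forall t, derivable Q t 1) -> continuous (derive1 Q) ->
  (forall t, a <= t <= b -> f t = P t +i* Q t) ->
  (forall t, a <= t <= b -> f t != 0) ->
  (forall t, a < t < b -> k t = (derive1 P t +i* derive1 Q t) / f t) ->
  log_integrand f k a b.
Proof.
move=> ab dP cP' dQ cQ' fE f0 kE.
(* f may vanish outside [a, b]; composing with the clamp extends f'/f to a continuous function on
   the whole line. *)
pose s t := clamp_itv a b t.
have s_in t : a <= s t <= b by apply: clamp_itv_in; exact: ltW.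
have sE t : a <= t <= b -> s t = t by exact: clamp_itvE.
pose g t := (derive1 P (s t) +i* derive1 Q (s t)) / (P (s t) +i* Q (s t)).
have cs : continuous s by exact: continuous_clamp_itv.
have cs_comp (h : R -> R) : continuous h -> continuous (fun t => h (s t)).
  by move=> ch t; apply: continuous_comp; [exact: cs|exact: ch].
have dcont (h : R -> R) : (forall t, derivable h t 1) -> continuous h.
  by move=> dh t; apply: differentiable_continuous; apply/derivable1_diffP.
have [cg1 cg2] : ccontinuous g.
  apply: ccontinuousM; first by split; exact: cs_comp.
  apply: ccontinuousV; last by move=> t; rewrite -fE ?f0.
  by split; apply: cs_comp; exact: dcont.
have [K [dK iK IK]] := primitive_ex ab cg1.
have [M [dM iM IM]] := primitive_ex ab cg2.
have kg : {in `]a, b[, k =1 g}.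
  move=> t; rewrite in_itv /= => tab; rewrite kE // /g.
  have tab' : a <= t <= b by case/andP: tab => h1 h2; rewrite !ltW.
  by rewrite !sE // fE.
have [j1 J1] := Rintegral_eq_oo ab (fun t tab => congr1 (@complex.Re R) (kg t tab)) iK.
have [j2 J2] := Rintegral_eq_oo ab (fun t tab => congr1 (@complex.Im R) (kg t tab)) iM.
have gP t : a <= t <= b -> derive1 P t = Re (g t) * P t - Im (g t) * Q t /\
    derive1 Q t = Re (g t) * Q t + Im (g t) * P t.
  move=> tab; have e : derive1 P t +i* derive1 Q t = g t * (P t +i* Q t).
    by rewrite /g !sE // divfK // -fE // f0.
  by split; [have := congr1 (@complex.Re R) e|have := congr1 (@complex.Im R) e];
     rewrite ?cReM ?cImM.
have [r [j [rE jE]]] : exists r j : R -> R,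
    (forall t, Re (g t) = r t) /\ (forall t, Im (g t) = j t).
  by exists (fun t => Re (g t)), (fun t => Im (g t)).
(* U + iV is f exp(-Z) with Z = K + iM. *)
pose U t := expR (- K t) * (P t * cos (M t) + Q t * sin (M t)).
pose V t := expR (- K t) * (Q t * cos (M t) - P t * sin (M t)).
have dP' t : is_derive t (1 : R) P (derive1 P t) by apply: DeriveDef; rewrite ?derive1E.
have dQ' t : is_derive t (1 : R) Q (derive1 Q t) by apply: DeriveDef; rewrite ?derive1E.
have dE t : a <= t <= b -> is_derive t (1 : R) (fun t => expR (- K t)) (expR (- K t) * - r t).
  move=> /dK; rewrite rE => dKt; apply: (@is_derive1_comp _ expR (fun t => - K t)).
have dC t : a <= t <= b -> is_derive t (1 : R) (fun t => cos (M t)) (- sin (M t) * j t).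
  by move=> /dM; rewrite jE => dMt; apply: (@is_derive1_comp _ cos M).
have dS t : a <= t <= b -> is_derive t (1 : R) (fun t => sin (M t)) (cos (M t) * j t).
  by move=> /dM; rewrite jE => dMt; apply: (@is_derive1_comp _ sin M).
have dU t : a <= t <= b -> is_derive t (1 : R) U 0.
  move=> tab; have := dE t tab; have := dC t tab; have := dS t tab => iS iC iE.
  apply: is_derive_eq; rewrite /GRing.scale /=.
  by have [-> ->] := gP t tab; rewrite rE jE; ring.
have dV t : a <= t <= b -> is_derive t (1 : R) V 0.
  move=> tab; have := dE t tab; have := dC t tab; have := dS t tab => iS iC iE.
  apply: is_derive_eq; rewrite /GRing.scale /=.
  by have [-> ->] := gP t tab; rewrite rE jE; ring.
pose Z t := K t +i* M t.
have fU t : a <= t <= b -> f t * cexp (- Z t) = U t +i* V t.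
  move=> tab; rewrite fE //; apply: complex_eqP; rewrite ?cReM ?cImM /= cosN sinN /U /V; ring.
have aab : a <= a <= b by rewrite lexx ltW.
have bab : a <= b <= b by rewrite lexx ltW.
have fZ t : a <= t <= b -> f t = f a * cexp (Z t - Z a).
  move=> tab; have e : f t * cexp (- Z t) = f a * cexp (- Z a).
    by rewrite !fU // (zero_derivative_cst ab dU tab) (zero_derivative_cst ab dV tab).
  by rewrite cexpD mulrCA -e mulrCA -cexpD subrr cexp0 mulr1.
have cK : continuous (fun t => K (s t)).
  move=> t; apply: continuous_comp; first exact: cs.
  by apply: differentiable_continuous; apply/derivable1_diffP; have [] := dK (s t) (s_in t).
have cM : continuous (fun t => M (s t)).
  move=> t; apply: continuous_comp; first exact: cs.
  by apply: differentiable_continuous; apply/derivable1_diffP; have [] := dM (s t) (s_in t).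
exists (fun t => Z (s t) - Z a); split; split=> //.
- by apply: ccontinuousD; [split|exact: ccontinuous_cst].
- by rewrite sE // subrr.
- by move=> t tab; rewrite sE // -fZ.
- by rewrite J1 IK sE //= cReD cReN.
- by rewrite J2 IM sE //= cImD cImN.
Qed.

(** It suffices to treat intervals with no point of S in their interior. The list need not be
    sorted, so the breakpoints of all coordinates can simply be concatenated. *)
Lemma interval_split (Q : R -> R -> Prop) :
  (forall a b c, a < b -> b < c -> Q a b -> Q b c -> Q a c) ->
  forall (S : seq R) a b, a < b ->
  (forall c d, a <= c -> c < d -> d <= b -> (forall x, x \in S -> ~ c < x < d) -> Q c d) ->
  Q a b.
Proof.
move=> Qcat; elim=> [|x S IH] a b ab QS; first exact: QS.
have [/andP[ax xb]|xab] := boolP (a < x < b); last first.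
  apply: IH => // c d ac cd db Scd; apply: QS => // y; rewrite inE => /orP[/eqP ->|]; last exact: Scd.
  by move=> /andP[cx xd]; case/negP: xab; rewrite (le_lt_trans ac) // (lt_le_trans xd).
apply: (Qcat _ _ _ ax xb).
  apply: IH ax _ => c d ac cd dx Scd; apply: QS => //; first exact: le_trans dx (ltW xb).
  move=> y; rewrite inE => /orP[/eqP -> /andP[_ xd]|]; last exact: Scd.
  by have := lt_le_trans xd dx; rewrite ltxx.
apply: IH xb _ => c d xc cd db Scd; apply: QS => //; first exact: le_trans (ltW ax) xc.
move=> y; rewrite inE => /orP[/eqP -> /andP[cx _]|]; last exact: Scd.
by have := lt_le_trans cx xc; rewrite ltxx.
Qed.

Lemma itv_partition_piece (s : seq R) a b c d : itv_partition a b s ->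
  a <= c -> c < d -> d <= b -> (forall x, x \in s -> ~ c < x < d) ->
  exists k : nat, [/\ (k < size s)%N, nth 0 (a :: s) k <= c & d <= nth 0 s k].
Proof.
elim: s a => [|x s IH] a pa ac cd db sP.
  by have := le_lt_trans ac (lt_le_trans cd db); rewrite (itv_partition_nil pa) ltxx.
have [dx|xd] := leP d x; first by exists 0%N.
have xc : x <= c.
  by rewrite leNgt; apply/negP => cx; apply: (sP x); rewrite ?inE ?eqxx // cx.
have [|k [ks kc kd]] := IH x (itv_partition_cons pa) xc cd db.
  by move=> y ys; apply: sP; rewrite inE ys orbT.
by exists k.+1.
Qed.

Lemma C1_betweenS (f : R -> R) a b c d :
  a <= c -> d <= b -> C1_between a b f -> C1_between c d f.
Proof.
move=> ac db [h [h1 h2 h3]]; exists h; split=> // t; rewrite in_itv /= => /andP[ct td].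
by apply: h3; rewrite in_itv /= (le_trans ac ct) (le_trans td db).
Qed.

Lemma piecewise_C1_breakpoints (f : R -> R) : piecewise_C1 f -> exists S : seq R,
  forall c d, 0 <= c -> c < d -> d <= 1 -> (forall x, x \in S -> ~ c < x < d) ->
  C1_between c d f.
Proof.
move=> [s s01 sC]; exists s => c d c0 cd d1 sP.
have [k [ks kc kd]] := itv_partition_piece s01 c0 cd d1 sP.
exact: C1_betweenS kc kd (sC k ks).
Qed.

Lemma is_derive_sumR (I : Type) (r : seq I) (f : I -> R -> R) (df : I -> R) t :
  (forall i, is_derive t (1 : R) (f i) (df i)) ->
  is_derive t (1 : R) (fun x => \sum_(i <- r) f i x) (\sum_(i <- r) df i).
Proof.
move=> fP; elim: r => [|i r IH].
  rewrite big_nil (_ : (fun x => _) = cst 0); first exact: is_derive_cst.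
  by apply/funext => x; rewrite big_nil.
rewrite big_cons (_ : (fun x => _) = f i + fun x => \sum_(j <- r) f j x).
  exact: is_deriveD.
by apply/funext => x; rewrite big_cons.
Qed.

Section DlogIntegral.
Variable n : nat.
Local Notation V := 'cV[R[i]]_n.

Lemma C1_linform (al : 'Hom(V, R[i])) (p q : 'I_n -> R -> R) :
  (forall j t, derivable (p j) t 1) -> (forall j, continuous (derive1 (p j))) ->
  (forall j t, derivable (q j) t 1) -> (forall j, continuous (derive1 (q j))) ->
  let x t := al (\col_j (p j t +i* q j t)) in
  let dx t := al (\col_j (derive1 (p j) t +i* derive1 (q j) t)) in
  [/\ forall t, is_derive t (1 : R) (fun t => Re (x t)) (Re (dx t)),
      forall t, is_derive t (1 : R) (fun t => Im (x t)) (Im (dx t)) &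
      ccontinuous dx].
Proof.
move=> dp cp dq cq x dx; pose c j := al (delta_mx j 0).
have alE (P Q : 'I_n -> R) : al (\col_j (P j +i* Q j)) = \sum_j (P j +i* Q j) * c j.
  rewrite {1}[\col_j _]matrix_sum_delta linear_sum; apply: eq_bigr => j _.
  by rewrite big_ord1 linearZ mxE.
have dP j t : is_derive t (1 : R) (p j) (derive1 (p j) t).
  by apply: DeriveDef; rewrite ?derive1E.
have dQ j t : is_derive t (1 : R) (q j) (derive1 (q j) t).
  by apply: DeriveDef; rewrite ?derive1E.
split=> [t|t|].
- rewrite (_ : (fun t => _) = fun t => \sum_j (p j t * Re (c j) - q j t * Im (c j))).
    rewrite /dx alE Re_sum; apply: is_derive_sumR => j.
    apply: is_derive_eq; rewrite cReM /GRing.scale /=; ring.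
  by apply/funext => u; rewrite /x alE Re_sum; apply: eq_bigr => j _; rewrite cReM.
- rewrite (_ : (fun t => _) = fun t => \sum_j (p j t * Im (c j) + q j t * Re (c j))).
    rewrite /dx alE Im_sum; apply: is_derive_sumR => j.
    apply: is_derive_eq; rewrite cImM /GRing.scale /=; ring.
  by apply/funext => u; rewrite /x alE Im_sum; apply: eq_bigr => j _; rewrite cImM.
- apply: vcontinuous_linform => j; under [X in ccontinuous X]eq_fun do rewrite mxE.
  by split; [exact: cp|exact: cq].
Qed.

(** The passage from integrals to continuous logarithms, through which all later arguments about the
    integrals go. *)
Lemma integral_dlog_log (al : 'Hom(V, R[i])) (g : R -> V) :
  piecewise_C1_path g -> (forall t, 0 <= t <= 1 -> al (g t) != 0) ->
  exists L : R -> R[i], [/\ ccontinuous L, L 0 = 0,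
    forall t, 0 <= t <= 1 -> al (g t) = al (g 0) * cexp (L t) &
    integral_dlog al g = L 1].
Proof.
move=> gC g0.
have /choice[S SP] : forall j : 'I_n, exists S : seq R, forall c d, 0 <= c -> c < d -> d <= 1 ->
    (forall x, x \in S -> ~ c < x < d) ->
    C1_between c d (fun t => Re (g t j 0)) /\ C1_between c d (fun t => Im (g t j 0)).
  move=> j; have [/piecewise_C1_breakpoints[S1 S1P] /piecewise_C1_breakpoints[S2 S2P]] := gC j.
  exists (S1 ++ S2) => c d c0 cd d1 SP.
  by split; [apply: S1P|apply: S2P] => // x xS; apply: SP; rewrite mem_cat xS ?orbT.
pose f t := al (g t); pose k t := al (velocity g t) / al (g t).
suff [L [[cL L0 LP] [_ _ I1 I2]]] : log_integrand f k 0 1.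
  by exists L; split=> //; rewrite /integral_dlog /integral01 I1 I2; case: (L 1).
apply: (@interval_split (log_integrand f k) _ (flatten [seq S j | j <- enum 'I_n])) => //.
  by move=> a b c; exact: log_integrand_cat.
move=> c d c0 cd d1 Scd.
have /choice[p pP] : forall j, exists p : R -> R, [/\ forall t, derivable p t 1,
    continuous (derive1 p) & {in `[c, d], (fun t => Re (g t j 0)) =1 p}].
  move=> j; have [|h _] := SP j c d c0 cd d1; last exact: h.
  by move=> x xS; apply: Scd; apply/flatten_mapP; exists j; rewrite // mem_enum.
have /choice[q qP] : forall j, exists p : R -> R, [/\ forall t, derivable p t 1,
    continuous (derive1 p) & {in `[c, d], (fun t => Im (g t j 0)) =1 p}].
  move=> j; have [|_ h] := SP j c d c0 cd d1; last exact: h.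
  by move=> x xS; apply: Scd; apply/flatten_mapP; exists j; rewrite // mem_enum.
have [||||dX dY cdx] := @C1_linform al p q; try by move=> j; have [] := pP j; have [] := qP j.
have gE t : c <= t <= d -> g t = \col_j (p j t +i* q j t).
  move=> tcd; apply/matrixP => j i; rewrite ord1 mxE.
  have [_ _ /(_ t)] := pP j; rewrite in_itv /= => /(_ tcd) <-.
  by have [_ _ /(_ t)] := qP j; rewrite in_itv /= => /(_ tcd) <-; case: (g t j 0).
apply: (log_integrand_C1 cd (P := fun t => Re (al (\col_j (p j t +i* q j t))))
  (Q := fun t => Im (al (\col_j (p j t +i* q j t))))).
- by move=> t; have [] := dX t.
- rewrite (_ : derive1 _ = fun t => Re (al (\col_j (derive1 (p j) t +i* derive1 (q j) t)))).
    by case: cdx.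
  by apply/funext => t; rewrite derive1E; have [_ ->] := dX t.
- by move=> t; have [] := dY t.
- rewrite (_ : derive1 _ = fun t => Im (al (\col_j (derive1 (p j) t +i* derive1 (q j) t)))).
    by case: cdx.
  by apply/funext => t; rewrite derive1E; have [_ ->] := dY t.
- by move=> t tcd; rewrite /f gE //; case: (al _).
- by move=> t /andP[ct td]; apply: g0; rewrite (le_trans c0 ct) (le_trans td d1).
move=> t /andP[ct td]; rewrite /k !derive1E; have [_ ->] := dX t; have [_ ->] := dY t.
congr (_ / _); rewrite (_ : velocity g t = \col_j (derive1 (p j) t +i* derive1 (q j) t)).
  by case: (al _).
(* [derive1] is local, so at an interior point the velocity may be computed from the C^1 extensions
   p and q. *)
have nt : \forall u \near t, c <= u <= d.
  near=> u; apply/andP; split; apply/ltW; near: u.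
    exact: (cvgr_gt t (@cvg_id _ (nbhs t))).
  exact: (cvgr_lt t (@cvg_id _ (nbhs t))).
apply/matrixP => j i; rewrite !mxE !derive1E; congr (_ +i* _); apply: near_eq_derive => //;
  apply: filterS nt => u ucd; have [_ _ pu] := pP j; have [_ _ qu] := qP j.
  by apply: pu; rewrite in_itv.
by apply: qu; rewrite in_itv.
Unshelve. all: by end_near. Qed.

End DlogIntegral.

End PathIntegral.
(** * Lifts of braids *)

Section BraidLifts.
Variables (R : realType) (n : nat) (W : finGroupType).
Variable rW : mx_representation R [set: W]%G n.
Local Notation V := 'cV[R[i]]_n.
Local Notation X := (arr_complement rW).
Local Notation act := (W_act rW).
Local Notation Wnorm := (Wnorm rW).
Local Notation I := (unit_itv R).
Variable alpha : hyperplane rW -> 'Hom(V, R[i]).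
Hypothesis alphaP : forall H, lker (alpha H) = H.
Hypothesis Xfree : forall (v : V) (w : W), X v -> act w v = v -> w = 1%g.
Variable A : R.
Hypothesis A0 : 0 < A.
Hypothesis AP : forall H (v : V), cnorm1 (alpha H v) <= A * Wnorm v.
Variable z : real_complement rW.
Implicit Types (u v : V) (w : W) (H : hyperplane rW).

Local Notation zV := (cplx (set_val z) : V).
Local Notation zX := (cplx_point z).

Lemma base_complement : X zV.
Proof. exact: (set_mem (valP zX)). Qed.

Lemma point_complement (x : X) : X (set_val x).
Proof. exact: (set_mem (valP x)). Qed.

Lemma to_orbitP (x y : X) :
  to_orbit x = to_orbit y <-> exists w, set_val y = act w (set_val x).
Proof.
split=> [/eqmodP /existsP[w /eqP ->]|[w yE]]; first by exists w.
by apply/eqmodP/existsP; exists w; apply/eqP.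
Qed.

Lemma repr_to_orbit (x : X) : exists w, set_val (repr (to_orbit x)) = act w (set_val x).
Proof. by apply/to_orbitP; rewrite /to_orbit reprK. Qed.

Lemma continuous_set_valX : continuous (set_val : X -> V).
Proof. exact: initial_continuous. Qed.

Definition to_complement (T : Type) (v : T -> V) (vX : forall x, X (v x)) (x : T) : X :=
  exist _ (v x) (mem_set (vX x)).

Lemma continuous_to_complement (T : topologicalType) (v : T -> V)
    (vX : forall x, X (v x)) : vcontinuous v -> continuous (to_complement vX).
Proof. by move=> /vcontinuousP cv; apply: continuous_comp_initial. Qed.

Lemma continuous_to_orbit : continuous (@to_orbit R n W rW).
Proof. exact: pi_continuous. Qed.

Lemma open_orbit (O : set V) : open O -> (forall w v, O v -> O (act w v)) ->
  open [set p : orbit_space rW | O (set_val (repr p))].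
Proof.
move=> oO Oact; suff oU : open ((@to_orbit R n W rW) @^-1` [set p | O (set_val (repr p))]).
  exact: oU.
have -> : (@to_orbit R n W rW) @^-1` [set p | O (set_val (repr p))] = set_val @^-1` O.
  apply/seteqP; split=> y /=; have [w ->] := repr_to_orbit y; last exact: Oact.
  by move=> /(Oact w^-1%g); rewrite W_actK.
by apply: open_comp => // ? _; exact: continuous_set_valX.
Qed.

Lemma open_Wnorm_ball v e : open [set u : V | exists w, Wnorm (v - act w u) < e].
Proof.
have -> : [set u : V | exists w, Wnorm (v - act w u) < e] =
    \bigcup_(w in [set: W]) [set u : V | Wnorm (v - act w u) < e].
  by apply/seteqP; split=> u /= [w]; exists w.
apply: bigcup_open => w _; apply: (@open_comp _ _ (fun u => Wnorm (v - act w u)) [set r | r < e]).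
  move=> u _; apply: continuous_Wnorm; apply: vcontinuousB; first exact: vcontinuous_cst.
  by apply: vcontinuous_act; apply/vcontinuousP => ?; exact: cvg_id.
exact: open_lt.
Qed.

(** [repr] picks representatives without continuity, but a W-stable open set of V defines an open
    set of the quotient whatever the representatives are. *)
Lemma wcontinuous_orbit (T : topologicalType) (l : T -> orbit_space rW) :
  continuous l -> wcontinuous rW (fun x => set_val (repr (l x)) : V).
Proof.
move=> /continuousP cl x e e0.
pose v0 : V := set_val (repr (l x)).
have Uact w v : (exists w, Wnorm (v0 - act w v) < e) ->
    exists w', Wnorm (v0 - act w' (act w v)) < e.
  by move=> [w' ww']; exists (w' * w^-1)%g; rewrite W_actM W_actK.
have lU := cl _ (open_orbit (@open_Wnorm_ball v0 e) Uact).
apply: (open_nbhs_nbhs (conj lU _)).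
by exists 1%g; rewrite W_act1 subrr Wnorm0.
Qed.

Lemma vcontinuous_path_of (g : I -> X) : continuous g -> vcontinuous (path_of g).
Proof.
move=> cg; apply/vcontinuousP.
apply: (@continuous_circ _ _ _ (g \o @clamp01 R) set_val); last exact: continuous_set_valX.
by apply: continuous_circ => //; exact: continuous_clamp01.
Qed.

Lemma path_of_complement (g : I -> X) t : X (path_of g t).
Proof. exact: point_complement. Qed.

(** The homotopy of loops in the orbit space, extended to the plane by clamping, is fed to
    [homotopic_wlifts] with both lifts starting at z. *)
Lemma lifts_equivalent (sigma : braid_group z) g h :
  is_lift sigma g -> is_lift sigma h -> set_val (g one) = set_val (h one) :> V /\
  forall H, log_equivalent (fun t => alpha H (path_of g t)) (fun t => alpha H (path_of h t)).
Proof.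
move=> [cg g0 [l [lE gl]]] [ch h0 [m [mE hm]]].
have /loop_classP [K [cK K0 K1 Kz Ko]] : loop_class l = loop_class m by rewrite lE mE.
pose F (p : R * R) : V := set_val (repr (K (clamp01 p.1, clamp01 p.2))).
have same (x y : X) : to_orbit x = to_orbit y -> exists w, set_val x = act w (set_val y).
  by move=> e; apply/to_orbitP; rewrite e.
have base s : exists w, zV = act w (set_val (repr (to_orbit zX))).
  by have [w ->] := repr_to_orbit zX; exists w^-1%g; rewrite W_actK.
have := @homotopic_wlifts R n W rW alpha alphaP Xfree A A0 AP F zV.
move=> /(_ _ _ _ _ _ (path_of g) (path_of h)); apply.
- apply: wcontinuous_orbit; apply: continuous_circ cK; apply: continuous_pair_map;
    apply: continuous_circ; try exact: continuous_clamp01;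
    by [exact: continuous_fst|exact: continuous_snd].
- by move=> p; exact: point_complement.
- by move=> t s; rewrite /F /= /clampR !itv_valK.
- by move=> s; rewrite /F /= -/(zero : I) Kz; exact: base.
- by move=> s; rewrite /F /= -/(one : I) Ko; exact: base.
- split; first exact: vcontinuous_path_of.
  move=> t _; rewrite /F /= -/(zero : I) K0 gl.
  have [w ->] := repr_to_orbit (g (clamp01 t)); exists w^-1%g; by rewrite W_actK.
- by rewrite -[LHS]/(set_val (g zero)) g0.
- split; first exact: vcontinuous_path_of.
  move=> t _; rewrite /F /= -/(one : I) K1 hm.
  have [w ->] := repr_to_orbit (h (clamp01 t)); exists w^-1%g; by rewrite W_actK.
- by rewrite -[LHS]/(set_val (h zero)) h0.
Qed.

(** A representative loop is lifted and the lift is replaced by a nearby polygon; the image in the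
    orbit space of the straight homotopy between them shows that the class is unchanged. *)
Lemma smooth_lift_ex (sigma : braid_group z) :
  exists2 g, is_lift sigma g & piecewise_C1_path (path_of g).
Proof.
pose l := repr sigma.
pose F (p : R * R) : V := set_val (repr (l (clamp01 p.1))).
have cF : wcontinuous rW F.
  apply: wcontinuous_orbit; apply: (@continuous_circ _ _ _ (fun p : R * R => clamp01 p.1) l).
    apply: continuous_circ; [exact: continuous_fst|exact: continuous_clamp01].
  exact: cts_fun.
have FX p : X (F p) by exact: point_complement.
have Fclamp t s : F (t, s) = F (clampR t, clampR s) by rewrite /F /= /clampR !itv_valK.
have F0 s : exists w, zV = act w (F (0, s)).
  rewrite /F /= -/(zero : I) path_zero.
  by have [w ->] := repr_to_orbit zX; exists w^-1%g; rewrite W_actK.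
have [k [ck kP] k0] := slice_wlift_ex alphaP Xfree A0 AP cF FX Fclamp F0 0.
have kX t : 0 <= t <= 1 -> X (k t).
  by move=> /kP[w ->]; apply: complement_act; exact: point_complement.
have [p [cp p0 p1 pC pX]] := @polygon_ex R n W rW alpha alphaP Xfree A A0 AP k ck kX.
pose G (u : I * I) : V :=
  k (itv_val u.1) + (itv_val u.2)%:C *: (p (itv_val u.1) - k (itv_val u.1)).
have GX (u : I * I) : X (G u) by apply: pX; exact: itv_val01.
have cG : continuous (to_complement GX).
  apply: continuous_to_complement.
  have c1 : continuous (fun u : I * I => itv_val u.1).
    by apply: continuous_circ; [exact: continuous_fst|exact: continuous_itv_val].
  have c2 : continuous (fun u : I * I => itv_val u.2).
    by apply: continuous_circ; [exact: continuous_snd|exact: continuous_itv_val].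
  apply: vcontinuousD; first exact: (vcontinuous_comp ck).
  apply: vcontinuousZ; first by split=> // u; exact: cvg_cst.
  by apply: vcontinuousB; [exact: (vcontinuous_comp cp)|exact: (vcontinuous_comp ck)].
pose g (t : I) : X := to_complement GX (t, one).
have cg : continuous g.
  apply: (@continuous_circ _ _ _ (fun t : I => (t, one : I))); last exact: cG.
  apply: (@continuous_pair_map I I I id (cst one)); last exact: cst_continuous.
  by move=> t; exact: cvg_id.
have gE t : set_val (g t) = p (itv_val t).
  rewrite -[LHS]/(G (t, one)) /G /= itv_val1 -[1%:C]/(1 : R[i]) scale1r.
  by rewrite addrC subrK.
have G0 s : to_complement GX (zero, s) = zX.
  by apply: val_inj; rewrite -[LHS]/(G (zero, s)) /G /= itv_val0 p0 subrr scaler0 addr0 k0.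
have o01 : 0 <= (1 : R) <= 1 by rewrite lexx ler01.
have G1 s : to_orbit (to_complement GX (one, s)) = to_orbit zX.
  apply/esym/to_orbitP; rewrite -[set_val _]/(G (one, s)) /G /= itv_val1 p1 subrr scaler0 addr0.
  have [w ->] := kP 1 o01; rewrite /F /= -/(one : I) path_one.
  have [w' w'E] := repr_to_orbit zX; exists (w * w')%g; by rewrite w'E W_actM.
have lg_cts : continuous (@to_orbit R n W rW \o g).
  by apply: continuous_circ => //; exact: continuous_to_orbit.
have lg_zero : (@to_orbit R n W rW \o g) zero = to_orbit zX by rewrite /= /g G0.
have lg_one : (@to_orbit R n W rW \o g) one = to_orbit zX by rewrite /= /g G1.
pose m : {path I from to_orbit zX to to_orbit zX in orbit_space rW} :=
  mk_path lg_cts lg_zero lg_one.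
exists g.
  split=> //; first by rewrite /g G0.
  exists m; split=> //; rewrite -[sigma]reprK; apply/loop_classP/homotopic_sym.
  exists (@to_orbit R n W rW \o to_complement GX); split.
  - by apply: continuous_circ => //; exact: continuous_to_orbit.
  - move=> t; have [w kE] := kP (itv_val t) (itv_val01 t).
    rewrite -/l -[l t]reprK; apply/esym/to_orbitP; exists w.
    rewrite -[LHS]/(G (t, zero)) /G /= itv_val0 -[0%:C]/(0 : R[i]) scale0r addr0 kE.
    by rewrite /F /= itv_valK.
  - by [].
  - by move=> s /=; rewrite G0.
  - by move=> s; exact: G1.
suff -> : path_of g = fun t => p (clampR t) by [].
by apply/funext => t; rewrite /path_of gE.
Qed.

Lemma braid_liftP (sigma : braid_group z) :
  is_lift sigma (braid_lift sigma) /\ piecewise_C1_path (path_of (braid_lift sigma)).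
Proof.
have [g gl gC] := smooth_lift_ex sigma; rewrite /braid_lift.
by case: xgetP => [h -> //|/(_ g) []].
Qed.

Lemma braid_projP (sigma : braid_group z) g :
  is_lift sigma g -> set_val (g one) = act (braid_proj sigma) zV.
Proof.
move=> gl; rewrite /braid_proj; case: xgetP => [w -> [h hl hE]|nex].
  by have [-> _] := lifts_equivalent gl hl.
have [_ _ [l [_ lE]]] := gl.
have /to_orbitP [w wE] : to_orbit zX = to_orbit (g one) by rewrite -lE path_one.
by case: (nex w); exists g.
Qed.

Lemma braid_proj_eq (sigma : braid_group z) g w :
  is_lift sigma g -> set_val (g one) = act w zV -> braid_proj sigma = w.
Proof.
move=> /braid_projP -> e; apply/eqP; rewrite eq_sym eq_mulVg1; apply/eqP.
by apply: (Xfree base_complement); rewrite W_actM e W_actK.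
Qed.

Definition dlog_period H (sigma : braid_group z) : R[i] :=
  integral_dlog (alpha H) (path_of (braid_lift sigma)).

Lemma path_of0 (g : I -> X) : g zero = zX -> path_of g 0 = zV.
Proof. by move=> e; rewrite -[LHS]/(set_val (g zero)) e. Qed.

Lemma alpha_neq0 H v : X v -> alpha H v != 0.
Proof. by move=> vX; have := vX H; rewrite -alphaP memv_ker. Qed.

Lemma lift_log H (sigma : braid_group z) g : is_lift sigma g -> exists L : R -> R[i],
  [/\ ccontinuous L, L 0 = 0, L 1 = dlog_period H sigma &
    forall t, 0 <= t <= 1 -> alpha H (path_of g t) = alpha H zV * cexp (L t)].
Proof.
move=> gl; have [bl blC] := braid_liftP sigma.
have [|L [cL L0 LP L1]] := integral_dlog_log (al := alpha H) blC.
  by move=> t _; apply: alpha_neq0; exact: path_of_complement.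
have [_ /(_ H) [M [cM M0 M1 MP]]] := lifts_equivalent bl gl.
exists (fun t => L t + M t); split.
- exact: ccontinuousD.
- by rewrite L0 M0 addr0.
- by rewrite M1 addr0 -L1.
- by move=> t t01; rewrite MP // LP // cexpD mulrA path_of0 //; case: bl.
Qed.

(** Two continuous logarithms of the same path that both start at 0 differ by a continuous logarithm
    of 1. The period can thus be read off any lift, smooth or not. *)
Lemma dlog_periodE H (sigma : braid_group z) g (L : R -> R[i]) : is_lift sigma g ->
  ccontinuous L -> L 0 = 0 ->
  (forall t, 0 <= t <= 1 -> alpha H (path_of g t) = alpha H zV * cexp (L t)) ->
  dlog_period H sigma = L 1.
Proof.
move=> gl cL L0 LP; have [K [cK K0 <- KP]] := lift_log H gl.
apply/esym/eqP; rewrite -subr_eq0; apply/eqP.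
apply: (@continuous_log1 R (fun t => L t - K t)); last by rewrite lexx ler01.
- by apply: ccontinuousD => //; exact: ccontinuousN.
- by rewrite L0 K0 subrr.
move=> t t01; rewrite cexpD cexpN.
have -> : cexp (L t) = cexp (K t).
  by apply: (mulfI (alpha_neq0 H base_complement)); rewrite -LP // -KP.
by rewrite divff // cexp_neq0.
Qed.

Lemma cexp_dlog_period H (sigma : braid_group z) :
  alpha H (act (braid_proj sigma) zV) = alpha H zV * cexp (dlog_period H sigma).
Proof.
have [bl _] := braid_liftP sigma; have [L [_ _ <- LP]] := lift_log H bl.
by rewrite -(braid_projP bl) -[set_val _]/(path_of _ 1) LP // lexx ler01.
Qed.

(** alpha_H o w and alpha_(w^-1 H) have the same kernel, so they are proportional; the ratio is
    expressed by their values at u. *)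
Lemma linform_act H w v u : X u ->
  alpha H (act w v) = alpha H (act w u) * (alpha (hyperplane_act w^-1%g H) v /
    alpha (hyperplane_act w^-1%g H) u).
Proof.
move=> uX; set K := hyperplane_act _ _; set c := _ / _.
have Ku := alpha_neq0 K uX.
have : v - c *: u \in (K : {vspace V}).
  rewrite -alphaP memv_ker linearB linearZ.
  by apply/eqP/(etrans _ (subrr (alpha K v))); congr (_ - _); exact: divfK.
rewrite /K /= image_spaceP invgK -alphaP memv_ker W_actB linearB subr_eq0 => /eqP ->.
by rewrite /W_act -scalemxAr linearZ mulrC.
Qed.

Section Product.
Variables (a b : braid_group z) (g h : I -> X).
Hypothesis gl : is_lift a g.
Hypothesis hl : is_lift b h.
Let w := braid_proj a.

Let cat_path (t : I) : V := if itv_val t <= 2^-1 then path_of g (2 * itv_val t)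
  else act w (path_of h (2 * itv_val t - 1)).

Let cat_pathX t : X (cat_path t).
Proof.
rewrite /cat_path; case: ifP => _; first exact: path_of_complement.
by apply: complement_act; exact: path_of_complement.
Qed.

Let vcontinuous_cat_path : vcontinuous cat_path.
Proof.
case: gl hl => cg _ _ [ch h0 _]; apply/vcontinuousP; apply: continuous_glue.
- exact: continuous_itv_val.
- apply/vcontinuousP; apply: (@vcontinuous_comp _ _ _ _ (path_of g) (fun t : I => 2 * itv_val t)).
    exact: vcontinuous_path_of.
  exact: (@continuous_circ I R R (@itv_val R) (fun x => 2 * x) (@continuous_itv_val R)
    (@mulrl_continuous R 2)).
- apply/vcontinuousP; apply: vcontinuous_act.
  apply: (@vcontinuous_comp _ _ _ _ (path_of h) (fun t : I => 2 * itv_val t - 1)).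
    exact: vcontinuous_path_of.
  exact: (@continuous_circ _ _ _ (@itv_val R) (fun x => 2 * x + -1)
    (@continuous_itv_val R) (@continuous_affine R 2 _)).
- move=> t ->; rewrite mulfV ?pnatr_eq0 // subrr path_of0 //.
  by rewrite -[LHS]/(set_val (g one)) (braid_projP gl).
Qed.

Lemma is_lift_mul : is_lift (a * b)%g (to_complement cat_pathX).
Proof.
case: (gl) (hl) => cg g0 [l [lE lg]] [ch h0 [m [mE mh]]]; split.
- exact: (@continuous_to_complement _ _ cat_pathX vcontinuous_cat_path).
- apply: val_inj; rewrite -[LHS]/(cat_path zero) /cat_path itv_val0 invr_ge0 ler0n mulr0.
  exact: path_of0.
exists (loop_cat l m); split.
  by rewrite -fundamental_group_mulE lE mE.
move=> t; rewrite loop_catE; case: ifPn => tle.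
  by rewrite lg; apply/to_orbitP; exists 1%g; rewrite W_act1 -[LHS]/(cat_path t) /cat_path tle.
by rewrite mh; apply/to_orbitP; exists w; rewrite -[LHS]/(cat_path t) /cat_path (negPf tle).
Qed.

Lemma braid_projM : braid_proj (a * b)%g = (braid_proj a * braid_proj b)%g.
Proof.
apply: (braid_proj_eq is_lift_mul); rewrite -[LHS]/(cat_path one) /cat_path itv_val1.
rewrite ifF; last by lra.
rewrite [2 * 1 - 1](_ : _ = 1); last by lra.
by rewrite -[path_of h 1]/(set_val (h one)) (braid_projP hl) W_actM.
Qed.

(** The second half of the concatenated lift is w.h, along which alpha_H varies as alpha_(w^-1 H)
    does along h. Joining the two logarithms gives one for the product. *)
Lemma dlog_periodM H : dlog_period H (a * b)%g =
  dlog_period H a + dlog_period (hyperplane_act (braid_proj a)^-1%g H) b.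
Proof.
have [L [cL L0 <- LP]] := lift_log H gl.
have [K [cK K0 <- KP]] := lift_log (hyperplane_act w^-1%g H) hl.
pose M (t : R) : R[i] := if t <= 2^-1 then L (2 * t) else L 1 + K (2 * t - 1).
have cM : ccontinuous M.
  have cl c : continuous (fun t : R => 2 * t + c) by exact: continuous_affine.
  have half (t : R) : t = 2^-1 -> L (2 * t + 0) = L 1 + K (2 * t + -1).
    by move=> ->; rewrite addr0 mulfV ?pnatr_eq0 // subrr K0 addr0.
  case: cL cK => [cL1 cL2] [cK1 cK2]; split.
    rewrite (_ : (fun t => _) = fun t : R => if t <= 2^-1 then Re (L (2 * t + 0))
        else Re (L 1) + Re (K (2 * t + -1))); last first.
      by apply/funext => t; rewrite /M addr0 -cReD; case: ifP.
    apply: continuous_glue => [t|||t /half ->]; last by rewrite cReD.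
    - exact: cvg_id.
    - exact: (@continuous_circ _ _ _ (fun t : R => 2 * t + 0) (fun t => Re (L t))).
    - move=> t; apply: cvgD; first exact: cvg_cst.
      exact: (@continuous_circ _ _ _ (fun t : R => 2 * t + -1) (fun t => Re (K t))).
  rewrite (_ : (fun t => _) = fun t : R => if t <= 2^-1 then Im (L (2 * t + 0))
      else Im (L 1) + Im (K (2 * t + -1))); last first.
    by apply/funext => t; rewrite /M addr0 -cImD; case: ifP.
  apply: continuous_glue => [t|||t /half ->]; last by rewrite cImD.
  - exact: cvg_id.
  - exact: (@continuous_circ _ _ _ (fun t : R => 2 * t + 0) (fun t => Im (L t))).
  - move=> t; apply: cvgD; first exact: cvg_cst.
    exact: (@continuous_circ _ _ _ (fun t : R => 2 * t + -1) (fun t => Im (K t))).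
rewrite (dlog_periodE is_lift_mul cM); first last.
- move=> t t01; rewrite -[path_of _ t]/(cat_path (clamp01 t)) /cat_path /M clamp01K //.
  case: ifPn => [tle|]; first by rewrite LP //; lra.
  rewrite -ltNge => tgt; rewrite (linform_act _ _ _ base_complement) KP; last by lra.
  have := LP 1; rewrite lexx ler01 -[path_of g 1]/(set_val (g one)) (braid_projP gl).
  move=> -> //; rewrite cexpD [RHS]mulrA; congr (_ * _).
  by rewrite mulrAC divff ?mul1r // alpha_neq0 //; exact: base_complement.
- by rewrite /M invr_ge0 ler0n mulr0.
rewrite /M ifF; last by lra.
by congr (_ + K _); lra.
Qed.
End Product.
End BraidLifts.
(** * Monodromy matrices *)

Section MonomialMatrices.
Variables (F : fieldType) (W : finGroupType) (I : finType) (act : W -> I -> I).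
Hypothesis act1 : forall H, act 1%g H = H.
Hypothesis actM : forall w w' H, act (w * w')%g H = act w (act w' H).
Implicit Types (w : W) (H K : I) (f g : I -> F).

Let actK w : cancel (act w) (act w^-1%g).
Proof. by move=> H; rewrite -actM mulVg act1. Qed.

Let actVK w : cancel (act w^-1%g) (act w).
Proof. by move=> H; rewrite -actM mulgV act1. Qed.

(** The matrix diag(f) R_0(w): [f] is indexed by the row, that is by the image under [w]. *)
Definition monomial w f : 'M[F]_#|I| := \matrix_(a, b)
  (f (enum_val a) * (enum_val a == act w (enum_val b))%:R).

Lemma monomialE w f a b : monomial w f a b =
  f (enum_val a) * (enum_val a == act w (enum_val b))%:R.
Proof. exact: mxE. Qed.

Lemma eq_monomial w f g : f =1 g -> monomial w f = monomial w g.
Proof. by move=> fg; apply/matrixP => a b; rewrite !monomialE fg. Qed.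

Lemma monomialM w w' f g : monomial w f *m monomial w' g =
  monomial (w * w')%g (fun H => f H * g (act w^-1%g H)).
Proof.
apply/matrixP => a b; rewrite monomialE [LHS]mxE.
set H := enum_val a; set K := enum_val b.
rewrite (bigD1 (enum_rank (act w^-1%g H)) isT) !monomialE enum_rankK.
rewrite actVK eqxx mulr1 big1 => [|c cE]; last first.
  rewrite !monomialE; have [HE|] := eqVneq; last by rewrite mulr0 mul0r.
  by case/eqP: cE; rewrite /H HE actK enum_valK.
rewrite /= addr0 actM mulrA -(inj_eq (can_inj (actK w))).
by rewrite actVK.
Qed.

Lemma monomial1 : monomial 1%g (fun=> 1) = 1%:M.
Proof.
apply/matrixP => a b; rewrite monomialE [RHS]mxE act1 mul1r.
by rewrite (inj_eq enum_val_inj).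
Qed.

Lemma monomial_unit w f : (forall H, f H != 0) -> monomial w f \in unitmx.
Proof.
move=> f0; pose g H := (f (act w H))^-1.
suff /mulmx1_unit[] : monomial w f *m monomial w^-1%g g = 1%:M by [].
rewrite monomialM mulgV -monomial1; apply: eq_monomial => H.
by rewrite /g actVK divff.
Qed.

Lemma monomial_basis w f H : monomial w f *m delta_mx (enum_rank H) 0 =
  f (act w H) *: delta_mx (enum_rank (act w H)) 0 :> 'cV_#|I|.
Proof.
rewrite -colE; apply/matrixP => a b; rewrite [LHS]mxE monomialE [RHS]mxE [X in _ = _ * X]mxE.
rewrite enum_rankK ord1 eqxx andbT.
rewrite -(inj_eq enum_val_inj) enum_rankK.
by have [->|] := eqVneq; rewrite ?mulr1 ?mulr0.
Qed.

Lemma monomial_trace w f :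
  \tr (monomial w f) = \sum_(H | H == act w H) f H.
Proof.
rewrite /mxtrace (reindex enum_rank); last by apply: onW_bij; exact: enum_rank_bij.
rewrite [RHS]big_mkcond; apply: eq_bigr => H _; rewrite monomialE !enum_rankK.
by case: eqP; rewrite ?mulr1 ?mulr0.
Qed.

Lemma prod_diagonal (r : seq (I)) (f : I -> I -> F) :
  \prod_(H <- r) monomial 1%g (f H) = monomial 1%g (fun K => \prod_(H <- r) f H K).
Proof.
elim: r => [|H r IH].
  by rewrite big_nil -[1]monomial1; apply: eq_monomial => K; rewrite big_nil.
rewrite big_cons IH -[_ * _]/(_ *m _) monomialM mulg1; apply: eq_monomial => K.
by rewrite invg1 act1 big_cons.
Qed.

End MonomialMatrices.

Section MonodromyMatrix.
Variables (R : realType) (n : nat) (W : finGroupType).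
Variable rW : mx_representation R [set: W]%G n.
Implicit Types (w : W) (H K : hyperplane rW).
Local Notation monomial := (monomial (@hyperplane_act R n W rW)).

Lemma hyperplane_actM w w' H :
  hyperplane_act (w * w')%g H = hyperplane_act w (hyperplane_act w' H).
Proof.
apply: val_inj; apply/vspaceP => v.
by rewrite -!/(image_space _ _ _) !image_spaceP invMg W_actM.
Qed.

Lemma hyperplane_act1 H : hyperplane_act 1%g H = H.
Proof. by apply: val_inj; apply/vspaceP => v; rewrite image_spaceP invg1 W_act1. Qed.

Lemma hyperplane_actK w H : hyperplane_act w^-1%g (hyperplane_act w H) = H.
Proof. by rewrite -hyperplane_actM mulVg hyperplane_act1. Qed.

Lemma permutation_repE w : permutation_rep rW w = monomial w (fun=> 1).
Proof. by apply/matrixP => a b; rewrite monomialE [LHS]mxE mul1r. Qed.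

Lemma mxexp_projE (c : R[i]) H : mxexp (c *: hyperplane_proj H) =
  monomial 1%g (fun K => if K == H then cexp c else 1).
Proof.
rewrite /hyperplane_proj mxexp_delta; apply/matrixP => a b.
rewrite [LHS]mxE [X in X + _]mxE [X in _ + X]mxE [X in _ * X]mxE monomialE.
rewrite hyperplane_act1 (inj_eq enum_val_inj).
rewrite -[a == enum_rank H](inj_eq enum_val_inj) -[b == enum_rank H](inj_eq enum_val_inj).
rewrite !enum_rankK.
have [<-|ab] := eqVneq a b; last first.
  case: eqVneq => [<-|]; last by rewrite mulr0 addr0 mulr0.
  by rewrite (inj_eq enum_val_inj) eq_sym (negPf ab) mulr0 addr0 mulr0.
by rewrite andbb mulr1; case: eqVneq => _; rewrite ?mulr1 ?mulr0 ?addr0 // addrC subrK.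
Qed.

Lemma monodromyE (z : real_complement rW) (alpha : hyperplane rW -> 'Hom('cV[R[i]]_n, R[i]))
    (h : R[i]) (b : braid_group z) :
  monodromy alpha h b = monomial (braid_proj b) (fun H => cexp (h * dlog_period alpha H b)).
Proof.
rewrite /monodromy permutation_repE.
under eq_bigr do rewrite mxexp_projE.
rewrite (prod_diagonal hyperplane_act1 hyperplane_actM).
rewrite (monomialM hyperplane_act1 hyperplane_actM) mul1g; apply: eq_monomial => H.
rewrite mulr1 (bigD1 H) //= eqxx big1 ?mulr1 // => K /negPf.
by rewrite eq_sym => ->.
Qed.

End MonodromyMatrix.

(** * Unit normals, distances to the base point and signs *)

Section Normals.
Variables (R : realType) (n : nat) (W : finGroupType).
Variable rW : mx_representation R [set: W]%G n.
Variable G : 'M[R]_n.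
Hypothesis Ginv : invariant_scalar_product rW G.
Hypothesis Wf : mx_faithful rW.
Variable z : real_complement rW.
Implicit Types (w s : W) (H K : hyperplane rW) (x y a b : 'cV[R]_n).
Local Notation dot := (dot G).
Local Notation zR := (set_val z : 'cV[R]_n).
Local Notation "w '^@' H" := (hyperplane_act w H) (at level 30).

Lemma base_regular : regular rW zR.
Proof. by apply/real_complement_regular; exact: (set_mem (valP z)). Qed.

(** The reflection with hyperplane [H] is chosen, but [normal_eq] shows that every such reflection
    gives the same vector. *)
Definition unit_normal H : 'cV[R]_n :=
  root rW G zR (xget 1%g [set t | is_reflection rW t /\ fix_space rW t = H]).

Lemma normal_reflects H : exists t, [/\ is_reflection rW t, fix_space rW t = H,
  root rW G zR t = unit_normal H & reflects rW G t (unit_normal H)].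
Proof.
have [t Tt tH] := hyperplane_reflection H.
have := @xgetPex _ 1%g [set t | is_reflection rW t /\ fix_space rW t = H]
  (ex_intro _ t (conj Tt tH)).
rewrite /unit_normal; set t' := xget _ _ => -[Tt' tH'].
have [_ tr _] := rootP Ginv base_regular Tt'.
by exists t'; split; [exact: Tt'|exact: tH'| |exact: tr].
Qed.

Lemma normal1 H : dot (unit_normal H) (unit_normal H) = 1.
Proof. by have [t [Tt _ <- _]] := normal_reflects H; have [] := rootP Ginv base_regular Tt. Qed.

Definition nu H := dot (unit_normal H) zR.

Lemma nu_gt0 H : 0 < nu H.
Proof.
by rewrite /nu; have [t [Tt _ <- _]] := normal_reflects H; have [] := rootP Ginv base_regular Tt.
Qed.

Lemma nu_neq0 H : nu H != 0. Proof. by rewrite gt_eqF ?nu_gt0. Qed.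

Lemma reflects_fix t a x : dot a a = 1 -> reflects rW G t a ->
  cplx x \in fix_space rW t <-> dot a x = 0.
Proof.
move=> a1 ta.
rewrite -(rwP (fix_spaceP _ _ _)) cplx_fix ta (dotC Ginv).
split=> [/eqP|->]; last by rewrite mulr0 scale0r subr0.
rewrite -subr_eq0 addrAC subrr add0r oppr_eq0 scaler_eq0 => /orP[/eqP|/eqP a0].
  by move/eqP; rewrite mulf_eq0 pnatr_eq0 /= => /eqP.
by move: a1; rewrite a0 /dot mulmx0 mxE => /eqP; rewrite eq_sym oner_eq0.
Qed.

Lemma mem_hyperplane H x : cplx x \in (H : {vspace _}) <-> dot (unit_normal H) x = 0.
Proof. by have [t [_ <- _ tH]] := normal_reflects H; apply: reflects_fix tH; exact: normal1. Qed.

Lemma unit_perp_uniq a b : dot a a = 1 -> dot b b = 1 ->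
  (forall x, dot a x = 0 -> dot b x = 0) -> b = a \/ b = - a.
Proof.
move=> a1 b1 ab; have := ab (b - dot a b *: a).
rewrite !(dotDr, dotNr, dotZr) a1 b1 mulr1 subrr (dotC Ginv b a) => /(_ erefl).
move=> /eqP; rewrite subr_eq0 -expr2 eq_sym sqrf_eq1 => /orP[] /eqP ab1; [left|right].
  apply/eqP; rewrite -subr_eq0; apply/eqP/(dot_eq0 Ginv).
  rewrite !(dotDr, dotNr, dotDl Ginv, dotNl Ginv) a1 b1 (dotC Ginv b a) ab1; lra.
apply/eqP; rewrite -subr_eq0 opprK; apply/eqP/(dot_eq0 Ginv).
rewrite !(dotDr, dotNr, dotDl Ginv, dotNl Ginv) a1 b1 (dotC Ginv b a) ab1; lra.
Qed.

Lemma normal_eq H s : is_reflection rW s -> fix_space rW s = H ->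
  unit_normal H = root rW G zR s.
Proof.
move=> Ts sH; have [s1 sr sz] := rootP Ginv base_regular Ts.
have [|//|e] := unit_perp_uniq s1 (normal1 H).
  by move=> x sx; apply/mem_hyperplane; rewrite -sH; apply/(reflects_fix _ s1 sr).
by have := nu_gt0 H; rewrite /nu e (dotNl Ginv) oppr_gt0 ltNge ltW.
Qed.

(** The sign in w^-1 a_H = +- a_(w^-1 H), obtained by pairing both sides with z. *)
Definition sgn w H : R := dot (unit_normal H) (rW w *m zR) / nu (w^-1%g ^@ H).

Lemma cplx_act w x : W_act rW w (cplx x) = cplx (rW w *m x).
Proof. by rewrite /W_act /W_mx /cplx map_mxM. Qed.

Lemma sgn_cases w H :
  (rW w^-1%g *m unit_normal H = unit_normal (w^-1%g ^@ H) /\ sgn w H = 1) \/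
  (rW w^-1%g *m unit_normal H = - unit_normal (w^-1%g ^@ H) /\ sgn w H = - 1).
Proof.
set K := _ ^@ H; have a1 : dot (rW w^-1%g *m unit_normal H) (rW w^-1%g *m unit_normal H) = 1.
  by rewrite (dot_act Ginv) normal1.
have sE : sgn w H = dot (rW w^-1%g *m unit_normal H) zR / nu K by rewrite (dot_actl Ginv) invgK.
have [x|e|e] := unit_perp_uniq (normal1 K) a1; first last.
- by right; rewrite sE e (dotNl Ginv) mulNr divff ?nu_neq0.
- by left; rewrite sE e divff ?nu_neq0.
rewrite -mem_hyperplane image_spaceP invgK cplx_act mem_hyperplane.
by rewrite (dot_actl Ginv) invgK.
Qed.

Lemma act_normal w H : rW w^-1%g *m unit_normal H = sgn w H *: unit_normal (w^-1%g ^@ H).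
Proof. by case: (sgn_cases w H) => -[-> ->]; rewrite ?scale1r ?scaleN1r. Qed.

Lemma sgn_sqr w H : sgn w H ^+ 2 = 1.
Proof. by case: (sgn_cases w H) => -[_ ->]; rewrite ?sqrrN expr1n. Qed.

Lemma dot_normal_act w H : dot (unit_normal H) (rW w *m zR) = sgn w H * nu (w^-1%g ^@ H).
Proof. by rewrite /sgn divfK ?nu_neq0. Qed.

(** This cocycle relation is what makes w |-> diag([sgn w]) R_0(w) a representation of W. *)
Lemma sgnM w w' H : sgn (w * w')%g H = sgn w H * sgn w' (w^-1%g ^@ H).
Proof.
rewrite {1}/sgn invMg hyperplane_actM actM -{1}[w]invgK -(dot_actl Ginv) act_normal.
by rewrite (dotZl Ginv) dot_normal_act mulrA mulfK ?nu_neq0.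
Qed.

Lemma sgn1 H : sgn 1%g H = 1.
Proof. by rewrite /sgn invg1 hyperplane_act1 act1 divff ?nu_neq0. Qed.

Section Simple.
Variables (s : W) (L : hyperplane rW).
Hypothesis sL : fix_space rW s = L.
Hypothesis ss : simple rW G zR s.

Lemma sgn_simple_wall : sgn s L = - 1.
Proof.
have [Ts _] := simpleP _ _ _ _ ss.
have [r1 sr _] := rootP Ginv base_regular Ts.
have : dot (unit_normal L) (rW s *m zR) < 0.
  by rewrite (normal_eq Ts sL); exact: (separates_self Ginv Wf base_regular Ts).
rewrite dot_normal_act; case: (sgn_cases s L) => -[_ ->] //.
by rewrite mul1r ltNge ltW // nu_gt0.
Qed.

Lemma act_simple_wall : s ^@ L = L.
Proof.
have [Ts _] := simpleP _ _ _ _ ss.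
apply: val_inj; apply/vspaceP => v.
rewrite image_spaceP -[\val L]/(hyperplane_space L) -sL {1}(reflectionK Ginv Wf base_regular Ts).
apply/fix_spaceP/fix_spaceP => [e|vE]; last by rewrite !vE.
by rewrite -e -{1}(reflectionK Ginv Wf base_regular Ts) W_actK.
Qed.

(** A negative sign would mean that H separates z from s z, which simplicity allows for L only. *)
Lemma sgn_simple H : H != L -> sgn s H = 1.
Proof.
move=> HL; have [Ts sP] := simpleP _ _ _ _ ss.
case: (sgn_cases s H) => -[_ //] sN; have := dot_normal_act s H; rewrite sN mulN1r.
have [t [Tt tH <- _]] := normal_reflects H => dE.
have ts : t = s by apply: sP => //; rewrite /separates dE oppr_lt0 nu_gt0.
by case/eqP: HL; apply: val_inj; rewrite -[LHS]tH ts.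
Qed.

End Simple.

(** * Periods of the Artin generators *)

Section LinearForms.
Variable alpha : hyperplane rW -> 'Hom('cV[R[i]]_n, R[i]).
Hypothesis alphaP : forall H, lker (alpha H) = H.

(** On real vectors alpha_H and <a_H, .> have the same kernel; normalising at z leaves a real
    factor. *)
Lemma alpha_cplx H x :
  alpha H (cplx x) = alpha H (cplx zR) * (dot (unit_normal H) x / nu H)%:C.
Proof.
set c := _ / _; have : cplx (x - c *: zR) \in (H : {vspace _}).
  apply/mem_hyperplane; rewrite dotDr dotNr dotZr -/(nu H) divfK ?subrr ?nu_neq0 //.
rewrite -alphaP memv_ker /cplx map_mxB map_mxZ linearB linearZ subr_eq0 => /eqP ->.
exact: mulrC.
Qed.

(** The modulus of the coefficient of xm along the Artin path: it decreases from 1 to eps, stays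
    there, and increases back. On each third the relevant term is the largest of the three. *)
Definition radius (eps t : R) : R :=
  Num.max eps (Num.max (1 - (1 - eps) * (3 * t)) (1 - (1 - eps) * (3 - 3 * t))).

(* exp (log_turn eps t) is the coefficient of xm in artin_path, so that every linear
   form alpha H is, along this path, a combination a + b exp (log_turn eps t). *)
Definition log_turn (eps t : R) : R[i] :=
  ln (radius eps (clampR t)) +i* (pi * clampR (3 * t - 1)).

Section ArtinPath.
Variable eps : R.
Hypothesis eps0 : 0 < eps.
Hypothesis eps1 : eps < 1.

Lemma radius_gt0 t : 0 < radius eps t.
Proof. by rewrite /radius lt_max eps0. Qed.

Lemma radius_le1 t : 0 <= t <= 1 -> radius eps t <= 1.
Proof.
move=> /andP[t0 t1]; have e1 : 0 <= 1 - eps by rewrite subr_ge0 ltW.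
have := mulr_ge0 e1 t0; have := mulr_ge0 e1 (_ : 0 <= 1 - t).
rewrite subr_ge0 => /(_ t1) h1 h2.
by rewrite /radius !ge_max; apply/and3P; split; lra.
Qed.

Lemma cexp_log_turn t : cexp (log_turn eps t) =
  (radius eps (clampR t) * cos (pi * clampR (3 * t - 1))) +i*
  (radius eps (clampR t) * sin (pi * clampR (3 * t - 1))).
Proof. by rewrite /cexp /= lnK // posrE radius_gt0. Qed.

Lemma ccontinuous_log_turn : ccontinuous (log_turn eps).
Proof.
have caff (a b : R) : continuous (fun t : R => a * t + b) by exact: continuous_affine.
have cclamp : continuous (@clampR R) by exact: continuous_itv_clamp.
have crad : continuous (radius eps).
  pose f1 (x : R) : R := (- (1 - eps) * 3) * x + 1.
  pose f2 (x : R) : R := ((1 - eps) * 3) * x + (1 - (1 - eps) * 3).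
  have -> : radius eps = cst eps \max (f1 \max f2).
    by apply/funext => x; rewrite /radius /f1 /f2; congr (Num.max _ (Num.max _ _)); ring.
  have cmax (f g : R -> R) : continuous f -> continuous g -> continuous (f \max g).
    by move=> cf cg x; apply: continuous_max; [exact: cf|exact: cg].
  by apply: (cmax); [exact: cst_continuous|apply: cmax; exact: caff].
split=> t /=.
  apply: (@continuous_comp _ _ _ (fun t => radius eps (clampR t)) (@ln R)); last first.
    exact/continuous_ln/radius_gt0.
  apply: (@continuous_comp _ _ _ (@clampR R) (radius eps)); first exact: cclamp.
  exact: crad.
apply: cvgM; first exact: cvg_cst.
exact: (@continuous_circ _ _ _ (fun t : R => 3 * t + -1) (@clampR R) (caff _ _) cclamp).
Qed.

Lemma log_turn0 : log_turn eps 0 = 0.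
Proof.
rewrite /log_turn (@clampRE _ 0) ?lexx ?ler01 // clampR_le0; last by lra.
rewrite mulr0 (_ : radius _ _ = 1) ?ln1 //; apply/eqP; rewrite eq_le radius_le1 ?lexx ?ler01 //=.
by rewrite /radius !le_max !mulr0 subr0 lexx orbT.
Qed.

Lemma log_turn1 : log_turn eps 1 = 0 +i* pi.
Proof.
rewrite /log_turn (@clampRE _ 1) ?lexx ?ler01 // clampR_ge1; last by lra.
rewrite mulr1 (_ : radius _ _ = 1) ?ln1 //; apply/eqP; rewrite eq_le radius_le1 ?lexx ?ler01 //=.
by rewrite /radius !le_max mulr1 subrr mulr0 subr0 lexx !orbT.
Qed.

Variables (s : W) (xp xm : 'cV[R]_n) (H : hyperplane rW).
Hypothesis sxp : rW s *m xp = xp.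
Hypothesis sxm : rW s *m xm = - xm.
Let p := dot (unit_normal H) xp / nu H.
Let m := dot (unit_normal H) xm / nu H.

Lemma alpha_artin_path t : 0 <= t <= 1 -> alpha H (artin_path rW s xp xm eps t) =
  alpha H (cplx zR) * (p%:C + m%:C * cexp (log_turn eps t)).
Proof.
move=> t01; have linE (r : R) : alpha H (cplx (xp + r *: xm)) =
    alpha H (cplx zR) * (p%:C + (m * r)%:C).
  rewrite alpha_cplx dotDr dotZr; congr (_ * _); rewrite -rmorphD; congr (_%:C).
  by rewrite /p /m; ring.
have /andP[t0 t1] := t01; have e1 : 0 <= 1 - eps by rewrite subr_ge0 ltW.
rewrite cexp_log_turn clampRE // /artin_path; case: ifPn => [t3|].
  rewrite (clampR_le0 (_ : 3 * t - 1 <= 0)); last by lra.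
  rewrite linE mulr0 cos0 sin0; congr (_ * (_ + _)).
  have h : 0 <= (1 - eps) * (1 - 3 * t) by apply: mulr_ge0 => //; lra.
  have h' := mulr_ge0 e1 t0.
  have -> : radius eps t = 1 - (1 - eps) * (3 * t).
    rewrite /radius max_r; last by rewrite le_max; apply/orP; left; lra.
    by rewrite max_l //; lra.
  by apply: complex_eqP; rewrite ?cReM ?cImM /=; ring.
rewrite -ltNge => t3; case: ifPn => [t23|].
  rewrite clampRE; last by lra.
  have h : 0 <= (1 - eps) * (3 * t - 1) by apply: mulr_ge0 => //; lra.
  have h' : 0 <= (1 - eps) * (2 / 3 - t) by apply: mulr_ge0 => //; lra.
  have -> : radius eps t = eps by rewrite /radius max_l // ge_max; apply/andP; split; lra.
  set c := eps%:C * _.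
  have -> : alpha H (cplx xp + c *: cplx xm) = alpha H (cplx xp) + c * alpha H (cplx xm).
    by rewrite linearD linearZ.
  rewrite (alpha_cplx H xp) (alpha_cplx H xm) -/p -/m.
  have -> : (eps * cos (pi * (3 * t - 1)) +i* (eps * sin (pi * (3 * t - 1)))) = c.
    by apply: complex_eqP; rewrite /c ?cReM ?cImM /=; ring.
  by ring.
(* On the last third s changes the sign of xm, which agrees with the angle pi reached at the end of
   the half turn. *)
rewrite -ltNge => t23; rewrite cplx_act mulmxDr -scalemxAr sxp sxm scalerN -scaleNr linE.
rewrite (clampR_ge1 (_ : 1 <= 3 * t - 1)); last by lra.
rewrite mulr1 cospi sinpi; congr (_ * (_ + _)).
have h : 0 <= (1 - eps) * (3 * t - 2) by apply: mulr_ge0 => //; lra.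
have h' : 0 <= (1 - eps) * (1 - t) by apply: mulr_ge0 => //; lra.
have -> : radius eps t = 1 - (1 - eps) * (3 - 3 * t).
  rewrite /radius max_r; last by rewrite le_max; apply/orP; right; lra.
  by rewrite max_r //; lra.
by apply: complex_eqP; rewrite ?cReM ?cImM /=; ring.
Qed.

(** The real part is a + b c with -1 <= c <= 1, so it lies between a - b and a + b. *)
Lemma Re_turn_gt0 (a b t : R) : 0 < a + b -> 0 < a - b ->
  0 < Re (a%:C + b%:C * cexp (log_turn eps t)).
Proof.
move=> ab0 ba0; rewrite cexp_log_turn cReD cReM /= mul0r subr0.
set c := _ * cos _; have /andP[c1 c2] : -1 <= c <= 1.
  rewrite -ler_norml normrM; apply: mulr_ile1; rewrite ?normr_ge0 //.
    by rewrite gtr0_norm ?radius_gt0 ?radius_le1 ?clampR01.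
  by rewrite ler_norml cos_geN1 cos_le1.
have [c0|c0] := leP 0 c; nra.
Qed.

End ArtinPath.

Lemma clog_real (x : R) : 0 < x -> clog x%:C = (ln x)%:C.
Proof.
by move=> x0; rewrite /clog /= mul0r atan0 expr0n addr0 sqrtr_sqr gtr0_norm.
Qed.

Section ArtinPeriod.
Hypothesis Xfree : forall (v : 'cV[R[i]]_n) w,
  arr_complement rW v -> W_act rW w v = v -> w = 1%g.
Variable A : R.
Hypothesis A0 : 0 < A.
Hypothesis AP : forall H (v : 'cV[R[i]]_n), cnorm1 (alpha H v) <= A * Wnorm rW v.
Variables (s : W) (L : hyperplane rW) (sigma : braid_group z).
Hypothesis sL : fix_space rW s = L.
Hypothesis ss : simple rW G zR s.
Hypothesis sigmaP : is_artin_generator G L s sigma.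

(** Along the path alpha_H is alpha_H(z) (p + m exp(turn)), with p + m = 1 at z and p - m the
    relative value at s z. On the wall p = 0, and the turn itself is the logarithm. Elsewhere p - m
    > 0 keeps the values in the right half-plane, and the principal logarithm ends at ln(p - m). *)
Lemma artin_period H : dlog_period alpha H sigma =
  if H == L then 0 +i* pi else (ln (nu (s^-1%g ^@ H)) - ln (nu H))%:C.
Proof.
have [Ts _] := simpleP _ _ _ _ ss.
have [_ [xp [xm [zE xpL xmL small]]]] := sigmaP.
have sxp : rW s *m xp = xp by apply/cplx_fix/fix_spaceP; rewrite sL.
have [a1 sr _] := rootP Ginv base_regular Ts; rewrite -(normal_eq Ts sL) in a1 sr.
set a := unit_normal L in a1 sr.
have xmE : xm = dot a xm *: a.
  apply/eqP; rewrite -subr_eq0; set y := _ - _; apply/eqP/(dot_eq0 Ginv).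
  have yL : dot a y = 0 by rewrite /y dotDr dotNr dotZr a1 mulr1 subrr.
  rewrite {2}/y dotDr dotNr dotZr [dot y a](dotC Ginv) yL mulr0 subr0.
  have /mem_hyperplane/xmL := yL; by rewrite /dot => ->; rewrite mxE.
have sxm : rW s *m xm = - xm.
  by rewrite sr [dot xm a](dotC Ginv) -scalerA -xmE -[X in X - _]scale1r -scalerBl
    (_ : 1 - 2 = - 1) ?scaleN1r //; lra.
have sz : rW s *m zR = xp - xm by rewrite zE mulmxDr sxp sxm.
have [eps [eps0 eps1 [g gl gE]]] : exists eps, [/\ 0 < eps, eps < 1 &
    exists2 g, is_lift sigma g & forall t, set_val (g t) = artin_path rW s xp xm eps (itv_val t)].
  have near0 : \forall eps \near (0 : R)^'+, eps < 1 by exact: nbhs_right_lt.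
  have pos0 : \forall eps \near (0 : R)^'+, 0 < eps by exact: nbhs_right_gt.
  have [eps [[e1 e2] e3]] := filter_ex (filterI (filterI pos0 near0) small).
  by exists eps.
pose p := dot (unit_normal H) xp / nu H; pose m := dot (unit_normal H) xm / nu H.
have pm1 : p + m = 1 by rewrite /p /m -mulrDl -dotDr -zE divff ?nu_neq0.
have gH t : 0 <= t <= 1 -> alpha H (path_of g t) =
    alpha H (cplx zR) * (p%:C + m%:C * cexp (log_turn eps t)).
  move=> t01; rewrite -(alpha_artin_path eps0 eps1 H sxp sxm t01).
  by rewrite -[path_of g t]/(set_val (g (clamp01 t))) gE clamp01K.
have e1 : cexp (0 +i* pi : R[i]) = (- 1)%:C.
  by apply: complex_eqP; rewrite /= expR0 ?cospi ?sinpi mul1r ?mulr0.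
case: (eqVneq H L) => HL.
  have p0 : p = 0 by rewrite /p HL; move/mem_hyperplane: xpL => ->; rewrite mul0r.
  have m1 : m = 1 by rewrite -pm1 p0 add0r.
  rewrite -(log_turn1 eps1).
  apply: (dlog_periodE alphaP Xfree A0 AP gl).
  - exact: ccontinuous_log_turn.
  - exact: log_turn0.
  - by move=> t t01; rewrite gH // p0 m1 add0r mul1r.
have pmE : p - m = nu (s^-1%g ^@ H) / nu H.
  have := dot_normal_act s H; rewrite (sgn_simple sL ss HL) mul1r sz => <-.
  by rewrite /p /m dotDr dotNr mulrBl.
have pm0 : 0 < p - m by rewrite pmE divr_gt0 ?nu_gt0.
have re0 t : 0 < Re (p%:C + m%:C * cexp (log_turn eps t)).
  by apply: Re_turn_gt0 => //; rewrite pm1.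
rewrite (@dlog_periodE _ _ _ _ _ alphaP Xfree _ A0 AP _ H sigma g
  (fun t => clog (p%:C + m%:C * cexp (log_turn eps t))) gl); first last.
- by move=> t t01; rewrite gH // clogK.
- by rewrite log_turn0 // cexp0 mulr1 -rmorphD pm1 clog1.
- apply: ccontinuous_clog => //; apply: ccontinuousD; first exact: ccontinuous_cst.
  apply: ccontinuousM; first exact: ccontinuous_cst.
  by apply: ccontinuous_cexp; exact: ccontinuous_log_turn.
rewrite log_turn1 // e1 -rmorphM -rmorphD mulrN1 clog_real // pmE.
by rewrite ln_div ?posrE ?nu_gt0.
Qed.

End ArtinPeriod.

End LinearForms.

End Normals.

(** * The representations and their equivalences *)

Lemma mxtrace_similar (F : fieldType) d (P M N : 'M[F]_d) : P \in unitmx ->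
  P *m M = N *m P -> \tr M = \tr N.
Proof.
move=> Pu PM; rewrite -[M]mul1mx -(mulVmx Pu) -mulmxA PM mxtrace_mulC -mulmxA.
by rewrite mulmxV // mulmx1.
Qed.

Section MonodromyRepresentation.
Variables (R : realType) (n : nat) (W : finGroupType).
Variable rW : mx_representation R [set: W]%G n.
Variable alpha : hyperplane rW -> 'Hom('cV[R[i]]_n, R[i]).
Hypothesis alphaP : forall H, lker (alpha H) = H.
Hypothesis Xfree : forall (v : 'cV[R[i]]_n) (w : W),
  arr_complement rW v -> W_act rW w v = v -> w = 1%g.
Variable A : R.
Hypothesis A0 : 0 < A.
Hypothesis AP : forall H (v : 'cV[R[i]]_n), cnorm1 (alpha H v) <= A * Wnorm rW v.
Variable z : real_complement rW.
Implicit Types (a b : braid_group z) (H : hyperplane rW).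
Local Notation monomial := (monomial (@hyperplane_act R n W rW)).
Local Notation J := (dlog_period alpha).
Local Notation "w '^@' H" := (hyperplane_act w H) (at level 30).

Lemma hyperplane_monomialM w w' (f g : hyperplane rW -> R[i]) :
  monomial w f *m monomial w' g = monomial (w * w')%g (fun H => f H * g (w^-1%g ^@ H)).
Proof. exact: (monomialM (@hyperplane_act1 R n W rW) (@hyperplane_actM R n W rW)). Qed.

Lemma braid_proj_mul a b : braid_proj (a * b)%g = (braid_proj a * braid_proj b)%g.
Proof.
exact: (braid_projM alphaP Xfree A0 AP (braid_liftP alphaP Xfree A0 AP a).1
  (braid_liftP alphaP Xfree A0 AP b).1).
Qed.

Lemma braid_proj1 : braid_proj (1%g : braid_group z) = 1%g.
Proof.
have := braid_proj_mul 1%g 1%g; rewrite mulg1 => /esym e.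
by apply: (mulgI (braid_proj (1%g : braid_group z))); rewrite e mulg1.
Qed.

Lemma dlog_period_mul H a b :
  J H (a * b)%g = J H a + J ((braid_proj a)^-1%g ^@ H) b.
Proof.
exact: (dlog_periodM alphaP Xfree A0 AP (braid_liftP alphaP Xfree A0 AP a).1
  (braid_liftP alphaP Xfree A0 AP b).1).
Qed.

Lemma dlog_period1 H : J H (1%g : braid_group z) = 0.
Proof.
apply: (addrI (J H 1%g)); rewrite addr0.
have := dlog_period_mul H 1 1; rewrite mulg1 braid_proj1 invg1 hyperplane_act1 => e.
exact: esym e.
Qed.

(** The intertwiner is diag(c); the second hypothesis is the intertwining relation entry by
    entry. *)
Lemma monomial_equivalent (f g : braid_group z -> hyperplane rW -> R[i])
    (c : hyperplane rW -> R[i]) :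
  (forall H, c H != 0) ->
  (forall b H, c H * f b H = g b H * c ((braid_proj b)^-1%g ^@ H)) ->
  equivalent_rep (fun b => monomial (braid_proj b) (f b))
    (fun b => monomial (braid_proj b) (g b)).
Proof.
move=> c0 cfg; exists (monomial 1%g c).
  exact: (monomial_unit (@hyperplane_act1 R n W rW) (@hyperplane_actM R n W rW)).
move=> b; rewrite [LHS]hyperplane_monomialM [RHS]hyperplane_monomialM mul1g mulg1.
by apply: eq_monomial => H; rewrite invg1 hyperplane_act1.
Qed.

Lemma monodromy_monomial h : monodromy (z := z) alpha h =
  fun b => monomial (braid_proj b) (fun H => cexp (h * J H b)).
Proof. by apply/funext => b; exact: monodromyE. Qed.

(** Adding the coboundary of c to the additive cocycle J leaves it a cocycle, and its exponential is
    multiplicative. *)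
Lemma twisted_representation (c : hyperplane rW -> R[i]) (h : R[i]) :
  is_representation (fun b : braid_group z => monomial (braid_proj b)
    (fun H => cexp (h * (c H + J H b - c ((braid_proj b)^-1%g ^@ H))))).
Proof.
split=> [|a b].
  rewrite braid_proj1 -(monomial1 _ (@hyperplane_act1 R n W rW)); apply: eq_monomial => H.
  by rewrite invg1 hyperplane_act1 dlog_period1 addr0 subrr mulr0 cexp0.
rewrite [RHS]hyperplane_monomialM braid_proj_mul.
apply: eq_monomial => H; rewrite -cexpD dlog_period_mul invMg hyperplane_actM.
by congr cexp; ring.
Qed.

End MonodromyRepresentation.

Theorem proposition5p12 (R : realType) (n : nat) (W : finGroupType)
    (rW : mx_representation R [set: W]%G n) (G : 'M[R]_n)
    (alpha : hyperplane rW -> 'Hom('cV[R[i]]_n, R[i]))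
    (C : set 'cV[R]_n) (z : real_complement rW)
    (Hw : 'I_n -> hyperplane rW) (s : 'I_n -> W)
    (sigma : 'I_n -> braid_group z)
    (n_gt0 : (0 < n)%N)
    (W_refl : is_reflection_group rW)
    (W_ess : is_essential rW)
    (G_inv : invariant_scalar_product rW G)
    (alphaP : forall H, lker (alpha H) = H)
    (C_chamber : is_chamber rW C)
    (zC : C (set_val z))
    (Hw_inj : injective Hw)
    (HwP : forall H, is_wall C H <-> exists i, H = Hw i)
    (sP : forall i, is_reflection rW (s i) /\ fix_space rW (s i) = Hw i)
    (sigmaP : forall i, is_artin_generator G (Hw i) (s i) (sigma i)) :
  [/\ forall h : R[i],
        exists rho : braid_group z -> 'M[R[i]]_#|hyperplane rW|,
          [/\ is_representation rho,
              forall i, rho (sigma i) =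
                permutation_rep rW (s i)
                  *m mxexp ((0 +i* pi) * h *: hyperplane_proj (Hw i))
            & equivalent_rep rho (monodromy alpha h)],
      exists rho : mx_representation R[i] [set: W]%G #|hyperplane rW|,
        [/\ forall i H, H != Hw i ->
              rho (s i) *m basis_vec H = basis_vec (hyperplane_act (s i) H),
            forall i, rho (s i) *m basis_vec (Hw i) = - basis_vec (Hw i)
          & equivalent_rep (monodromy alpha 1)
              (fun b : braid_group z => rho (braid_proj b))],
      forall h : R[i],
        equivalent_rep (monodromy (z := z) alpha (h + 2)) (monodromy alpha h)
    & ~ equivalent_rep (monodromy (z := z) alpha 1) (monodromy alpha 0)].
Proof.
have [Wf Wgen] := W_refl.
have Xfree := complement_free G_inv Wf Wgen.
have [A A0 AP] := linform_bound rW alpha.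
pose w0 : braid_group z -> W := @braid_proj R n W rW z.
pose J := fun H (b : braid_group z) => dlog_period alpha H b.
pose N := fun H => (nu G z H)%:C.
have N0 H : N H != 0 by rewrite fmorph_eq0 (nu_neq0 G_inv).
have zX := @base_complement R n W rW z.
(* The exponential is alpha_H(w z) / alpha_H(z), a quotient of signed distances since z and w z are
   real. *)
have expJ H b : cexp (J H b) = (sgn G z (w0 b) H)%:C * N (hyperplane_act (w0 b)^-1%g H) / N H.
  apply: (mulfI (alpha_neq0 alphaP H zX)); rewrite -(cexp_dlog_period alphaP Xfree A0 AP).
  rewrite cplx_act (alpha_cplx G_inv z alphaP) (dot_normal_act G_inv); congr (_ * _).
  by rewrite fmorph_div rmorphM.
have simp i : simple rW G (set_val z) (s i).
  have [Ts sH] := sP i; apply: (wall_simple G_inv Wf C_chamber zC _ Ts sH).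
  by apply/HwP; exists i.
have sL i : fix_space rW (s i) = Hw i by have [] := sP i.
have projs i : w0 (sigma i) = s i by have [] := sigmaP i.
have sK i : ((s i)^-1)%g = s i.
  have [Ts _] := sP i; exact: (reflectionK G_inv Wf (base_regular z) Ts).
have sHw i : hyperplane_act (s i) (Hw i) = Hw i.
  exact: (act_simple_wall G_inv Wf (sL i) (simp i)).
have sneq i H : (hyperplane_act (s i) H == Hw i) = (H == Hw i).
  by rewrite -{1}(sHw i) (inj_eq (can_inj (hyperplane_actK _))).
split.
(* Twisting by l = ln nu cancels the period of sigma_i off its wall, and leaves i pi on the wall
   because s_i fixes it. *)
- move=> h; pose l := fun H => (ln (nu G z H))%:C : R[i].
  exists (fun b : braid_group z => monomial (@hyperplane_act R n W rW) (w0 b)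
    (fun H => cexp (h * (l H + J H b - l (hyperplane_act (w0 b)^-1%g H))))); split.
  + exact: (twisted_representation alphaP Xfree A0 AP).
  + move=> i; rewrite permutation_repE mxexp_projE.
    rewrite [RHS]hyperplane_monomialM mulg1 projs.
    apply: eq_monomial => H; rewrite mul1r sK sneq /J.
    rewrite (artin_period G_inv alphaP Xfree A0 AP (sL i) (simp i) (sigmaP i)) sK.
    have [->|HL] := eqVneq H (Hw i).
      by rewrite sHw addrAC subrr add0r mulrC.
    by rewrite /l rmorphB [X in X - _]addrC subrK subrr mulr0 cexp0.
  + rewrite monodromy_monomial.
    (* The intertwiner goes from the twisted representation to R_h, hence it is the inverse of
       diag(nu_H^h). *)
    apply: (@monomial_equivalent _ _ _ _ _ _ _ (fun H => cexp (- (h * l H)))).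
      by move=> H; exact: cexp_neq0.
    by move=> b H; rewrite -!cexpD; congr cexp; rewrite /J /w0; ring.
- have reprP : mx_repr [set: W]%G (fun w => monomial (@hyperplane_act R n W rW) w
      (fun H => (sgn G z w H)%:C)).
    split=> [|w w' _ _].
      rewrite -(monomial1 _ (@hyperplane_act1 R n W rW)); apply: eq_monomial => H.
      by rewrite (sgn1 G_inv).
    rewrite [RHS]hyperplane_monomialM; apply: eq_monomial => H.
    by rewrite (sgnM G_inv) rmorphM.
  exists (MxRepresentation reprP); split.
  + move=> i H HL /=; rewrite monomial_basis (sgn_simple G_inv (sL i) (simp i)) ?sneq //.
    by rewrite scale1r.
  + move=> i /=; rewrite monomial_basis sHw (sgn_simple_wall G_inv Wf (sL i) (simp i)).
    by rewrite rmorphN scaleN1r.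
  + rewrite monodromy_monomial; apply: (@monomial_equivalent _ _ _ _ _ _ _ N) => // b H.
    by rewrite mul1r -/(J H b) expJ mulrC divfK.
- move=> h; rewrite !monodromy_monomial.
  apply: (@monomial_equivalent _ _ _ _ _ _ _ (fun H => N H ^+ 2)) => [H|b H].
    by rewrite expf_neq0.
  (* The extra factor exp(J)^2 is the square of a ratio of distances, as the sign squares to 1. *)
  rewrite mulrDl cexpD (_ : 2 * _ = J H b + J H b); last by rewrite mulr_natl.
  rewrite cexpD expJ -/(w0 b).
  have s2 : (sgn G z (w0 b) H)%:C * (sgn G z (w0 b) H)%:C = 1 :> R[i].
    by rewrite -rmorphM -expr2 (sgn_sqr G_inv).
  set S := (sgn _ _ _ _)%:C in s2 *; set N' := N (hyperplane_act _ _).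
  rewrite (_ : _ * _ / _ * _ = (S * S) * (N' / N H) ^+ 2); last by ring.
  by rewrite s2 mul1r exprMn mulrCA [N H ^+ 2 * _]mulrCA -exprMn divff // expr1n mulr1.
rewrite !monodromy_monomial => -[P Pu PM].
pose i0 := Ordinal n_gt0.
have trE f : \tr (monomial (@hyperplane_act R n W rW) (s i0) f : 'M[R[i]]_#|hyperplane rW|) =
    \sum_(H | H == hyperplane_act (s i0) H) f H by exact: monomial_trace.
have := PM (sigma i0); rewrite [braid_proj _]projs => /(mxtrace_similar Pu).
rewrite [LHS]trE [RHS]trE => /eqP.
rewrite -subr_eq0 -sumrB.
(* Only hyperplanes fixed by s_i contribute to the traces. For those other than H_i both entries
   equal 1; at H_i they are -1 and 1. *)
rewrite (bigD1 (Hw i0)) ?sHw //= big1 => [|H /andP[/eqP HE HL]].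
  rewrite addr0 mul1r mul0r cexp0 -/(J _ _) expJ projs sK sHw.
  rewrite (sgn_simple_wall G_inv Wf (sL i0) (simp i0)) -mulrA divff // mulr1.
  rewrite rmorphN -opprD oppr_eq0.
  by rewrite rmorph1 -mulr2n pnatr_eq0.
rewrite mul1r mul0r cexp0 -/(J _ _) expJ projs sK -HE.
by rewrite (sgn_simple G_inv (sL i0) (simp i0)) // mul1r divff // subrr.
Qed.
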